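(* Let $n\ge1$. Then $\{B^\lambda\mid\lambda\vdash n\}$ is a complete set of pairwise inequivalent simple $\mathbb{C}B_n^-$-modules (in the $\mathbb{Z}_2$-graded sense), all of type $\mathtt{M}$ when $n$ is even, and all of type $\mathtt{Q}$ when $n$ is odd.
   Context: All algebras and modules are finite-dimensional over $\mathbb{C}$. Modules over a superalgebra $A$ are $\mathbb{Z}_2$-graded, simple means no proper nonzero graded submodule, $\mathrm{Hom}_A(M,N)$ is spanned by all homogeneous (even and odd) linear maps $f$ with $f(am)=(-1)^{|f||a|}af(m)$; isomorphisms may be even or odd. A simple $M$ is of type $\mathtt{M}$ if $\dim\mathrm{Hom}_A(M,M)=1$ and of type $\mathtt{Q}$ if this dimension is $2$. $\mathbb{C}B_n^-$ is the superalgebra with odd generators $t_1,\dots,t_n$ and relations $t_i^2=1$; $t_it_{i+1}t_i=t_{i+1}t_it_{i+1}$ ($1\le i\le n-2$); $(t_it_j)^2=-1$ ($|i-j|>1$); $(t_{n-1}t_n)^4=-1$. $\mathcal{C}l_n$ is the Clifford superalgebra with odd generators $c_1,\dots,c_n$, $c_i^2=1$, $c_ic_j=-c_jc_i$ ($i\ne j$); $U$ is its unique simple module. There is a superalgebra isomorphism $\phi^B:\mathbb{C}B_n^-\to\mathcal{C}l_n\otimes\mathbb{C}S_n$ ($\mathbb{C}S_n$ purely even) with $t_i\mapsto\frac1{\sqrt2}(c_i-c_{i+1})s_i$ for $i<n$ and $t_n\mapsto c_n$, where $s_i=(i,i+1)$. $B^\lambda$ is the pullback via $\phi^B$ of $U\otimes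 S^\lambda$, with $S^\lambda$ the Specht module. *)

(* Defs.v *)
From HB Require Import structures.
From mathcomp Require Import all_boot all_order all_algebra all_fingroup.
From mathcomp Require Import boolp generic_quotient.
Import GRing.Theory Num.Theory.

Set Implicit Arguments.
Unset Strict Implicit.
Unset Printing Implicit Defensive.

Local Open Scope ring_scope.
Local Open Scope quotient_scope.

(* Parities are booleans: [false] is even, [true] is odd, addition is [(+)].
   The scalars enter through a ring morphism [scal] into the centre, and the
   base is [pzRingType], because MathComp's [algType] requires [1 != 0], which
   fails for the endomorphisms of the zero space. *)

HB.mixin Record isSuperAlgebra (C : numClosedFieldType) A of GRing.PzRing A := {
  scal : C -> A;
  scal1 : scal 1 = 1;
  scalD : forall k l, scal (k + l) = scal k + scal l;
  scalM : forall k l, scal (k * l) = scal k * scal l;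
  scalC : forall k a, scal k * a = a * scal k;
  homog : bool -> A -> Prop;
  homog0 : forall p, homog p 0;
  homogD : forall p a b, homog p a -> homog p b -> homog p (a + b);
  homog_scal : forall k, homog false (scal k);
  homogM : forall p q a b, homog p a -> homog q b -> homog (p (+) q) (a * b);
  homog_split : forall a, exists a0 a1,
    [/\ homog false a0, homog true a1 & a = a0 + a1];
  homog_disj : forall a, homog false a -> homog true a -> a = 0
}.

#[short(type="superAlgType")]
HB.structure Definition SuperAlgebra (C : numClosedFieldType) :=
  {A of isSuperAlgebra C A & GRing.PzRing A}.

Arguments scal {C A} k : rename.
Arguments homog {C A} p a : rename.
Arguments homogM {C A p q a b} : rename.

Lemma scal0 (C : numClosedFieldType) (A : superAlgType C) :
  scal (0 : C) = 0 :> A.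
Proof. by apply: (addrI (scal 0)); rewrite -scalD !addr0. Qed.

Lemma scalN1 (C : numClosedFieldType) (A : superAlgType C) :
  scal (-1 : C) = -1 :> A.
Proof. by apply/eqP; rewrite -addr_eq0 -scal1 -scalD addNr scal0. Qed.

Record superhom (C : numClosedFieldType) (A B : superAlgType C) := SuperHom {
  superhom_fun :> A -> B;
  superhom_scal : forall k, superhom_fun (scal k) = scal k;
  superhomD : forall a b, superhom_fun (a + b) = superhom_fun a + superhom_fun b;
  superhomM : forall a b, superhom_fun (a * b) = superhom_fun a * superhom_fun b;
  superhom_homog : forall p a, homog p a -> homog p (superhom_fun a)
}.

Lemma superhom1 (C : numClosedFieldType) (A B : superAlgType C)
  (f : superhom A B) : f 1 = 1.
Proof. by rewrite -(@scal1 C A) superhom_scal scal1. Qed.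

Section SuperhomComp.

Variables (C : numClosedFieldType) (A B D : superAlgType C).
Variables (g : superhom B D) (f : superhom A B).

Fact superhom_comp_scal k : (g \o f) (scal k) = scal k.
Proof. by rewrite /= !superhom_scal. Qed.

Fact superhom_compD a b : (g \o f) (a + b) = (g \o f) a + (g \o f) b.
Proof. by rewrite /= !superhomD. Qed.

Fact superhom_compM a b : (g \o f) (a * b) = (g \o f) a * (g \o f) b.
Proof. by rewrite /= !superhomM. Qed.

Fact superhom_comp_homog p a : homog p a -> homog p ((g \o f) a).
Proof. by move=> pa; apply/superhom_homog/superhom_homog. Qed.

Definition superhom_comp : superhom A D :=
  SuperHom superhom_comp_scal superhom_compD superhom_compM superhom_comp_homog.

End SuperhomComp.

(* The superalgebra presented by generators and relations is the quotient of
   the expressions in the generators by the congruence generated by the axioms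
   of associative unital algebras and the given relations. *)

Inductive expr (K I : Type) : Type :=
| Gen of I
| Cst of K
| Add of expr K I & expr K I
| Mul of expr K I & expr K I.

Arguments Gen {K I} _.
Arguments Cst {K I} _.

Declare Scope expr_scope.
Delimit Scope expr_scope with X.
Bind Scope expr_scope with expr.
Notation "s + t" := (Add s t) : expr_scope.
Notation "s * t" := (Mul s t) : expr_scope.

HB.instance Definition _ (K I : Type) := gen_eqMixin (expr K I).
HB.instance Definition _ (K I : Type) := gen_choiceMixin (expr K I).

Inductive expr_homog (C : numClosedFieldType) (I : Type) (par : I -> bool) :
  bool -> expr C I -> Prop :=
| expr_homog_gen i : expr_homog par (par i) (Gen i)
| expr_homog_cst k : expr_homog par false (Cst k)
| expr_homog_0 p : expr_homog par p (Cst 0)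
| expr_homog_add p s t : expr_homog par p s -> expr_homog par p t ->
    expr_homog par p (s + t)
| expr_homog_mul p q s t : expr_homog par p s -> expr_homog par q t ->
    expr_homog par (p (+) q) (s * t).

Record presentation (C : numClosedFieldType) := Presentation {
  generator : Type;
  gen_parity : generator -> bool;
  relation : expr C generator -> expr C generator -> Prop;
  relation_homog : forall s t, relation s t ->
    exists p, expr_homog gen_parity p s /\ expr_homog gen_parity p t
}.

Section Presented.

Variables (C : numClosedFieldType) (P : presentation C).
Notation T := (expr C (generator P)).

Inductive congr_expr : T -> T -> Prop :=
| ce_rel s t : @relation C P s t -> congr_expr s t
| ce_refl s : congr_expr s s
| ce_sym s t : congr_expr s t -> congr_expr t s
| ce_trans s t u : congr_expr s t -> congr_expr t u -> congr_expr s u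
| ce_add s s' t t' : congr_expr s s' -> congr_expr t t' ->
    congr_expr (s + t) (s' + t')
| ce_mul s s' t t' : congr_expr s s' -> congr_expr t t' ->
    congr_expr (s * t) (s' * t')
| ce_addA s t u : congr_expr (s + (t + u)) (s + t + u)
| ce_addC s t : congr_expr (s + t) (t + s)
| ce_add0 s : congr_expr (Cst 0 + s) s
| ce_mulA s t u : congr_expr (s * (t * u)) (s * t * u)
| ce_mul1 s : congr_expr (Cst 1 * s) s
| ce_mul0 s : congr_expr (Cst 0 * s) (Cst 0)
| ce_mulDl s t u : congr_expr ((s + t) * u) (s * u + t * u)
| ce_mulDr s t u : congr_expr (s * (t + u)) (s * t + s * u)
| ce_cstD k l : congr_expr (Cst (k + l)%R) (Cst k + Cst l)
| ce_cstM k l : congr_expr (Cst (k * l)%R) (Cst k * Cst l)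
| ce_cstC k s : congr_expr (Cst k * s) (s * Cst k).

Definition congr_exprb (s t : T) : bool := `[< congr_expr s t >].

Fact congr_exprb_refl : reflexive congr_exprb.
Proof. by move=> s; apply/asboolP; apply: ce_refl. Qed.

Fact congr_exprb_sym : symmetric congr_exprb.
Proof. by move=> s t; apply/asboolP/asboolP; apply: ce_sym. Qed.

Fact congr_exprb_trans : transitive congr_exprb.
Proof.
by move=> t s u /asboolP st /asboolP tu; apply/asboolP; apply: ce_trans tu.
Qed.

Canonical congr_expr_equiv :=
  EquivRel congr_exprb congr_exprb_refl congr_exprb_sym congr_exprb_trans.

Definition presented : Type := {eq_quot congr_expr_equiv}.
HB.instance Definition _ := Choice.on presented.
HB.instance Definition _ := EqQuotient.on presented.

Definition cls (t : T) : presented := \pi_presented t.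

Lemma clsP s t : cls s = cls t <-> congr_expr s t.
Proof.
split=> [/eqquotP/asboolP //|st].
by apply/eqquotP/asboolP.
Qed.

Lemma clsK (a : presented) : cls (repr a) = a.
Proof. exact: reprK. Qed.

Lemma repr_cls t : congr_expr (repr (cls t)) t.
Proof. by apply/clsP; rewrite clsK. Qed.

Definition padd (a b : presented) := cls (repr a + repr b).
Definition popp (a : presented) := cls (Cst (-1) * repr a).
Definition pmul (a b : presented) := cls (repr a * repr b).

Fact clsD s t : padd (cls s) (cls t) = cls (s + t).
Proof. by apply/clsP/ce_add; apply: repr_cls. Qed.

Fact clsM s t : pmul (cls s) (cls t) = cls (s * t).
Proof. by apply/clsP/ce_mul; apply: repr_cls. Qed.

Fact clsN t : popp (cls t) = cls (Cst (-1) * t).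
Proof. by apply/clsP/ce_mul; [apply: ce_refl | apply: repr_cls]. Qed.

Lemma cls_ind (Q : presented -> Prop) : (forall t, Q (cls t)) -> forall a, Q a.
Proof. by move=> Qcls a; rewrite -(clsK a). Qed.

Fact paddA : associative padd.
Proof.
do 3![elim/cls_ind=> ?]; rewrite !clsD; apply/clsP; exact: ce_addA.
Qed.

Fact paddC : commutative padd.
Proof. do 2![elim/cls_ind=> ?]; rewrite !clsD; apply/clsP; exact: ce_addC. Qed.

Fact padd0 : left_id (cls (Cst 0)) padd.
Proof. elim/cls_ind=> ?; rewrite !clsD; apply/clsP; exact: ce_add0. Qed.

Fact paddN : left_inverse (cls (Cst 0)) popp padd.
Proof.
elim/cls_ind=> t; rewrite clsN clsD; apply/clsP.
apply: ce_trans (ce_mul0 t); rewrite -(addNr 1).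
apply: ce_trans (ce_mul (ce_sym (ce_cstD _ _)) (ce_refl t)).
apply: ce_trans (ce_sym (ce_mulDl _ _ _)).
by apply: ce_add; [apply: ce_refl | apply/ce_sym/ce_mul1].
Qed.

HB.instance Definition _ :=
  GRing.isZmodule.Build presented paddA paddC padd0 paddN.

Fact pmulA : associative pmul.
Proof. do 3![elim/cls_ind=> ?]; rewrite !clsM; apply/clsP; exact: ce_mulA. Qed.

Fact pmul1 : left_id (cls (Cst 1)) pmul.
Proof. elim/cls_ind=> ?; rewrite !clsM; apply/clsP; exact: ce_mul1. Qed.

Fact pmulr1 : right_id (cls (Cst 1)) pmul.
Proof.
elim/cls_ind=> t; rewrite !clsM; apply/clsP.
apply: ce_trans (ce_sym (ce_cstC _ _)) _; exact: ce_mul1.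
Qed.

Fact pmulDl : left_distributive pmul padd.
Proof.
do 3![elim/cls_ind=> ?]; rewrite !(clsM, clsD); apply/clsP; exact: ce_mulDl.
Qed.

Fact pmulDr : right_distributive pmul padd.
Proof.
do 3![elim/cls_ind=> ?]; rewrite !(clsM, clsD); apply/clsP; exact: ce_mulDr.
Qed.

HB.instance Definition _ :=
  GRing.Zmodule_isPzRing.Build presented pmulA pmul1 pmulr1 pmulDl pmulDr.

Lemma cls_add s t : cls (s + t) = cls s + cls t.
Proof. by rewrite -clsD. Qed.

Lemma cls_mul s t : cls (s * t) = cls s * cls t.
Proof. by rewrite -clsM. Qed.

Definition pscal (k : C) : presented := cls (Cst k).

Fact pscal1 : pscal 1 = 1.
Proof. by []. Qed.

Fact pscalD k l : pscal (k + l) = pscal k + pscal l.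
Proof. by rewrite -cls_add; apply/clsP/ce_cstD. Qed.

Fact pscalM k l : pscal (k * l) = pscal k * pscal l.
Proof. by rewrite -cls_mul; apply/clsP/ce_cstM. Qed.

Fact pscalC k (a : presented) : pscal k * a = a * pscal k.
Proof.
by elim/cls_ind: a => t; rewrite -!cls_mul; apply/clsP/ce_cstC.
Qed.

Notation ehomog := (expr_homog (@gen_parity C P)).

Definition presented_homog (p : bool) (a : presented) : Prop :=
  exists2 t, ehomog p t & a = cls t.

Fact presented_homog0 p : presented_homog p 0.
Proof. by exists (Cst 0) => //; apply: expr_homog_0. Qed.

Fact presented_homogD p a b :
  presented_homog p a -> presented_homog p b -> presented_homog p (a + b).
Proof.
move=> [s ps ->] [t pt ->]; exists (s + t)%X; last by rewrite cls_add.
exact: expr_homog_add.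
Qed.

Fact presented_homog_scal k : presented_homog false (pscal k).
Proof. by exists (Cst k) => //; apply: expr_homog_cst. Qed.

Fact presented_homogM p q a b : presented_homog p a -> presented_homog q b ->
  presented_homog (p (+) q) (a * b).
Proof.
move=> [s ps ->] [t qt ->]; exists (s * t)%X; last by rewrite cls_mul.
exact: expr_homog_mul.
Qed.

Fact presented_homog_split a : exists a0 a1,
  [/\ presented_homog false a0, presented_homog true a1 & a = a0 + a1].
Proof.
elim/cls_ind: a; elim=> [i|k|s [a [b [ha hb sab]]] t [c [d [hc hd tcd]]]
  |s [a [b [ha hb sab]]] t [c [d [hc hd tcd]]]].
- have hi : presented_homog (gen_parity i) (cls (Gen i)).
    by exists (Gen i) => //; apply: expr_homog_gen.
  case: (gen_parity i) hi => hi.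
    by exists 0, (cls (Gen i)); split=> //; [apply: presented_homog0|rewrite add0r].
  by exists (cls (Gen i)), 0; split=> //; [apply: presented_homog0|rewrite addr0].
- exists (cls (Cst k)), 0; split; rewrite ?addr0 //; last exact: presented_homog0.
  by exists (Cst k) => //; apply: expr_homog_cst.
- exists (a + c), (b + d); split; try exact: presented_homogD.
  by rewrite cls_add sab tcd addrACA.
- exists (a * c + b * d), (a * d + b * c); split.
  + by apply: presented_homogD;
      [apply: (presented_homogM ha hc) | apply: (presented_homogM hb hd)].
  + by apply: presented_homogD;
      [apply: (presented_homogM ha hd) | apply: (presented_homogM hb hc)].
  + rewrite cls_mul sab tcd mulrDl !mulrDr -!addrA; congr (_ + _).
    by rewrite [RHS]addrC -addrA.
Qed.

Fixpoint expr_sign (t : T) : T :=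
  match t with
  | Gen i => (Cst ((-1) ^+ (gen_parity i)) * Gen i)%X
  | Cst k => Cst k
  | Add s t => (expr_sign s + expr_sign t)%X
  | Mul s t => (expr_sign s * expr_sign t)%X
  end.

Fact expr_sign_homog p t :
  ehomog p t -> cls (expr_sign t) = pscal ((-1) ^+ p) * cls t.
Proof.
elim=> {p t} [i|k|p|p s t _ IHs _ IHt|p q s t _ IHs _ IHt] /=.
- by rewrite cls_mul.
- by rewrite pscal1 mul1r.
- by rewrite -[cls _]/(0 : presented) mulr0.
- by rewrite !cls_add IHs IHt mulrDr.
- rewrite !cls_mul IHs IHt signr_addb pscalM -!mulrA; congr (_ * _).
  by rewrite !mulrA pscalC.
Qed.

Fact expr_sign_congr s t : congr_expr s t ->
  congr_expr (expr_sign s) (expr_sign t).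
Proof.
elim=> {s t} /=; try by move=> *; constructor.
- move=> s t st; have [p [ps pt]] := relation_homog st.
  apply/clsP; rewrite (expr_sign_homog ps) (expr_sign_homog pt).
  by congr (_ * _); apply/clsP/ce_rel.
- by move=> s t u _ st _; apply: ce_trans.
Qed.

Fact presented_homog_disj a :
  presented_homog false a -> presented_homog true a -> a = 0.
Proof.
move=> [s ps ->] [t pt st]; have /clsP/expr_sign_congr/clsP := st.
rewrite (expr_sign_homog ps) (expr_sign_homog pt) -st pscal1 mul1r => e.
have {e} s0 : pscal 2%:R * cls s = 0.
  by rewrite (pscalD 1 1) mulrDl pscal1 mul1r {2}e -{1}[cls s]mul1r -pscal1
    -mulrDl -pscalD subrr -[pscal 0]/(0 : presented) mul0r.
rewrite -[LHS]mul1r -pscal1 -(@mulVf C 2%:R) ?pnatr_eq0 //.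
by rewrite pscalM -mulrA s0 mulr0.
Qed.

HB.instance Definition _ := isSuperAlgebra.Build C presented
  pscal1 pscalD pscalM pscalC presented_homog0 presented_homogD
  presented_homog_scal presented_homogM presented_homog_split
  presented_homog_disj.

Lemma scalE k : scal k = cls (Cst k).
Proof. by []. Qed.

Definition gen (i : generator P) : presented := cls (Gen i).

Lemma gen_homog i : homog (gen_parity i) (gen i).
Proof. by exists (Gen i) => //; apply: expr_homog_gen. Qed.

Lemma relationE s t : @relation C P s t -> cls s = cls t.
Proof. by move=> st; apply/clsP/ce_rel. Qed.

End Presented.

Arguments gen {C P} i.
Arguments cls {C P} t.

Section Lift.

Variables (C : numClosedFieldType) (P : presentation C) (B : superAlgType C).
Variable x : generator P -> B.

Fixpoint eval_expr (t : expr C (generator P)) : B :=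
  match t with
  | Gen i => x i
  | Cst k => scal k
  | Add s t => eval_expr s + eval_expr t
  | Mul s t => eval_expr s * eval_expr t
  end.

Hypothesis xpar : forall i, homog (gen_parity i) (x i).
Hypothesis xrel : forall s t, relation s t -> eval_expr s = eval_expr t.

Fact eval_congr s t : congr_expr s t -> eval_expr s = eval_expr t.
Proof.
elim=> {s t} /=.
- exact: xrel.
- by [].
- by [].
- by move=> s t u _ ->.
- by move=> s s' t t' _ -> _ ->.
- by move=> s s' t t' _ -> _ ->.
- by move=> *; rewrite addrA.
- by move=> *; rewrite addrC.
- by move=> *; rewrite scal0 add0r.
- by move=> *; rewrite mulrA.
- by move=> *; rewrite scal1 mul1r.
- by move=> *; rewrite scal0 mul0r.
- by move=> *; rewrite mulrDl.
- by move=> *; rewrite mulrDr.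
- by move=> *; rewrite scalD.
- by move=> *; rewrite scalM.
- by move=> *; rewrite scalC.
Qed.

Definition lift_fun (a : presented P) : B := eval_expr (repr a).

Fact lift_cls t : lift_fun (cls t) = eval_expr t.
Proof. exact/eval_congr/repr_cls. Qed.

Fact lift_scal k : lift_fun (scal k) = scal k.
Proof. exact: lift_cls. Qed.

Fact liftD a b : lift_fun (a + b) = lift_fun a + lift_fun b.
Proof.
by elim/cls_ind: a => s; elim/cls_ind: b => t; rewrite -cls_add !lift_cls.
Qed.

Fact liftM a b : lift_fun (a * b) = lift_fun a * lift_fun b.
Proof.
by elim/cls_ind: a => s; elim/cls_ind: b => t; rewrite -cls_mul !lift_cls.
Qed.

Fact lift_homog p a : homog p a -> homog p (lift_fun a).
Proof.
move=> [t pt ->]; rewrite lift_cls.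
elim: pt => {p t} [i|k|p|p s t _ IHs _ IHt|p q s t _ IHs _ IHt] /=.
- exact: xpar.
- exact: homog_scal.
- by rewrite scal0; apply: homog0.
- exact: homogD.
- exact: homogM.
Qed.

Definition plift : superhom (presented P) B :=
  SuperHom lift_scal liftD liftM lift_homog.

Lemma plift_gen i : plift (gen i) = x i.
Proof. exact: lift_cls. Qed.

End Lift.

HB.mixin Record hasParity (C : numClosedFieldType) V of Vector C V := {
  part : bool -> {vspace V};
  part_disj : (part false :&: part true = 0)%VS;
  part_full : (part false + part true = fullv)%VS
}.

#[short(type="superVectType")]
HB.structure Definition SuperVector (C : numClosedFieldType) :=
  {V of hasParity C V & Vector C V}.

Arguments part {C V} p : rename.

Definition map_homog (C : numClosedFieldType) (V W : superVectType C)
    (p : bool) (f : 'Hom(V, W)) : Prop :=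
  forall q, (f @: part q <= part (q (+) p))%VS.

Section SuperSpace.

Variables (C : numClosedFieldType) (V : superVectType C).

Lemma part_disjC p : (part p :&: part (~~ p) = 0 :> {vspace V})%VS.
Proof. by case: p => /=; [rewrite capvC|]; rewrite part_disj. Qed.

Lemma part_fullC p : (part p + part (~~ p) = fullv :> {vspace V})%VS.
Proof. by case: p => /=; [rewrite addvC|]; rewrite part_full. Qed.

Definition part_proj (p : bool) : 'End(V) := daddv_pi (part p) (part (~~ p)).

Lemma part_projP p v : part_proj p v \in (part p : {vspace V}).
Proof. exact: memv_pi. Qed.

Lemma part_proj_id p v : v \in (part p : {vspace V}) -> part_proj p v = v.
Proof. by apply: daddv_pi_id; apply: part_disjC. Qed.

Lemma part_projD (v : V) : part_proj false v + part_proj true v = v.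
Proof. by apply: daddv_pi_add; rewrite ?part_disj // part_full memvf. Qed.

Lemma part_proj0 p v : v \in (part (~~ p) : {vspace V}) -> part_proj p v = 0.
Proof.
move=> vp; have := part_projD v; have := part_proj_id vp.
case: p {vp} => /= ->; first by move/eqP; rewrite addrC -subr_eq0 addrK => /eqP.
by move/eqP; rewrite -subr_eq0 addrK => /eqP.
Qed.

(* The p-th power of the involution that is (-1)^q on the part of parity q *)
Definition invol (p : bool) : 'End(V) :=
  if p then (part_proj false - part_proj true)%R else \1%VF.

Lemma involE p q v : v \in (part q : {vspace V}) ->
  invol p v = (-1) ^+ (p && q) *: v.
Proof.
case: p => /=; last by rewrite id_lfunE scale1r.
rewrite add_lfunE opp_lfunE; case: q => vq /=.
  by rewrite (part_proj_id vq) (part_proj0 (p := false)) // sub0r scaleN1r.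
by rewrite (part_proj_id vq) (part_proj0 (p := true)) // subr0 scale1r.
Qed.

Lemma part_ext (W : vectType C) (f g : 'Hom(V, W)) :
  (forall q v, v \in (part q : {vspace V}) -> f v = g v) -> f = g.
Proof.
move=> fg; apply/lfunP=> v; rewrite -[v]part_projD !linearD /=.
by rewrite !(fg _ _ (part_projP _ _)).
Qed.

Lemma map_homogP (W : superVectType C) p (f : 'Hom(V, W)) :
  map_homog p f <->
  (forall q v, v \in (part q : {vspace V}) -> f v \in (part (q (+) p) : {vspace W})).
Proof.
split=> [fp q v vq|fp q].
  by apply: (subvP (fp q)); apply: memv_img.
by apply/subvP=> _ /memv_imgP[v vq ->]; apply: fp.
Qed.

Lemma invol_homog p : map_homog false (invol p).
Proof.
apply/map_homogP=> q v vq; rewrite addbF (involE _ vq); exact: memvZ.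
Qed.

Definition superEnd : Type := 'End(V).

HB.instance Definition _ := GRing.Zmodule.copy superEnd 'End(V).

Fact superEnd_mulDl : left_distributive (fun f g : superEnd => (f \o g)%VF) +%R.
Proof. by move=> f g h; apply: comp_lfunDl. Qed.

Fact superEnd_mulDr : right_distributive (fun f g : superEnd => (f \o g)%VF) +%R.
Proof. by move=> f g h; apply: comp_lfunDr. Qed.

HB.instance Definition _ := GRing.Zmodule_isPzRing.Build superEnd
  (@comp_lfunA _ _ _ _ _) (@comp_lfun1l _ _ _) (@comp_lfun1r _ _ _)
  superEnd_mulDl superEnd_mulDr.

Definition end_scal (k : C) : superEnd := k *: \1%VF.

Fact end_scal1 : end_scal 1 = 1.
Proof. exact: scale1r. Qed.

Fact end_scalD k l : end_scal (k + l) = end_scal k + end_scal l.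
Proof. exact: scalerDl. Qed.

Fact end_scalM k l : end_scal (k * l) = end_scal k * end_scal l.
Proof.
apply/lfunP=> v; rewrite comp_lfunE !scale_lfunE !id_lfunE.
by rewrite scalerA.
Qed.

Fact end_scalC k (f : superEnd) : end_scal k * f = f * end_scal k.
Proof.
by apply/lfunP=> v; rewrite !comp_lfunE !scale_lfunE !id_lfunE linearZ.
Qed.

Definition end_homog (p : bool) (f : superEnd) : Prop := map_homog p f.

Fact end_homog0 p : end_homog p 0.
Proof. by apply/map_homogP=> q v _; rewrite zero_lfunE mem0v. Qed.

Fact end_homogD p (f g : superEnd) :
  end_homog p f -> end_homog p g -> end_homog p (f + g).
Proof.
move=> /map_homogP fp /map_homogP gp; apply/map_homogP=> q v vq.
by rewrite add_lfunE memvD ?fp ?gp.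
Qed.

Fact end_homog_scal k : end_homog false (end_scal k).
Proof.
apply/map_homogP=> q v vq; rewrite scale_lfunE id_lfunE addbF; exact: memvZ.
Qed.

Fact end_homogM p q (f g : superEnd) :
  end_homog p f -> end_homog q g -> end_homog (p (+) q) (f * g).
Proof.
move=> /map_homogP fp /map_homogP gq; apply/map_homogP=> r v vr.
by rewrite comp_lfunE [p (+) q]addbC addbA fp ?gq.
Qed.

Fact end_homog_split (f : superEnd) : exists f0 f1,
  [/\ end_homog false f0, end_homog true f1 & f = f0 + f1].
Proof.
pose e p q := (part_proj p \o f \o part_proj q)%VF.
exists (e false false + e true true), (e true false + e false true); split.
- apply/map_homogP=> q v vq; rewrite add_lfunE !comp_lfunE addbF.
  case: q vq => vq.
    rewrite (part_proj0 (p := false) vq) !linear0 add0r; exact: part_projP.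
  rewrite (part_proj0 (p := true) vq) !linear0 addr0; exact: part_projP.
- apply/map_homogP=> q v vq; rewrite add_lfunE !comp_lfunE addbT.
  case: q vq => vq.
    rewrite (part_proj0 (p := false) vq) !linear0 add0r; exact: part_projP.
  rewrite (part_proj0 (p := true) vq) !linear0 addr0; exact: part_projP.
- apply/lfunP=> v; rewrite !add_lfunE -[LHS]part_projD.
  have fE p : part_proj p (f v) = e p false v + e p true v.
    by rewrite !comp_lfunE -!linearD part_projD.
  by rewrite !fE [e true _ v + _]addrC addrACA [e false true v + _]addrC.
Qed.

Fact end_homog_disj (f : superEnd) :
  end_homog false f -> end_homog true f -> f = 0.
Proof.
move=> /map_homogP f0 /map_homogP f1; apply: part_ext => q v vq.
apply/eqP; rewrite zero_lfunE -memv0 -(part_disjC q) memv_cap.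
by have := f0 q v vq; have := f1 q v vq; rewrite addbF addbT => -> ->.
Qed.

HB.instance Definition _ := isSuperAlgebra.Build C superEnd
  end_scal1 end_scalD end_scalM end_scalC end_homog0 end_homogD end_homog_scal
  end_homogM end_homog_split end_homog_disj.

End SuperSpace.

Record supermodule (C : numClosedFieldType) (A : superAlgType C) :=
  SuperModule {
    smod_carrier :> superVectType C;
    smod_hom : superhom A (superEnd smod_carrier)
  }.

Definition smod_act (C : numClosedFieldType) (A : superAlgType C)
  (M : supermodule A) (a : A) (m : M) : M := (smod_hom M a : 'End(M)) m.

Definition pullback (C : numClosedFieldType) (A B : superAlgType C)
    (f : superhom A B) (M : supermodule B) : supermodule A :=
  SuperModule (superhom_comp (smod_hom M) f).

Section Modules.

Variables (C : numClosedFieldType) (A : superAlgType C).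
Implicit Types M N : supermodule A.

Definition graded M (S : {vspace M}) : Prop :=
  S = ((S :&: part false) + (S :&: part true))%VS.

Definition graded_submodule M (S : {vspace M}) : Prop :=
  graded S /\ forall a m, m \in S -> smod_act a m \in S.

Definition smod_simple M : Prop :=
  (fullv != 0 :> {vspace M})%VS /\
  forall S : {vspace M}, graded_submodule S -> S = 0%VS \/ S = fullv.

Definition module_hom M N (p : bool) (f : 'Hom(M, N)) : Prop :=
  map_homog p f /\
  forall q (a : A) m, homog q a ->
    f (smod_act a m) = (-1) ^+ (p && q) *: smod_act a (f m).

(* H is the span of the homogeneous homomorphisms, i.e. Hom_A(M, N) *)
Definition is_Hom_space M N (H : {vspace 'Hom(M, N)}) : Prop :=
  (forall p f, module_hom p f -> f \in H) /\
  forall K : {vspace 'Hom(M, N)},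
    (forall p f, module_hom p f -> f \in K) -> (H <= K)%VS.

Definition isomorphic M N : Prop :=
  exists p (f : 'Hom(M, N)),
    [/\ module_hom p f, lker f = 0%VS & limg f = fullv].

Definition typeM M : Prop :=
  smod_simple M /\ exists2 H : {vspace 'Hom(M, M)}, is_Hom_space H & \dim H = 1.

Definition typeQ M : Prop :=
  smod_simple M /\ exists2 H : {vspace 'Hom(M, M)}, is_Hom_space H & \dim H = 2.

End Modules.

(* Homogeneous elements bundled with a parity; 0 occurs with both parities *)
Record helt (C : numClosedFieldType) (A : superAlgType C) := HElt {
  hpar : bool;
  hval : A;
  hvalP : homog hpar hval
}.

Section TensorAlgebra.

Variables (C : numClosedFieldType) (A B : superAlgType C).

(* The tensor product of superalgebras is presented by the homogeneous elements
   of A and of B, subject to the relations making a |-> a (x) 1 and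
   b |-> 1 (x) b superalgebra morphisms, and to the rule of signs
   (1 (x) b) (a (x) 1) = (-1)^(|a||b|) a (x) b. *)
Definition tens_gen : Type := (helt A + helt B)%type.

Definition tens_par (g : tens_gen) : bool :=
  match g with inl a => hpar a | inr b => hpar b end.

Definition tl (a : helt A) : expr C tens_gen := Gen (inl a).
Definition tr (b : helt B) : expr C tens_gen := Gen (inr b).

Inductive tens_rel : expr C tens_gen -> expr C tens_gen -> Prop :=
| tens_l_add (x y z : helt A) : hpar x = hpar z -> hpar y = hpar z ->
    hval z = hval x + hval y -> tens_rel (tl x + tl y) (tl z)
| tens_l_mul (x y z : helt A) : hpar z = hpar x (+) hpar y ->
    hval z = hval x * hval y -> tens_rel (tl x * tl y) (tl z)
| tens_l_scal k (x : helt A) : hpar x = false ->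
    hval x = scal k -> tens_rel (tl x) (Cst k)
| tens_r_add (x y z : helt B) : hpar x = hpar z -> hpar y = hpar z ->
    hval z = hval x + hval y -> tens_rel (tr x + tr y) (tr z)
| tens_r_mul (x y z : helt B) : hpar z = hpar x (+) hpar y ->
    hval z = hval x * hval y -> tens_rel (tr x * tr y) (tr z)
| tens_r_scal k (x : helt B) : hpar x = false ->
    hval x = scal k -> tens_rel (tr x) (Cst k)
| tens_sign (a : helt A) (b : helt B) :
    tens_rel (tr b * tl a) (Cst ((-1) ^+ (hpar a && hpar b)) * (tl a * tr b)).

Fact tens_rel_homog s t : tens_rel s t ->
  exists p, expr_homog tens_par p s /\ expr_homog tens_par p t.
Proof.
have hl a : expr_homog tens_par (hpar a) (tl a).
  exact: (expr_homog_gen C (@tens_par) (inl a)).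
have hr b : expr_homog tens_par (hpar b) (tr b).
  exact: (expr_homog_gen C (@tens_par) (inr b)).
case=> {s t} [x y z xz yz _|x y z zxy _|k x x0 _|x y z xz yz _|x y z zxy _
  |k x x0 _|a b].
- exists (hpar z); split=> //.
  by apply: expr_homog_add; [rewrite -xz | rewrite -yz].
- by exists (hpar z); split=> //; rewrite zxy; apply: expr_homog_mul.
- by exists false; split; [rewrite -x0 | apply: expr_homog_cst].
- exists (hpar z); split=> //.
  by apply: expr_homog_add; [rewrite -xz | rewrite -yz].
- by exists (hpar z); split=> //; rewrite zxy; apply: expr_homog_mul.
- by exists false; split; [rewrite -x0 | apply: expr_homog_cst].
- exists (hpar b (+) hpar a); split; first exact: expr_homog_mul.
  rewrite addbC -[_ (+) _]addFb; apply: expr_homog_mul.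
    exact: expr_homog_cst.
  exact: expr_homog_mul.
Qed.

Definition tens_pres : presentation C := Presentation tens_rel_homog.

Definition tensA : superAlgType C := presented tens_pres.

Definition tens_inl (a : helt A) : tensA := gen (inl a : generator tens_pres).
Definition tens_inr (b : helt B) : tensA := gen (inr b : generator tens_pres).

Lemma tens_inlD x y z : hpar x = hpar z -> hpar y = hpar z ->
  hval z = hval x + hval y -> tens_inl z = tens_inl x + tens_inl y.
Proof.
by move=> xz yz zE; rewrite -cls_add; apply/esym/relationE/tens_l_add.
Qed.

Lemma tens_inlM x y z : hpar z = hpar x (+) hpar y ->
  hval z = hval x * hval y -> tens_inl z = tens_inl x * tens_inl y.
Proof. by move=> zp zE; rewrite -cls_mul; apply/esym/relationE/tens_l_mul. Qed.

Lemma tens_inl_scal k x : hpar x = false -> hval x = scal k ->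
  tens_inl x = scal k.
Proof. by move=> xp xE; apply/relationE/tens_l_scal. Qed.

Lemma tens_inrM x y z : hpar z = hpar x (+) hpar y ->
  hval z = hval x * hval y -> tens_inr z = tens_inr x * tens_inr y.
Proof. by move=> zp zE; rewrite -cls_mul; apply/esym/relationE/tens_r_mul. Qed.

Lemma tens_inr_scal k x : hpar x = false -> hval x = scal k ->
  tens_inr x = scal k.
Proof. by move=> xp xE; apply/relationE/tens_r_scal. Qed.

Lemma tens_swap a b : tens_inr b * tens_inl a =
  scal ((-1) ^+ (hpar a && hpar b)) * (tens_inl a * tens_inr b).
Proof.
by have := relationE (P := tens_pres) (tens_sign a b); rewrite !cls_mul.
Qed.

End TensorAlgebra.

Section TensorSpace.

Import VectorInternalTheory.

(* The tensor product of vector spaces is realised by matrices in coordinates: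
   u (x) w is the product of the column of u and the row of w. *)
Definition tensv (C : numClosedFieldType) (U W : vectType C) : Type :=
  'M[C]_(dim U, dim W).

HB.instance Definition _ (C : numClosedFieldType) (U W : vectType C) :=
  Vector.copy (tensv U W) 'M[C]_(dim U, dim W).

Variables (C : numClosedFieldType).

Definition ptens (U W : vectType C) (u : U) (w : W) : tensv U W :=
  (v2r u)^T *m v2r w.

Lemma ptensDl (U W : vectType C) (u u' : U) (w : W) :
  ptens (u + u') w = ptens u w + ptens u' w.
Proof. by rewrite /ptens !linearD /= mulmxDl. Qed.

Lemma ptensDr (U W : vectType C) (u : U) (w w' : W) :
  ptens u (w + w') = ptens u w + ptens u w'.
Proof. by rewrite /ptens [v2r (_ + _)]linearD mulmxDr. Qed.

Lemma ptensZl (U W : vectType C) k (u : U) (w : W) :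
  ptens (k *: u) w = k *: ptens u w.
Proof. by rewrite /ptens [v2r (_ *: _)]linearZ linearZ -scalemxAl. Qed.

Lemma ptensZr (U W : vectType C) k (u : U) (w : W) :
  ptens u (k *: w) = k *: ptens u w.
Proof. by rewrite /ptens [v2r (_ *: _)]linearZ -scalemxAr. Qed.

Lemma ptens_span (U W : vectType C) (S : {vspace tensv U W}) :
  (forall u w, ptens u w \in S) -> forall x, x \in S.
Proof.
move=> Sp x; rewrite (matrix_sum_delta (x : 'M_(_, _))).
apply: memv_suml => i _; apply: memv_suml => j _; apply: memvZ.
have -> : delta_mx i j = ptens (r2v (delta_mx 0 i)) (r2v (delta_mx 0 j)) :> tensv U W.
  by rewrite /ptens !r2vK trmx_delta mul_delta_mx.
exact: Sp.
Qed.

Lemma ptens_ext (U W X : vectType C) (f g : 'Hom(tensv U W, X)) :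
  (forall u w, f (ptens u w) = g (ptens u w)) -> f = g.
Proof.
move=> fg; apply/lfunP=> x; apply/eqP; rewrite -subr_eq0.
have : x \in lker (f - g)%R.
  apply: ptens_span => u w.
  by rewrite memv_ker add_lfunE opp_lfunE fg subrr.
by rewrite memv_ker add_lfunE opp_lfunE.
Qed.

(* f (x) g without sign; the sign of the super tensor product is put in by
   [invol] in [boxtimes_gen] below. *)
Definition tensf (U W : vectType C) (f : 'End(U)) (g : 'End(W)) :
    'End(tensv U W) :=
  linfun (mulmxr (f2mx g) \o mulmx (f2mx f)^T).

Lemma tensfE (U W : vectType C) (f : 'End(U)) (g : 'End(W)) u w :
  tensf f g (ptens u w) = ptens (f u) (g w).
Proof.
rewrite lfunE /= /ptens.
have E (V : vectType C) (h : 'End(V)) v : v2r (h v) = v2r v *m f2mx h.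
  by rewrite unlock /= r2vK.
by rewrite !E trmx_mul !mulmxA.
Qed.

Lemma tensf_comp (U W : vectType C) (f f' : 'End(U)) (g g' : 'End(W)) :
  (tensf f g \o tensf f' g')%VF = tensf (f \o f')%VF (g \o g')%VF.
Proof. by apply: ptens_ext => u w; rewrite !(comp_lfunE, tensfE). Qed.

Definition tens_vs (U W : vectType C) (A : {vspace U}) (B : {vspace W}) :
    {vspace tensv U W} :=
  <<[seq ptens u w | u <- vbasis A, w <- vbasis B]>>%VS.

Lemma ptens_suml (U W : vectType C) I (r : seq I) (F : I -> U) (w : W) :
  ptens (\sum_(i <- r) F i) w = \sum_(i <- r) ptens (F i) w.
Proof.
elim: r => [|i r IH]; last by rewrite !big_cons ptensDl IH.
by rewrite !big_nil -[0 in LHS](scale0r (0 : U)) ptensZl scale0r.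
Qed.

Lemma ptens_sumr (U W : vectType C) I (r : seq I) (u : U) (F : I -> W) :
  ptens u (\sum_(i <- r) F i) = \sum_(i <- r) ptens u (F i).
Proof.
elim: r => [|i r IH]; last by rewrite !big_cons ptensDr IH.
by rewrite !big_nil -[0 in LHS](scale0r (0 : W)) ptensZr scale0r.
Qed.

Lemma tens_vsP (U W : vectType C) (A : {vspace U}) (B : {vspace W})
    (S : {vspace tensv U W}) :
  (tens_vs A B <= S)%VS <->
  (forall u w, u \in A -> w \in B -> ptens u w \in S).
Proof.
split=> [/subvP SS u w uA wB|SS].
  apply: SS; rewrite (coord_vbasis uA) (coord_vbasis wB) ptens_suml.
  apply: memv_suml => i _; rewrite ptensZl ptens_sumr; apply: memvZ.
  apply: memv_suml => j _; rewrite ptensZr; apply: memvZ.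
  by apply/memv_span/allpairs_f; apply: mem_nth; rewrite size_tuple.
apply/span_subvP=> _ /allpairsP[[u w] [/= ur wr ->]].
by apply: SS; apply: vbasis_mem.
Qed.

End TensorSpace.

Section TensorModule.

Variables (C : numClosedFieldType) (U W : superVectType C).

Definition tens_part (p : bool) : {vspace tensv U W} :=
  (tens_vs (part false) (part p) + tens_vs (part true) (part (~~ p)))%VS.

Lemma tens_partP p (S : {vspace tensv U W}) :
  (tens_part p <= S)%VS <->
  (forall q u w, u \in (part q : {vspace U}) ->
     w \in (part (p (+) q) : {vspace W}) -> ptens u w \in S).
Proof.
rewrite /tens_part; split=> [|SS].
  rewrite subv_add => /andP[/tens_vsP S0 /tens_vsP S1] [] u w.
    by rewrite addbT; apply: S1.
  by rewrite addbF; apply: S0.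
rewrite subv_add; apply/andP; split; apply/tens_vsP=> u w uU wW.
  by apply: SS uU _; rewrite addbF.
by apply: SS uU _; rewrite addbT.
Qed.

Lemma ptens_part q r u w : u \in (part q : {vspace U}) ->
  w \in (part r : {vspace W}) -> ptens u w \in tens_part (q (+) r).
Proof.
move=> uq wr; have /tens_partP := subvv (tens_part (q (+) r)).
by move=> /(_ q u w uq); apply; rewrite addbC addbA addbb.
Qed.

Fact tens_part_disj : (tens_part false :&: tens_part true = 0)%VS.
Proof.
pose s := tensf (invol U true) (invol W true).
have sE p x : x \in tens_part p -> s x = (-1) ^+ p *: x.
  move=> xp; have : x \in lker (s - (-1) ^+ p *: \1%VF)%R.
    apply: (subvP _ _ xp); apply/tens_partP=> q u w uq wq.
    rewrite memv_ker add_lfunE opp_lfunE scale_lfunE id_lfunE tensfE.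
    rewrite (involE _ uq) (involE _ wq) ptensZl ptensZr scalerA.
    by rewrite -signr_addb /= addbC -addbA addbb addbF subrr.
  rewrite memv_ker add_lfunE opp_lfunE scale_lfunE id_lfunE subr_eq0.
  by move/eqP.
apply/eqP; rewrite -subv0; apply/subvP=> x; rewrite memv_cap memv0.
case/andP=> x0 x1; have := sE _ _ x1.
rewrite (sE _ _ x0) /= scale1r scaleN1r => /eqP.
rewrite -addr_eq0 -mulr2n -scaler_nat scaler_eq0.
by rewrite pnatr_eq0.
Qed.

Fact tens_part_full : (tens_part false + tens_part true = fullv)%VS.
Proof.
apply/eqP; rewrite eqEsubv subvf /=; apply/subvP=> x _.
apply: ptens_span x => u w.
have mem q r u' w' : u' \in (part q : {vspace U}) ->
    w' \in (part r : {vspace W}) ->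
    ptens u' w' \in (tens_part false + tens_part true)%VS.
  move=> uq wr; have := ptens_part uq wr.
  case: (q (+) r); first exact: (subvP (addvSr _ _)).
  exact: (subvP (addvSl _ _)).
rewrite -[u]part_projD -[w]part_projD !ptensDl !ptensDr.
by do 2!apply: memvD; apply: mem; apply: part_projP.
Qed.

HB.instance Definition _ := hasParity.Build C (tensv U W)
  tens_part_disj tens_part_full.

Lemma tensf_homog p q (f : 'End(U)) (g : 'End(W)) :
  map_homog p f -> map_homog q g -> map_homog (p (+) q) (tensf f g).
Proof.
move=> /map_homogP fp /map_homogP gq r.
apply/subvP=> _ /memv_imgP[x xr ->]; rewrite memv_preim.
move: x xr; apply/subvP/tens_partP=> t u w ut wt.
rewrite -memv_preim tensfE.
rewrite (_ : r (+) _ = (t (+) p) (+) ((r (+) t) (+) q)).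
  by apply: ptens_part; [apply: fp | apply: gq].
by case: r t p q {fp gq ut wt} => [] [] [] [].
Qed.

End TensorModule.

(* U (x) W as a module over A (x) B:
   (a (x) b) (u (x) w) = (-1)^(|b||u|) a u (x) b w *)
Section BoxTimes.

Variables (C : numClosedFieldType) (A B : superAlgType C).
Variables (U : supermodule A) (W : supermodule B).

Definition boxtimes_gen (g : generator (tens_pres A B)) :
    superEnd (tensv U W) :=
  match g with
  | inl a => tensf (smod_hom U (hval a)) \1%VF
  | inr b => tensf (invol U (hpar b)) (smod_hom W (hval b))
  end.

Fact boxtimes_homog (g : generator (tens_pres A B)) :
  homog (gen_parity g) (boxtimes_gen g).
Proof.
case: g => [a|b] /=.
  rewrite -[hpar a]addbF; apply: tensf_homog; last exact: (invol_homog _ false).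
  exact: (superhom_homog (smod_hom U) (hvalP a)).
rewrite -[hpar b]addFb; apply: tensf_homog; first exact: invol_homog.
exact: (superhom_homog (smod_hom W) (hvalP b)).
Qed.

Lemma invol_comp p q : (invol U p \o invol U q)%VF = invol U (p (+) q).
Proof.
apply: part_ext => r v vr; rewrite comp_lfunE !(involE _ vr) linearZ /=.
rewrite (involE _ vr) scalerA -signr_addb.
by case: p q r {vr} => [] [] [].
Qed.

Lemma tensfDl (f f' : 'End(U)) (g : 'End(W)) :
  tensf (f + f') g = tensf f g + tensf f' g.
Proof.
by apply: ptens_ext => u w; rewrite add_lfunE !tensfE add_lfunE ptensDl.
Qed.

Lemma tensfDr (f : 'End(U)) (g g' : 'End(W)) :
  tensf f (g + g') = tensf f g + tensf f g'.
Proof.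
by apply: ptens_ext => u w; rewrite add_lfunE !tensfE add_lfunE ptensDr.
Qed.

Fact boxtimes_rel (s t : expr C (generator (tens_pres A B))) :
  relation s t -> eval_expr boxtimes_gen s = eval_expr boxtimes_gen t.
Proof.
case=> {s t} [x y z _ _ zE|x y z _ zE|k x _ xE|x y z xz yz zE|x y z zp zE
  |k x xp xE|a b] /=.
- by rewrite zE superhomD -tensfDl.
- by rewrite zE superhomM -[_ * _]/(_ \o _)%VF tensf_comp comp_lfun1l.
- rewrite xE superhom_scal; apply: ptens_ext => u w.
  by rewrite tensfE !scale_lfunE !id_lfunE ptensZl.
- by rewrite zE superhomD xz yz -tensfDr.
- by rewrite zE superhomM zp -[_ * _]/(_ \o _)%VF tensf_comp invol_comp.
- rewrite xE superhom_scal xp; apply: ptens_ext => u w.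
  by rewrite tensfE !scale_lfunE !id_lfunE ptensZr.
- rewrite -![_ * _]/(_ \o _)%VF !tensf_comp comp_lfun1l comp_lfun1r.
  have -> : (invol U (hpar b) \o smod_hom U (hval a) =
      (-1) ^+ (hpar a && hpar b) *: (smod_hom U (hval a) \o invol U (hpar b)))%VF.
    have /map_homogP ha := superhom_homog (smod_hom U) (hvalP a).
    apply: part_ext => q v vq; rewrite scale_lfunE !comp_lfunE.
    rewrite (involE _ vq) (involE _ (ha _ _ vq)) linearZ /= scalerA -signr_addb.
    by case: (hpar a) (hpar b) q {ha vq} => [] [] [].
  apply: ptens_ext => u w.
  by rewrite comp_lfunE !scale_lfunE id_lfunE !tensfE scale_lfunE ptensZl.
Qed.

Definition boxtimes : supermodule (tensA A B) :=
  SuperModule (plift boxtimes_homog boxtimes_rel).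

End BoxTimes.

Fixpoint epow (C : numClosedFieldType) (I : Type) (t : expr C I) (k : nat) :=
  if k is k'.+1 then (t * epow t k')%X else Cst 1.

Section Algebras.

Variables (C : numClosedFieldType) (n : nat).
Notation "t ^ k" := (epow t k) : expr_scope.

(* Generators are numbered from 0: [Gen i] stands for c_(i+1), t_(i+1). *)
Inductive clif_rel : expr C 'I_n -> expr C 'I_n -> Prop :=
| clif_sq i : clif_rel (Gen i ^ 2) (Cst 1)
| clif_anti i j : i != j ->
    clif_rel (Gen i * Gen j) (Cst (-1) * (Gen j * Gen i)).

Inductive bn_rel : expr C 'I_n -> expr C 'I_n -> Prop :=
| bn_sq i : bn_rel (Gen i ^ 2) (Cst 1)
| bn_braid (i j : 'I_n) : j = i.+1 :> nat -> (j.+1 < n)%N ->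
    bn_rel (Gen i * Gen j * Gen i) (Gen j * Gen i * Gen j)
| bn_far (i j : 'I_n) : (i.+1 < j)%N \/ (j.+1 < i)%N ->
    bn_rel ((Gen i * Gen j) ^ 2) (Cst (-1))
| bn_last (i j : 'I_n) : j = i.+1 :> nat -> j.+1 = n ->
    bn_rel ((Gen i * Gen j) ^ 4) (Cst (-1)).

(* MathComp's product of permutations g * h applies g first; the product in
   CS_n is composition of maps, that is h * g. *)
Inductive sym_rel : expr C 'S_n -> expr C 'S_n -> Prop :=
| sym_mul g h : sym_rel (Gen g * Gen h) (Gen (h * g)%g)
| sym_one : sym_rel (Gen 1%g) (Cst 1).

Fact expr_homog_pow (I : Type) (par : I -> bool) p (t : expr C I) k :
  expr_homog par p t -> expr_homog par (odd k && p) (t ^ k)%X.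
Proof.
move=> pt; elim: k => [|k IH] /=; first exact: expr_homog_cst.
have -> : ~~ odd k && p = p (+) (odd k && p) by case: (odd k) (p) => [] [].
exact: expr_homog_mul.
Qed.

Fact expr_homog_gens (i j : 'I_n) :
  [/\ expr_homog (fun=> true) true (Gen i : expr C 'I_n),
      expr_homog (fun=> true) false (Gen i * Gen j : expr C 'I_n) &
      expr_homog (fun=> true) true (Gen i * Gen j * Gen i : expr C 'I_n)].
Proof.
have h (k : 'I_n) : expr_homog (fun=> true) true (Gen k : expr C 'I_n).
  exact: (expr_homog_gen C (fun=> true) k).
have h2 := expr_homog_mul (h i) (h j).
by split=> //; apply: (expr_homog_mul h2 (h i)).
Qed.

Fact clif_rel_homog s t : clif_rel s t ->
  exists p, expr_homog (fun=> true) p s /\ expr_homog (fun=> true) p t.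
Proof.
case=> [i|i j _]; exists false.
  have [h _ _] := expr_homog_gens i i.
  by split; [apply: (expr_homog_pow 2 h) | apply: expr_homog_cst].
have [_ h _] := expr_homog_gens i j.
have [_ h' _] := expr_homog_gens j i.
by split=> //; apply: (expr_homog_mul (expr_homog_cst _ _) h').
Qed.

Fact bn_rel_homog s t : bn_rel s t ->
  exists p, expr_homog (fun=> true) p s /\ expr_homog (fun=> true) p t.
Proof.
case=> [i|i j _ _|i j _|i j _ _].
- have [h _ _] := expr_homog_gens i i; exists false.
  by split; [apply: (expr_homog_pow 2 h) | apply: expr_homog_cst].
- have [_ _ h] := expr_homog_gens i j.
  by have [_ _ h'] := expr_homog_gens j i; exists true.
- have [_ h _] := expr_homog_gens i j; exists false.
  by split; [apply: (expr_homog_pow 2 h) | apply: expr_homog_cst].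
- have [_ h _] := expr_homog_gens i j; exists false.
  by split; [apply: (expr_homog_pow 4 h) | apply: expr_homog_cst].
Qed.

Fact sym_rel_homog s t : sym_rel s t ->
  exists p, expr_homog (fun=> false) p s /\ expr_homog (fun=> false) p t.
Proof.
have h (g : 'S_n) : expr_homog (fun=> false) false (Gen g : expr C 'S_n).
  exact: (expr_homog_gen C (fun=> false) g).
case=> [g g'|]; exists false; split=> //; last exact: expr_homog_cst.
exact: (expr_homog_mul (h g) (h g')).
Qed.

Definition clif_pres := Presentation clif_rel_homog.
Definition bn_pres := Presentation bn_rel_homog.
Definition sym_pres := Presentation sym_rel_homog.

Definition Cl : superAlgType C := presented clif_pres.
Definition CB : superAlgType C := presented bn_pres.
Definition CS : superAlgType C := presented sym_pres.

Definition cgen (i : 'I_n) : Cl := gen (i : generator clif_pres).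
Definition tgen (i : 'I_n) : CB := gen (i : generator bn_pres).
Definition sgen (g : 'S_n) : CS := gen (g : generator sym_pres).

End Algebras.

Arguments cgen {C n} i.
Arguments tgen {C n} i.
Arguments sgen {C n} g.

Lemma eval_pow (C : numClosedFieldType) (P : presentation C)
    (B : superAlgType C) (x : generator P -> B) e k :
  eval_expr x (epow e k) = eval_expr x e ^+ k.
Proof. by elim: k => [|k IH] /=; rewrite ?scal1 // exprS IH. Qed.

Section Phi.

Variables (C : numClosedFieldType) (n : nat).
Notation Cl := (Cl C n).
Notation CS := (CS C n).
Notation D := (tensA Cl CS).

Definition c_helt (i : 'I_n) : helt Cl :=
  HElt (gen_homog (i : generator (clif_pres C n))).
Definition s_helt (g : 'S_n) : helt CS :=
  HElt (gen_homog (g : generator (sym_pres C n))).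

(* c_i (x) 1 and 1 (x) g *)
Definition cD (i : 'I_n) : D := tens_inl CS (c_helt i).
Definition sD (g : 'S_n) : D := tens_inr Cl (s_helt g).

Lemma cD_sq i : cD i * cD i = 1.
Proof.
have h := homogM (hvalP (c_helt i)) (hvalP (c_helt i)).
rewrite -(tens_inlM CS (z := HElt h)) // (tens_inl_scal CS (k := 1)) ?scal1 //=.
by have := relationE (P := clif_pres C n) (clif_sq C i); rewrite !cls_mul mulr1.
Qed.

Lemma cD_anti i j : i != j -> cD i * cD j = - (cD j * cD i).
Proof.
move=> ij.
have hij := homogM (hvalP (c_helt i)) (hvalP (c_helt j)).
have hji := homogM (hvalP (c_helt j)) (hvalP (c_helt i)).
rewrite -(tens_inlM CS (z := HElt hij)) // -(tens_inlM CS (z := HElt hji)) //.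
apply/eqP; rewrite -addr_eq0.
rewrite -(tens_inlD CS (z := HElt (homog0 (s := Cl) false))) //=.
  by rewrite (tens_inl_scal CS (k := 0)) ?scal0.
have := relationE (P := clif_pres C n) (clif_anti C ij).
by rewrite !cls_mul -scalE scalN1 mulN1r => /= ->; rewrite addNr.
Qed.

Lemma sD1 : sD 1%g = 1.
Proof.
rewrite /sD (tens_inr_scal Cl (k := 1)) ?scal1 //=.
exact: (relationE (P := sym_pres C n) (sym_one C n)).
Qed.

Lemma sDM g h : sD g * sD h = sD (h * g)%g.
Proof.
rewrite /sD -(tens_inrM Cl (z := s_helt (h * g)%g)) //=.
have := relationE (P := sym_pres C n) (sym_mul C g h).
by rewrite cls_mul.
Qed.

Lemma sDC g i : sD g * cD i = cD i * sD g.
Proof. by rewrite /sD /cD tens_swap /= scal1 mul1r. Qed.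


(* With i numbered from 0, [insub i.+1] is [Some] of the index i + 1 when
   i + 1 < n, and [None] when i is the last index. *)
Definition phi_gen (i : generator (bn_pres C n)) : D :=
  match insub i.+1 : option 'I_n with
  | Some j => scal (sqrtC 2)^-1 * ((cD i - cD j) * sD (tperm i j))
  | None => cD i
  end.


(* Every phi_gen i is k a g with k scalar, a in Cl_n and g in S_n *)
Definition normal (k : C) (a : D) (g : 'S_n) : D := scal k * (a * sD g).
Definition comm_sD (a : D) := forall g, sD g * a = a * sD g.

Lemma normalM k a g l b h : comm_sD b ->
  normal k a g * normal l b h = normal (k * l) (a * b) (h * g)%g.
Proof.
move=> bC; rewrite /normal scalM -sDM.
have -> : scal k * (a * sD g) * (scal l * (b * sD h)) =
          scal k * (a * (sD g * scal l) * b * sD h) by rewrite !mulrA.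
rewrite -(scalC l (sD g)).
have -> : a * (scal l * sD g) * b * sD h = (a * scal l) * (sD g * b) * sD h.
  by rewrite !mulrA.
by rewrite bC -(scalC l a) !mulrA.
Qed.

Lemma comm_sDM a b : comm_sD a -> comm_sD b -> comm_sD (a * b).
Proof. by move=> aC bC g; rewrite mulrA aC -mulrA bC mulrA. Qed.

Lemma comm_sDB i j : comm_sD (cD i - cD j).
Proof. by move=> g; rewrite mulrBr mulrBl !sDC. Qed.

Lemma normalN k a : normal k (- a) 1%g = - (scal k * a).
Proof. by rewrite /normal sD1 mulr1 mulrN. Qed.

Definition phi_k (i : 'I_n) : C :=
  if (insub i.+1 : option 'I_n) is Some _ then (sqrtC 2)^-1 else 1.
Definition phi_a (i : 'I_n) : D :=
  if (insub i.+1 : option 'I_n) is Some j then cD i - cD j else cD i.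
Definition phi_g (i : 'I_n) : 'S_n :=
  if (insub i.+1 : option 'I_n) is Some j then tperm i j else 1%g.

Lemma phi_genE i : phi_gen i = normal (phi_k i) (phi_a i) (phi_g i).
Proof.
rewrite /phi_gen /phi_k /phi_a /phi_g; case: insubP => // _.
by rewrite /normal scal1 sD1 mul1r mulr1.
Qed.

Lemma phi_aC i : comm_sD (phi_a i).
Proof.
rewrite /phi_a; case: insubP => [j _ _|_]; first exact: comm_sDB.
by move=> g; apply: sDC.
Qed.

Lemma phi_gg i : (phi_g i * phi_g i)%g = 1%g.
Proof. by rewrite /phi_g; case: insubP => [j _ _|_]; rewrite ?tperm2 ?mulg1. Qed.

Lemma sqrt2V : (sqrtC 2)^-1 * (sqrtC 2)^-1 = 2^-1 :> C.
Proof. by rewrite -invfM -expr2 sqrtCK. Qed.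

Lemma scal2 : scal (2 : C) = 1 + 1 :> D.
Proof. by rewrite (scalD 1 1) !scal1. Qed.

Lemma scal_half : scal (2^-1 : C) * (1 + 1) = 1 :> D.
Proof. by rewrite -scal2 -scalM mulVf ?scal1 ?pnatr_eq0. Qed.

Lemma cDB_sq (i j : 'I_n) : i != j -> (cD i - cD j) * (cD i - cD j) = 1 + 1.
Proof.
move=> ij; rewrite mulrBr !mulrBl !cD_sq (cD_anti ij).
by rewrite opprB opprK [RHS]addrC; rewrite !addrA addrAC subrK.
Qed.

Lemma next_neq (i j : 'I_n) : j = i.+1 :> nat -> i != j.
Proof. by move=> e; rewrite -val_eqE /= e ltn_eqF. Qed.

Lemma phi_aa i : scal (phi_k i * phi_k i) * (phi_a i * phi_a i) = 1.
Proof.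
rewrite /phi_k /phi_a; case: insubP => [j _ ji|_].
  by rewrite sqrt2V cDB_sq ?scal_half // next_neq.
by rewrite mulr1 scal1 mul1r cD_sq.
Qed.

Definition anti (a b : D) := a * b = - (b * a).

Lemma anti_sym a b : anti a b -> anti b a.
Proof. by rewrite /anti => ->; rewrite opprK. Qed.

Lemma antiBr x y z : anti x y -> anti x z -> anti x (y - z).
Proof. by rewrite /anti => xy xz; rewrite mulrBr mulrBl xy xz opprB opprK addrC. Qed.

Lemma antiBl x y z : anti y x -> anti z x -> anti (y - z) x.
Proof. by move=> yx zx; apply/anti_sym/antiBr; apply: anti_sym. Qed.

Lemma cD_lt (x y : 'I_n) : (x < y)%N -> anti (cD x) (cD y).
Proof. by move=> xy; apply: cD_anti; rewrite -val_eqE /= ltn_eqF. Qed.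

Lemma phi_far (i j : 'I_n) : (i.+1 < j)%N ->
  anti (phi_a i) (phi_a j) /\ commute (phi_g i) (phi_g j).
Proof.
move=> ij; have ij' : (i < j)%N by apply: leq_trans ij.
rewrite /phi_a /phi_g; case: insubP => [i' _ iE|]; last first.
  by move/negP; case; apply: (leq_trans ij); apply: ltnW.
have i'j : (i' < j)%N by rewrite [nat_of_ord i']iE.
case: insubP => [j' _ jE|_]; last first.
  by split; [apply: antiBl; apply: cD_lt | apply: commute1].
have jj' : (j < j')%N by rewrite [nat_of_ord j']jE.
have ij'2 := ltn_trans ij' jj'; have i'j'2 := ltn_trans i'j jj'.
split; first by apply: antiBr; apply: antiBl; apply: cD_lt.
apply/commgP/conjg_fixP; rewrite tpermJ !tpermD // -val_eqE /= gtn_eqF //.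
Qed.

Lemma phi_far_rel (i j : 'I_n) : (i.+1 < j)%N \/ (j.+1 < i)%N ->
  (phi_gen i * phi_gen j) ^+ 2 = -1.
Proof.
move=> ij; have [ab gh] : anti (phi_a i) (phi_a j) /\ commute (phi_g i) (phi_g j).
  case: ij => [/phi_far//|/phi_far[/anti_sym ab /commute_sym]]; by split.
rewrite !phi_genE (normalM _ _ _ _ _ (phi_aC j)) expr2.
rewrite (normalM _ _ _ _ _ (comm_sDM (phi_aC i) (phi_aC j))).
set k := phi_k i; set l := phi_k j.
set a := phi_a i; set b := phi_a j.
have -> : (phi_g j * phi_g i * (phi_g j * phi_g i) = 1)%g.
  by rewrite -{1}gh -mulgA (mulgA (phi_g j)) phi_gg mul1g phi_gg.
have -> : a * b * (a * b) = - ((a * a) * (b * b)).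
  by rewrite -mulrA (mulrA b) -[b * a]opprK -[- (b * a)]ab mulNr mulrN !mulrA.
rewrite normalN -[RHS]/(- (1 : D)); congr (- _).
rewrite [k * l * _]mulrACA scalM -(mulrA (scal (k * k))) (mulrA (scal (l * l))).
by rewrite (scalC (l * l)) -(mulrA (a * a)) phi_aa mulr1 phi_aa.
Qed.

Lemma phi_next (i j : 'I_n) : j = i.+1 :> nat ->
  phi_gen i = normal (sqrtC 2)^-1 (cD i - cD j) (tperm i j).
Proof.
move=> ji; rewrite /phi_gen; case: insubP => [j' _ j'i|]; last first.
  by rewrite -ji ltn_ord.
by rewrite (_ : j' = j) //; apply: val_inj; rewrite [LHS]j'i.
Qed.

Lemma phi_last (i : 'I_n) : i.+1 = n -> phi_gen i = normal 1 (cD i) 1%g.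
Proof.
move=> ni; rewrite /phi_gen; case: insubP => [j' lt _|_].
  by exfalso; move: lt; rewrite {1}ni ltnn.
by rewrite /normal scal1 sD1 mul1r mulr1.
Qed.

Lemma comm_cD i : comm_sD (cD i).
Proof. by move=> g; apply: sDC. Qed.

Lemma phi_sq i : phi_gen i ^+ 2 = 1.
Proof.
rewrite phi_genE expr2 normalM ?phi_gg; last exact: phi_aC.
by rewrite /normal sD1 mulr1 phi_aa.
Qed.

Lemma braid_ring (a b : D) : a * a = 1 + 1 -> b * b = 1 + 1 ->
  (a + b) * (a + b) = 1 + 1 -> a * b * a = b * a * b.
Proof.
move=> aa bb abab.
have ab : a * b = - (1 + 1) - b * a.
  move: abab; rewrite mulrDl !mulrDr aa bb -addrA -[RHS]addr0 => /addrI /eqP.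
  by rewrite addrA addr_eq0 => /eqP abba; apply: (canRL (addrK _)).
rewrite {1}ab mulrBl mulNr -[b * a * a]mulrA aa -mulrA ab mulrBr mulrN mulrA bb.
by rewrite addrC.
Qed.

Lemma phi_braid (i j : 'I_n) : j = i.+1 :> nat -> (j.+1 < n)%N ->
  phi_gen i * phi_gen j * phi_gen i = phi_gen j * phi_gen i * phi_gen j.
Proof.
move=> ji jn; pose l := Ordinal jn.
have ij : i != j by apply: next_neq.
have jl : j != l by apply: next_neq.
have il : i != l by rewrite -val_eqE /= ji ltn_eqF.
rewrite (phi_next ji) (@phi_next j l erefl).
do 4!(rewrite normalM; last exact: comm_sDB); congr (normal _ _ _).
  by apply: braid_ring; rewrite ?addrA ?subrK; apply: cDB_sq.
have e (x y z : 'I_n) : x != z -> y != z -> x != y ->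
    (tperm x y * (tperm y z * tperm x y) = tperm x z)%g.
  move=> xz yz xy; rewrite -{1}tpermV -/(conjg _ _) tpermJ tpermR tpermD //.
by rewrite e // (tpermC j l) (tpermC i j) e 1?eq_sym // tpermC.
Qed.

Lemma phi_last_rel (i j : 'I_n) : j = i.+1 :> nat -> j.+1 = n ->
  (phi_gen i * phi_gen j) ^+ 4 = -1.
Proof.
move=> ji jn; have ij := next_neq ji.
rewrite (phi_next ji) (phi_last jn) normalM; last exact: comm_cD.
rewrite mulr1 mul1g mulrBl cD_sq; set x := _ - 1.
have xC : comm_sD x.
  move=> g; rewrite /x mulrBr mulrBl mulr1 mul1r.
  by rewrite (comm_sDM (comm_cD i) (comm_cD j)).
have y2 : (cD i * cD j) * (cD i * cD j) = - (1 : D).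
  rewrite {1}(cD_anti ij) mulNr -[cD j * _ * _]mulrA [cD i * (_ * _)]mulrA cD_sq.
  by rewrite mul1r cD_sq.
have x2 : x * x = - ((1 + 1) * (cD i * cD j)).
  rewrite /x mulrBr mulrBl y2 mul1r mulr1 mulrDl !mul1r opprB addrA.
  by rewrite [- 1 - _]addrC addrNK -opprD.
rewrite (exprM _ 2 2) !expr2 (normalM _ _ _ _ _ xC) tperm2 sqrt2V x2.
by rewrite normalN mulrA scal_half mul1r mulrN mulNr opprK.
Qed.

Fact phi_rel s1 s2 : relation s1 s2 ->
  eval_expr phi_gen s1 = eval_expr phi_gen s2.
Proof.
case=> {s1 s2} [i|i j ji jn|i j ij|i j ji jn].
- by rewrite eval_pow [RHS]scal1 phi_sq.
- exact: phi_braid.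
- by rewrite eval_pow [RHS]scalN1 phi_far_rel.
- by rewrite eval_pow [RHS]scalN1 phi_last_rel.
Qed.

Fact phi_homog i : homog (gen_parity i) (phi_gen i).
Proof.
have cDh k : homog true (cD k).
  exact: (gen_homog (inl (c_helt k) : generator (tens_pres Cl CS))).
have sDh g : homog false (sD g).
  exact: (gen_homog (inr (s_helt g) : generator (tens_pres Cl CS))).
rewrite /phi_gen; case: insubP => [j _ _|_]; last exact: cDh.
apply: (homogM (p := false) (q := true)); first exact: homog_scal.
apply: (homogM (p := true) (q := false)) => //.
apply: homogD => //; rewrite -mulN1r -scalN1.
by apply: (homogM (p := false) (q := true)); first exact: homog_scal.
Qed.

Definition phiB : superhom (CB C n) D := plift phi_homog phi_rel.

Lemma phiB_gen i : phiB (tgen i) = phi_gen i.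
Proof. exact: plift_gen. Qed.

End Phi.

Definition evenv (C : numClosedFieldType) (V : vectType C) : Type := V.

HB.instance Definition _ (C : numClosedFieldType) (V : vectType C) :=
  Vector.copy (evenv V) V.

Definition evenv_part (C : numClosedFieldType) (V : vectType C) (p : bool) :
  {vspace evenv V} := if p then 0%VS else fullv.

Fact evenv_disj (C : numClosedFieldType) (V : vectType C) :
  (evenv_part V false :&: evenv_part V true = 0)%VS.
Proof. exact: capv0. Qed.

Fact evenv_full (C : numClosedFieldType) (V : vectType C) :
  (evenv_part V false + evenv_part V true = fullv)%VS.
Proof. exact: addv0. Qed.

HB.instance Definition _ (C : numClosedFieldType) (V : vectType C) :=
  hasParity.Build C (evenv V) (evenv_disj V) (evenv_full V).

Definition is_partition (n : nat) (lam : seq nat) : bool :=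
  [&& sorted geq lam, 0%N \notin lam & sumn lam == n].

Section Specht.

Variables (C : numClosedFieldType) (n : nat) (lam : seq nat).

(* The cells of the diagram of lam are numbered from 0 in row reading order, and
   a tableau is a permutation t mapping the number of a cell to its entry. *)
Definition tab_row (t : 'S_n) (i : 'I_n) : nat :=
  reshape_index lam (t^-1%g i).
Definition tab_col (t : 'S_n) (i : 'I_n) : nat :=
  reshape_offset lam (t^-1%g i).

(* A tabloid is recorded by the row of each entry, which is at most n. *)
Definition tabloid : finType := {ffun 'I_n -> 'I_n.+1}.
Definition tabloid_of (t : 'S_n) : tabloid := [ffun i => inord (tab_row t i)].

Definition tabloid_space : vectType C := {ffun tabloid -> C^o}.
Definition tabloid_vec (f : tabloid) : tabloid_space :=
  [ffun f' => (f' == f)%:R].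

Definition col_stab (t : 'S_n) : {set 'S_n} :=
  [set s : 'S_n | [forall i, tab_col t (s i) == tab_col t i]].

(* t * s is the tableau s t, because MathComp composes from left to right *)
Definition polytabloid (t : 'S_n) : tabloid_space :=
  \sum_(s in col_stab t) (-1) ^+ s *: tabloid_vec (tabloid_of (t * s)%g).

Definition specht : {vspace tabloid_space} :=
  <<[seq polytabloid t | t : 'S_n]>>%VS.

(* g maps the tabloid with row function f to the one with row function
   f \o g^-1. *)
Definition perm_fun (g : 'S_n) (v : tabloid_space) : tabloid_space :=
  [ffun f : tabloid => v [ffun i => f (g i)]].

Fact perm_fun_linear g : linear (perm_fun g).
Proof. by move=> k u v; apply/ffunP=> f; rewrite !ffunE. Qed.

HB.instance Definition _ g := GRing.isLinear.Build C tabloid_space tabloid_space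
  _ (perm_fun g) (perm_fun_linear g).

Definition perm_act (g : 'S_n) : 'End(tabloid_space) := linfun (perm_fun g).

Lemma perm_act_vec g f :
  perm_act g (tabloid_vec f) = tabloid_vec [ffun i => f (g^-1%g i)].
Proof.
apply/ffunP=> f'; rewrite lfunE !ffunE; congr (nat_of_bool _)%:R.
apply/eqP/eqP=> [<-|->]; apply/ffunP=> i; rewrite !ffunE ?permK ?permKV //.
Qed.

Lemma perm_actM g h : perm_act (h * g)%g = (perm_act g \o perm_act h)%VF.
Proof.
apply/lfunP=> v; rewrite comp_lfunE !lfunE; apply/ffunP=> f; rewrite !ffunE.
by congr (v _); apply/ffunP=> i; rewrite !ffunE permM.
Qed.

Lemma perm_act1 : perm_act 1%g = \1%VF.
Proof.
apply/lfunP=> v; rewrite id_lfunE lfunE; apply/ffunP=> f; rewrite !ffunE.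
by congr (v _); apply/ffunP=> i; rewrite !ffunE perm1.
Qed.

Lemma perm_act_polytabloid g t :
  perm_act g (polytabloid t) = polytabloid (t * g)%g.
Proof.
have colM s i : tab_col (t * g)%g ((s ^ g)%g i) = tab_col t (s (g^-1%g i)).
  by rewrite /tab_col invMg !permM permK.
rewrite /polytabloid linear_sum [RHS](reindex_inj (conjg_inj g)) /=.
apply: eq_big => [s|s _].
  rewrite !inE; apply/forallP/forallP=> h i.
    by rewrite colM (eqP (h _)) /tab_col invMg permM.
  have /eqP := h (g i); rewrite colM permK => ->.
  by rewrite /tab_col invMg permM permK.
rewrite linearZ /= perm_act_vec odd_permJ; congr (_ *: tabloid_vec _).
apply/ffunP=> i; rewrite !ffunE; congr inord.
have -> : (t * g * (s ^ g) = t * s * g)%g by rewrite conjgE !mulgA mulgK.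
by rewrite /tab_row [((t * s) * g)^-1%g]invMg permM.
Qed.

Lemma perm_act_specht g v : v \in specht -> perm_act g v \in specht.
Proof.
rewrite memv_preim; apply: subvP v; apply/span_subvP=> _ /imageP[t _ ->].
rewrite -memv_preim perm_act_polytabloid; apply: memv_span.
exact: image_f.
Qed.

Definition spechtv : superVectType C := evenv (subvs_of specht).

Definition specht_act (g : generator (sym_pres C n)) : superEnd spechtv :=
  linfun (vsproj specht \o (perm_act g \o vsval)).

Lemma specht_actE g (v : spechtv) :
  vsval ((specht_act g : 'End(_)) v : subvs_of specht) =
  perm_act g (vsval (v : subvs_of specht)).
Proof.
rewrite lfunE /= vsprojK //; apply: perm_act_specht; exact: subvsP.
Qed.

Fact specht_rel s1 s2 : relation s1 s2 ->
  eval_expr specht_act s1 = eval_expr specht_act s2.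
Proof.
case=> {s1 s2} [g h|] /=; apply/lfunP=> v; apply: val_inj.
  by rewrite comp_lfunE /= !specht_actE perm_actM comp_lfunE.
by rewrite scale_lfunE scale1r id_lfunE /= specht_actE perm_act1 id_lfunE.
Qed.

Fact specht_homog g : homog (gen_parity g) (specht_act g).
Proof.
apply/map_homogP=> [] [] v; rewrite addbF => vq; last exact: memvf.
by move: vq; rewrite !memv0 => /eqP ->; rewrite linear0.
Qed.

Definition specht_module : supermodule (CS C n) :=
  SuperModule (plift specht_homog specht_rel).

End Specht.

(* B^lambda, with the simple Cl_n-module U as a parameter *)
Definition Bmodule (C : numClosedFieldType) (n : nat)
    (U : supermodule (Cl C n)) (lam : seq nat) : supermodule (CB C n) :=
  pullback (phiB C n) (boxtimes U (specht_module C n lam)).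

(* Main.v *)
From HB Require Import structures.
From mathcomp Require Import all_boot all_order all_algebra all_fingroup zify boolp.
From mathcomp Require Import complex reals.
Require Import Defs.
Import GRing.Theory Num.Theory.

Set Implicit Arguments.
Unset Strict Implicit.
Unset Printing Implicit Defensive.

(** Write c_i and s_g for the generators of the two factors of the tensor product
    Cl_n (x) CS_n. The first step makes the isomorphism [phiB] usable on modules:
    words [cB i] and [sB g] in the generators t_i satisfy the relations of Cl_n and
    of CS_n, commute with each other, are mapped to c_i (x) 1 and 1 (x) g, and
    express the t_i ([tgenE]). For this the Coxeter relations must be shown to
    define a map on the whole symmetric group ([coxeter_lift]). A supermodule over
    the hyperoctahedral superalgebra is then a space with odd Clifford operators and
    commuting even permutation operators.

    The heart of the proof is a count. If P is the parity involution, the linear maps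
    that are sums of even and odd homomorphisms are those that commute with the
    permutation operators and with the operators c_i P. On the space of Sn-maps from
    M to N, conjugation by the c_i P gives n commuting involutions, and composition
    with c_i flips the sign of exactly one of them; all joint eigenspaces therefore
    have the same dimension, and Hom_Sn(M, N) has 2^n times the dimension of
    Hom(M, N) ([dim_equivariants]). Without the permutations, the same count gives
    (dim U)^2 = 2^n dim End(U), where dim End(U) is 1 or 2 by Schur's lemma
    ([simple_End_dim]); hence it is 1 for even n and 2 for odd n
    ([dim_clifford_module]).

    About Specht modules three facts are needed. Their Sn-endomorphisms are scalars
    ([specht_schur]) and a nonzero Sn-map from S^lambda to S^mu implies that lambda
    dominates mu ([equivariant_specht_dominates]); both come from applying the column
    antisymmetriser to tabloids, after James. And every nonzero representation of
    Sn has a nonzero map to some Specht module ([exists_equivariant_specht]), since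
    permutations of the same cycle type are conjugate, so that the orthogonal
    characters of the Specht modules are numerous enough to span the class
    functions.

    The theorem follows. The Sn-endomorphisms of B^lambda are those of the form
    f (x) 1, a space of dimension (dim U)^2, so that End(B^lambda) has the dimension of
    End(U) ([dim_B_End]); they also show that a submodule of B^lambda is U' (x) S^lambda
    for a submodule U' of U ([B_simple]). An isomorphism between B^lambda and B^mu
    yields maps between Specht modules in both directions ([B_isomorphic_inj]). A
    simple M has a nonzero Sn-map to some B^lambda, so by the count a nonzero
    homomorphism, which is an isomorphism ([B_complete]). *)

Local Open Scope ring_scope.

(** * Maps out of the symmetric group *)

Section CoxeterLift.

Variable (n : nat).

Definition next (i j : 'I_n) : bool := j == i.+1 :> nat.

Definition descent (g : 'S_n) (p : 'I_n * 'I_n) : bool :=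
  next p.1 p.2 && (g p.2 < g p.1)%N.

(** A substitute for the number of inversions: sorting a descent increases it,
    by the rearrangement inequality, and it is bounded. *)
Definition weight (g : 'S_n) : nat := (\sum_(i < n) i * g i)%N.

Lemma weight_descent g i j : descent g (i, j) ->
  (weight g < weight (tperm i j * g)%g)%N.
Proof.
case/andP=> /eqP/= ji gji; rewrite /weight.
have ij : j != i by rewrite -val_eqE /= ji; lia.
rewrite (bigD1 i) //= (bigD1 j) //= [X in (_ < X)%N](bigD1 i) //=.
rewrite [X in (_ < _ + X)%N](bigD1 j) //= !permM tpermL tpermR.
rewrite !addnA -[leqLHS]addSn leq_add ?ji //; first nia.
by apply: eq_leq; apply: eq_bigr => k /andP[ki kj]; rewrite permM tpermD // eq_sym.
Qed.

Lemma weight_bound g : (weight g <= n * (n * n))%N.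
Proof.
rewrite /weight -[X in (_ <= X * _)%N](card_ord n) -sum_nat_const.
by apply: leq_sum => i _; apply: leq_mul; apply: ltnW.
Qed.

Lemma weight_ind (P : 'S_n -> Prop) :
  (forall g, (forall h, (weight g < weight h)%N -> P h) -> P g) -> forall g, P g.
Proof.
move=> step g; have [m] := ubnP (n * (n * n) - weight g).
elim: m g => // m IH g le_m; apply: step => h lt_w.
by apply: IH; have := weight_bound h; lia.
Qed.

(** A permutation without descents is increasing, so [i <= g i] for all [i],
    and both sides have the same sum. *)
Lemma no_descent g : (forall i j, ~~ descent g (i, j)) -> g = 1%g.
Proof.
move=> nod; have ge_g k : forall i : 'I_n, i = k :> nat -> (k <= g i)%N.
  elim: k => [//|k IH] j jk.
  have ki : (k < n)%N by rewrite ltnW // -jk.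
  have := IH (Ordinal ki) erefl; have := nod (Ordinal ki) j.
  rewrite /descent /next /= jk eqxx -leqNgt leq_eqVlt => /orP[/eqP/val_inj|].
    by move/perm_inj/(congr1 val) => /=; rewrite jk; lia.
  by move=> lt_g le_k; apply: leq_ltn_trans lt_g.
have : (\sum_(i < n) i)%N = (\sum_(i < n) g i)%N.
  by rewrite [RHS](reindex_inj (@perm_inj _ g^-1)); apply: eq_bigr => i _; rewrite permKV.
move/eqP; rewrite (leqif_sum (fun (i : 'I_n) _ => leqif_geq (ge_g i i erefl))).
move/forall_inP => eqg; apply/permP=> i; rewrite perm1; apply/val_inj/anti_leq.
by rewrite eqg ?ge_g.
Qed.

(** The value attached to [g] is read off a sorting of [g] by adjacent
    transpositions; [x i j] matters only for [j] the successor of [i]. *)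
Variables (A : pzRingType) (x : 'I_n -> 'I_n -> A).
Hypothesis x_sq : forall i j, next i j -> x i j * x i j = 1.
Hypothesis x_far : forall i j k l, next i j -> next k l -> (j < k)%N ->
  x i j * x k l = x k l * x i j.
Hypothesis x_braid : forall i j k, next i j -> next j k ->
  x i j * x j k * x i j = x j k * x i j * x j k.

(** [m] is a bound on the number of sorting steps. *)
Fixpoint sort_word (m : nat) (g : 'S_n) : A :=
  if m is m'.+1 then
    if [pick p | descent g p] is Some p then
      sort_word m' (tperm p.1 p.2 * g)%g * x p.1 p.2
    else 1
  else 1.

Definition coxeter_lift (g : 'S_n) : A := sort_word (n * (n * n) - weight g).+1 g.

Lemma sort_word_stable m k g : (n * (n * n) - weight g < m)%N ->
  (n * (n * n) - weight g < k)%N -> sort_word m g = sort_word k g.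
Proof.
elim: m k g => // m IH [//|k] g le_m le_k /=; case: pickP => // -[i j] ds /=.
have lt_w := weight_descent ds; have w_le := weight_bound (tperm i j * g).
by congr (_ * _); apply: IH; lia.
Qed.

Lemma coxeter_lift1 : coxeter_lift 1 = 1.
Proof.
rewrite /coxeter_lift /=; case: pickP => // -[i j] /andP[/eqP/= ji].
by rewrite !perm1 ji; lia.
Qed.

Lemma coxeter_lift_pick g i j : descent g (i, j) ->
  exists2 p, descent g p &
    coxeter_lift g = coxeter_lift (tperm p.1 p.2 * g)%g * x p.1 p.2.
Proof.
move=> ij; rewrite {1}/coxeter_lift /=.
case: pickP => [[k l] kl|/(_ (i, j))]; last by rewrite ij.
exists (k, l) => //; congr (_ * _); apply: sort_word_stable => //=.
by have := weight_descent kl; have := weight_bound (tperm k l * g); lia.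
Qed.

Lemma descentP g i j : descent g (i, j) -> next i j /\ (g j < g i)%N.
Proof. by case/andP. Qed.

(** Sorting at any descent gives the same value, by induction on the weight. Two
    distant descents commute; two adjacent ones [i, j] and [j, l] are both
    completed to the sorting of the three positions [i, j, l], where the two
    words differ by the braid relation. *)
Lemma coxeter_lift_descent g i j : descent g (i, j) ->
  coxeter_lift g = coxeter_lift (tperm i j * g)%g * x i j.
Proof.
elim/weight_ind: g i j => g IH.
suff confl i j k l : descent g (i, j) -> descent g (k, l) -> (i <= k)%N ->
    coxeter_lift (tperm i j * g)%g * x i j = coxeter_lift (tperm k l * g)%g * x k l.
  move=> i j ij; have [[k l] /= kl ->] := coxeter_lift_pick ij.
  by case/orP: (leq_total i k) => ik; [apply/esym|]; apply: confl.
move=> ij kl; have [nij gji] := descentP ij; have [nkl glk] := descentP kl.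
rewrite leq_eqVlt => /orP[/eqP/val_inj eik|ik].
  subst k; have <- // : j = l by apply: val_inj; rewrite /= (eqP nij) (eqP nkl).
have lt_ij := weight_descent ij; have lt_kl := weight_descent kl.
have lt_neq (a b : 'I_n) : (a < b)%N -> (a != b) * (b != a).
  by move=> ab; rewrite -!val_eqE /=; split; lia.
have nij' : (i < j)%N by rewrite (eqP nij).
have nkl' : (k < l)%N by rewrite (eqP nkl).
have [jk|] := ltnP j k.
  have [ik' il jl] := And3 ik (ltn_trans ik nkl') (ltn_trans jk nkl').
  have fixD := (tpermD, lt_neq _ _ ik', lt_neq _ _ il, lt_neq _ _ jk, lt_neq _ _ jl).
  have dkl : descent (tperm i j * g)%g (k, l).
    by rewrite /descent !permM !fixD // glk nkl.
  have dij : descent (tperm k l * g)%g (i, j).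
    by rewrite /descent !permM !fixD // gji nij.
  rewrite (IH _ lt_ij _ _ dkl) (IH _ lt_kl _ _ dij) -!mulrA (x_far nij nkl jk).
  congr (coxeter_lift _ * _); rewrite !mulgA; congr (_ * _)%g.
  by apply/commgP/conjg_fixP; rewrite tpermJ !fixD.
(* the remaining case is the adjacent one: k = j *)
rewrite leq_eqVlt ltnNge (eqP nij) ik orbF -(eqP nij) => /eqP/val_inj ekj; subst k.
have il := ltn_trans nij' nkl'.
have [Eij [Ejl Eil]] := (lt_neq _ _ nij', (lt_neq _ _ nkl', lt_neq _ _ il)).
have E1 : tperm i j l = l by rewrite tpermD ?Eil ?Ejl.
have E2 : tperm j l i = i by rewrite tpermD ?Eij ?Eil.
have d1 : descent (tperm i j * g)%g (j, l).
  by rewrite /descent /= !permM E1 tpermR nkl (ltn_trans glk gji).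
have d2 : descent (tperm j l * (tperm i j * g))%g (i, j).
  by rewrite /descent /= !permM E2 !tpermL E1 nij glk.
have d3 : descent (tperm j l * g)%g (i, j).
  by rewrite /descent /= !permM E2 tpermL nij (ltn_trans glk gji).
have d4 : descent (tperm i j * (tperm j l * g))%g (j, l).
  by rewrite /descent /= !permM E1 !tpermR E2 nkl gji.
have lt1 := ltn_trans lt_ij (weight_descent d1).
have lt3 := ltn_trans lt_kl (weight_descent d3).
rewrite (IH _ lt_ij _ _ d1) (IH _ lt1 _ _ d2) (IH _ lt_kl _ _ d3) (IH _ lt3 _ _ d4).
rewrite -!mulrA [x i j * _]mulrA (x_braid nij nkl) !mulrA; do 3!congr (_ * _).
congr coxeter_lift; rewrite !mulgA; congr (_ * _)%g.
have := tpermJ i j (tperm j l); rewrite tpermL E2 conjgE tpermV mulgA => ->.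
by have := tpermJ j l (tperm i j); rewrite tpermR E1 conjgE tpermV mulgA => ->.
Qed.

Lemma coxeter_lift_tperm g i j : next i j ->
  coxeter_lift (tperm i j * g)%g = coxeter_lift g * x i j.
Proof.
move=> nij; have [gij|gji] := ltnP (g j) (g i).
  by rewrite (@coxeter_lift_descent g i j) /descent ?nij //= -mulrA x_sq // mulr1.
rewrite (@coxeter_lift_descent (tperm i j * g)%g i j) ?mulgA ?tperm2 ?mul1g //.
rewrite /descent nij !permM tpermL tpermR ltn_neqAle gji andbT /=.
by rewrite (inj_eq val_inj) (inj_eq perm_inj) -val_eqE /= (eqP nij); lia.
Qed.

(** Adjacent transpositions generate the symmetric group. *)
Lemma adj_tperm_ind (P : 'S_n -> Prop) : P 1%g ->
  (forall i j g, next i j -> P g -> P (tperm i j * g)%g) -> forall g, P g.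
Proof.
move=> P1 PM; elim/weight_ind=> g IH.
have [/existsP[i /existsP[j ij]]|/existsPn nod] := boolP [exists i, exists j, descent g (i, j)].
  have [nij _] := descentP ij.
  by rewrite -[g]mul1g -(tperm2 i j) -mulgA; apply: PM => //; apply/IH/weight_descent.
suff -> : g = 1%g by [].
by apply: no_descent => i j; have /existsPn := nod i; apply.
Qed.

(** The order of the factors is that of maps: [h * g] applies [h] first. *)
Lemma coxeter_liftM g h : coxeter_lift (h * g)%g = coxeter_lift g * coxeter_lift h.
Proof.
elim/adj_tperm_ind: h => [|i j h nij IH]; first by rewrite mul1g coxeter_lift1 mulr1.
by rewrite -mulgA !coxeter_lift_tperm // IH mulrA.
Qed.

Lemma coxeter_lift_gen i j : next i j -> coxeter_lift (tperm i j) = x i j.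
Proof.
by move=> nij; rewrite -[tperm i j]mulg1 coxeter_lift_tperm // coxeter_lift1 mul1r.
Qed.

End CoxeterLift.

(** * Clifford elements and reflections from the relations of the generators *)

(** Here [t i] stands for the generator t_(i+1) of the hyperoctahedral
    superalgebra, extended arbitrarily to all naturals so that indices can be
    shifted without casts. *)
Section BnRelations.

Variables (A : pzRingType) (n : nat) (t : nat -> A).
Hypothesis t_sq : forall i, (i < n)%N -> t i * t i = 1.
Hypothesis t_far : forall i j, (i.+1 < j)%N -> (j < n)%N ->
  t i * t j = - (t j * t i).
Hypothesis t_braid : forall i, (i.+2 < n)%N ->
  t i * t i.+1 * t i = t i.+1 * t i * t i.+1.
Hypothesis t_last : forall i, i.+2 = n ->
  t i.+1 * (t i * t i.+1 * t i) = - (t i * t i.+1 * t i * t i.+1).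

Definition acomm (a b : A) := a * b = - (b * a).

Lemma acomm_sym a b : acomm a b -> acomm b a.
Proof. by rewrite /acomm => ->; rewrite opprK. Qed.

Lemma acommB a b c : acomm a b -> acomm a c -> acomm a (b - c).
Proof. by rewrite /acomm mulrBr mulrBl => -> ->; rewrite opprD. Qed.

Lemma acommN a b : acomm a b -> acomm a (- b).
Proof. by rewrite /acomm mulrN mulNr => ->. Qed.

Lemma acomm_conj a b c : acomm a b -> acomm a c -> acomm a (b * c * b).
Proof.
move=> ab ac; rewrite /acomm !mulrA ab !mulNr -[b * a * c]mulrA ac mulrN mulNr.
by rewrite opprK !mulrA -[_ * a * b]mulrA ab mulrN !mulrA.
Qed.

(** Under the isomorphism with the tensor product, conjugating c_(i+1) by t_i
    gives -c_i: the permutation s_i commutes with it, and conjugation by the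
    Clifford part of t_i is the negative of the reflection that exchanges c_i and
    c_(i+1). So c_i is reached from c_n = t_n by descending induction. *)
Fixpoint cliff_from (d i : nat) : A :=
  if d is d'.+1 then - (t i * cliff_from d' i.+1 * t i) else t i.

Definition cliff (i : nat) : A := cliff_from (n.-1 - i) i.

Lemma cliff_last i : i.+1 = n -> cliff i = t i.
Proof. by move=> ni; rewrite /cliff -ni subnn. Qed.

Lemma cliff_step i : (i.+1 < n)%N -> cliff i = - (t i * cliff i.+1 * t i).
Proof. by move=> lt_in; rewrite /cliff (_ : n.-1 - i = (n.-1 - i.+1).+1)%N //; lia. Qed.

Lemma cliff_ind (P : nat -> Prop) :
  (forall i, i.+1 = n -> P i) -> (forall i, (i.+1 < n)%N -> P i.+1 -> P i) ->
  forall i, (i < n)%N -> P i.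
Proof.
move=> Pn PS i lt_in; have [d] := ubnP (n - i); elim: d i lt_in => // d IH i lt_in le_d.
have [lt_Sin|ge_Sin] := ltnP i.+1 n; last by apply: Pn; lia.
by apply: PS => //; apply: IH => //; lia.
Qed.

Lemma cliff_sq i : (i < n)%N -> cliff i * cliff i = 1.
Proof.
move: i; apply: cliff_ind => [i ni|i lt_in IH]; first by rewrite cliff_last ?t_sq // -ni.
have tt := t_sq (ltnW lt_in).
rewrite cliff_step // mulrNN !mulrA -[_ * t i * t i]mulrA tt mulr1.
by rewrite -[_ * cliff _ * cliff _]mulrA IH mulr1.
Qed.

(** [cliff j] is a word of odd length in the [t k] with [k >= j]. *)
Lemma t_cliff_far i j : (i.+1 < j)%N -> (j < n)%N -> acomm (t i) (cliff j).
Proof.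
move=> lt_ij lt_jn; move: j lt_jn lt_ij; apply: cliff_ind => [j nj|j lt_jn IH] lt_ij.
  by rewrite cliff_last //; apply: t_far; rewrite -?nj.
rewrite cliff_step //; apply/acommN/acomm_conj; last by apply: IH; lia.
by apply: t_far => //; lia.
Qed.

(** The case [j = i.+1] is where the braid relation and, for the last two
    generators, the relation of order 8 come in. *)
Lemma t_cliff_gt i j : (i < j)%N -> (j < n)%N -> acomm (t j) (cliff i).
Proof.
move=> lt_ij lt_jn; have lt_in := ltn_trans lt_ij lt_jn.
move: i lt_in lt_ij; apply: cliff_ind => [i ni|i lt_in IH] lt_ij; first by lia.
have [eij|lt_Sij] : j = i.+1 \/ (i.+1 < j)%N by lia.
  subst j; have [lt_SSin|] := ltnP i.+2 n; last first.
    move=> ge_n; have ni : i.+2 = n by lia.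
    by rewrite cliff_step // cliff_last //; apply/acommN/t_last.
  have far := t_cliff_far (ltnSn i.+1) lt_SSin.
  rewrite cliff_step // cliff_step // mulrN mulNr opprK /acomm.
  set a := t i; set b := t i.+1; set c := cliff i.+2.
  have aba : a * b * a = b * a * b by apply: t_braid.
  have ac : a * c = - (c * a) by apply: t_cliff_far.
  rewrite !mulrA -aba -[a * b * a * c]mulrA ac mulrN !mulNr; congr (- _).
  by rewrite -!mulrA; do 3!congr (_ * _); rewrite !mulrA -aba.
by rewrite cliff_step //; apply/acommN/acomm_conj; [apply/acomm_sym/t_far|apply: IH].
Qed.

Lemma cliff_anti i j : (i < j)%N -> (j < n)%N -> acomm (cliff i) (cliff j).
Proof.
move=> lt_ij lt_jn; move: j lt_jn lt_ij; apply: cliff_ind => [j nj|j lt_jn IH] lt_ij.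
  by rewrite (cliff_last nj); apply/acomm_sym/t_cliff_gt; rewrite -?nj.
rewrite (cliff_step lt_jn); apply/acommN/acomm_conj; last by apply: IH; lia.
by apply/acomm_sym/t_cliff_gt; lia.
Qed.

Lemma t_cliff_swap i : (i.+1 < n)%N -> t i * cliff i.+1 = - (cliff i * t i).
Proof.
move=> lt_in; rewrite (cliff_step lt_in) mulNr opprK -[_ * t i * t i]mulrA.
by rewrite t_sq ?mulr1 // ltnW.
Qed.

Lemma t_cliff_swap' i : (i.+1 < n)%N -> t i * cliff i = - (cliff i.+1 * t i).
Proof.
by move=> lt_in; rewrite (cliff_step lt_in) mulrN !mulrA t_sq ?mul1r // ltnW.
Qed.

Variable r : A.
Hypothesis rC : forall a, r * a = a * r.
Hypothesis r2 : r * r * (1 + 1) = 1.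

Let x i := cliff i - cliff i.+1.
(** As t_i = (c_i - c_(i+1)) s_i / sqrt 2 and (c_i - c_(i+1))^2 = 2, this is
    the expression of s_i; [r] plays the role of 1 / sqrt 2. *)
Definition refl i : A := r * (x i * t i).

Lemma cliff_diff_sq a b : a * a = 1 -> b * b = 1 -> acomm a b ->
  (a - b) * (a - b) = 1 + 1.
Proof.
move=> aa bb ab; rewrite mulrBr !mulrBl aa bb ab opprB opprK.
by rewrite [RHS]addrC !addrA addrAC subrK.
Qed.

(** The hypotheses say that [a * b + b * a = -2]. *)
Lemma braid_of_squares (a b : A) : a * a = 1 + 1 -> b * b = 1 + 1 ->
  (a + b) * (a + b) = 1 + 1 -> a * b * a = b * a * b.
Proof.
move=> aa bb abab; have ab_ba : a * b + b * a = - (1 + 1).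
  apply: (addrI (1 + 1)); rewrite subrr; apply: (addIr (1 + 1)); rewrite add0r.
  by rewrite -[RHS]abab mulrDl !mulrDr aa bb !addrA.
have ab : a * b = - (1 + 1) - b * a by rewrite -ab_ba addrK.
rewrite {1}ab mulrBl -[b * a * a]mulrA aa -[RHS]mulrA ab mulrBr mulrA bb.
by rewrite mulNr mulrN addrC !(mulrDl, mulrDr) !(mul1r, mulr1).
Qed.

Lemma x_sq i : (i.+1 < n)%N -> x i * x i = 1 + 1.
Proof.
by move=> lt_in; apply: cliff_diff_sq; rewrite ?cliff_sq ?(ltnW lt_in) //; apply: cliff_anti.
Qed.

Lemma t_refl i : (i.+1 < n)%N -> t i = r * (x i * refl i).
Proof.
move=> lt_in; rewrite /refl [x i * _]mulrA -(rC (x i)) -mulrA [x i * _]mulrA x_sq //.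
by rewrite !mulrA r2 mul1r.
Qed.

Lemma refl_cliff_comm i k : (i.+1 < n)%N -> (k < n)%N ->
  refl i * cliff k = cliff k * refl i.
Proof.
move=> lt_in lt_kn; have lt_in' := ltnW lt_in.
rewrite /refl [RHS]mulrA -(rC (cliff k)) -!mulrA; congr (_ * _).
have ci := cliff_sq lt_in'; have cSi := cliff_sq lt_in.
have cSii := cliff_anti (ltnSn i) lt_in.
have [->|nki] := eqVneq k i.
  rewrite t_cliff_swap' // mulrN mulrA mulrA -mulNr; congr (_ * _).
  by rewrite mulrBr mulrBl ci cSi opprB.
have [->|nkSi] := eqVneq k i.+1.
  rewrite t_cliff_swap // mulrN mulrA mulrA -mulNr; congr (_ * _).
  by rewrite mulrBr mulrBl ci cSi opprB.
have anti_t : acomm (t i) (cliff k).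
  have [lt_ki|lt_Sik] : (k < i)%N \/ (i.+1 < k)%N by lia.
    exact: t_cliff_gt.
  exact: t_cliff_far.
have anti_x : acomm (cliff k) (x i).
  apply: acommB; have [lt_ki|lt_Sik] : (k < i)%N \/ (i.+1 < k)%N by lia.
  - exact: cliff_anti.
  - by apply/acomm_sym/cliff_anti => //; lia.
  - by apply: cliff_anti => //; lia.
  - exact/acomm_sym/cliff_anti.
by rewrite anti_t mulrN !mulrA anti_x mulNr.
Qed.

Lemma refl_x_comm i k : (i.+1 < n)%N -> (k.+1 < n)%N -> refl i * x k = x k * refl i.
Proof.
by move=> lt_in lt_kn; rewrite mulrBr mulrBl !refl_cliff_comm // ltnW.
Qed.

(** A reflection passes through the scalar and Clifford parts of another one,
    which reduces relations between reflections to relations between the [t i]. *)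
Lemma refl_push i y z : refl i * y = y * refl i ->
  refl i * (r * (y * z)) = r * (y * (refl i * z)).
Proof.
by move=> iy; rewrite mulrA -(rC (refl i)) -mulrA [refl i * _]mulrA iy -mulrA.
Qed.

Lemma refl_sq i : (i.+1 < n)%N -> refl i * refl i = 1.
Proof.
move=> lt_in; rewrite {2}/refl refl_push ?refl_x_comm // /refl -[r * _ * t i]mulrA.
rewrite -[x i * t i * t i]mulrA t_sq ?mulr1 1?ltnW //.
by rewrite [x i * _]mulrA -(rC (x i)) -mulrA x_sq // mulrA.
Qed.

Lemma refl_far i k : (i.+1 < k)%N -> (k.+1 < n)%N -> refl i * refl k = refl k * refl i.
Proof.
move=> lt_ik lt_kn; have lt_in : (i.+1 < n)%N by lia.
rewrite {2}/refl refl_push ?refl_x_comm // /refl -!mulrA; congr (_ * (_ * _)).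
have tt : acomm (t i) (t k) by apply: t_far => //; lia.
have tx : acomm (t k) (x i) by apply: acommB; apply: t_cliff_gt; lia.
rewrite tt [RHS]mulrA -(rC (t k)) -[RHS]mulrA; congr (_ * _).
by rewrite [RHS]mulrA tx mulNr mulrN !mulrA.
Qed.

(** Both sides become r^3 times a Clifford part times a braid in the [t i]; the
    Clifford parts agree since the vectors [x i] and [x i.+1], together with their
    sum, have square 2. *)
Lemma refl_braid i : (i.+2 < n)%N ->
  refl i * refl i.+1 * refl i = refl i.+1 * refl i * refl i.+1.
Proof.
move=> lt_n; have lt_in := ltnW lt_n.
have expand a b : (a.+1 < n)%N -> (b.+1 < n)%N -> refl a * refl b * refl a =
    r * (r * (r * (x a * x b * x a * (t a * t b * t a)))).
  move=> an bn; rewrite -[LHS]mulrA {3}/refl refl_push ?refl_x_comm //.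
  rewrite refl_push ?refl_x_comm // {2}/refl -[r * _ * t a]mulrA -[x b * _ * t a]mulrA.
  rewrite refl_push ?refl_x_comm // /refl -!mulrA; congr (_ * _).
  rewrite mulrA -(rC (x a)) -mulrA; congr (_ * _).
  by rewrite [x b * (r * _)]mulrA -(rC (x b)) -mulrA [x a * (r * _)]mulrA -(rC (x a)) -mulrA.
rewrite !expand // t_braid //; do 4!congr (_ * _).
apply: braid_of_squares; rewrite ?x_sq // addrA subrK.
by apply: cliff_diff_sq; rewrite ?cliff_sq //; [lia|apply: cliff_anti].
Qed.

End BnRelations.

(** * The inverse of the isomorphism onto the tensor product *)

Section CliffordInBn.

Variables (C : numClosedFieldType) (n : nat).
Notation CB := (CB C n).

Lemma homogN (A : superAlgType C) p (a : A) : homog p a -> homog p (- a).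
Proof.
by move=> pa; rewrite -mulN1r -scalN1; apply: (homogM (p := false)); first exact: homog_scal.
Qed.

Definition tB (i : nat) : CB := if insub i is Some j then tgen j else 0.

Lemma tBE (i : 'I_n) : tB i = tgen i.
Proof. by rewrite /tB valK. Qed.

Lemma cls_epow (P : presentation C) (e : expr C (generator P)) k :
  cls (epow e k) = cls e ^+ k :> presented P.
Proof. by elim: k => [|k IH] //=; rewrite cls_mul IH exprS. Qed.

Lemma tB_sq i : (i < n)%N -> tB i * tB i = 1.
Proof.
move=> lt_in; rewrite (tBE (Ordinal lt_in)) -expr2 -[tgen _]/(cls (Gen _)) -cls_epow.
exact: (relationE (P := bn_pres C n) (bn_sq C _)).
Qed.

Lemma tB_far i j : (i.+1 < j)%N -> (j < n)%N -> tB i * tB j = - (tB j * tB i).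
Proof.
move=> lt_ij lt_jn; have lt_in : (i < n)%N by lia.
have := relationE (P := bn_pres C n) (@bn_far C n (Ordinal lt_in) (Ordinal lt_jn) (or_introl lt_ij)).
rewrite cls_epow cls_mul -scalE scalN1 expr2 -![cls (Gen _)]/(tgen _) -!tBE /= => ab2.
rewrite -mulN1r -ab2 !mulrA -[_ * tB j * tB j]mulrA tB_sq // mulr1.
by rewrite -[_ * tB i * tB i]mulrA tB_sq // mulr1.
Qed.

Lemma tB_braid i : (i.+2 < n)%N -> tB i * tB i.+1 * tB i = tB i.+1 * tB i * tB i.+1.
Proof.
move=> lt_n; have lt_in : (i < n)%N by lia.
have := relationE (P := bn_pres C n) (@bn_braid C n (Ordinal lt_in) (Ordinal (ltnW lt_n)) erefl lt_n).
by rewrite !cls_mul -![cls (Gen _)]/(tgen _) -!tBE.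
Qed.

Lemma tB_last i : i.+2 = n ->
  tB i.+1 * (tB i * tB i.+1 * tB i) = - (tB i * tB i.+1 * tB i * tB i.+1).
Proof.
move=> ni; have lt_in : (i < n)%N by lia.
have lt_Sin : (i.+1 < n)%N by lia.
have := relationE (P := bn_pres C n) (@bn_last C n (Ordinal lt_in) (Ordinal lt_Sin) erefl ni).
rewrite cls_epow cls_mul -scalE scalN1 -![cls (Gen _)]/(tgen _) -!tBE /=.
set a := tB i; set b := tB i.+1; rewrite (exprM _ 2 2) !expr2 => ab4.
have aa : a * a = 1 by apply: tB_sq.
have bb : b * b = 1 by apply: tB_sq.
have baba : (a * b * (a * b)) * (b * a * (b * a)) = 1.
  by rewrite !mulrA -[_ * b * b]mulrA bb mulr1 -[_ * a * a]mulrA aa mulr1 -[_ * b * b]mulrA bb mulr1.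
have -> : b * (a * b * a) = b * a * (b * a) by rewrite !mulrA.
apply/eqP; rewrite -eqr_oppLR -mulN1r -ab4 -[X in X == _]mulrA baba mulr1.
by rewrite -[X in _ == X]mulrA.
Qed.

Definition half : CB := scal (sqrtC 2)^-1.

Lemma half_sq : half * half * (1 + 1) = 1.
Proof.
rewrite /half -scalM sqrt2V -scal1 -scalD -scalM -mulr2n mulVf ?scal1 //.
by rewrite pnatr_eq0.
Qed.

Lemma halfC a : half * a = a * half. Proof. exact: scalC. Qed.

(** The preimages of c_i (x) 1 and of 1 (x) g. *)
Definition cB (i : 'I_n) : CB := cliff n tB i.
Definition sB : 'S_n -> CB := coxeter_lift (fun i _ => refl n tB half i).

Lemma cB_sq i : cB i * cB i = 1.
Proof. by apply: cliff_sq => //; apply: tB_sq. Qed.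

Lemma cB_anti i j : i != j -> cB i * cB j = - (cB j * cB i).
Proof.
have anti (k l : 'I_n) : (k < l)%N -> acomm (cB k) (cB l).
  by move=> lt_kl; apply: (cliff_anti tB_far tB_braid tB_last).
rewrite -val_eqE neq_ltn => /orP[/anti //|/anti]; exact: acomm_sym.
Qed.

Let next_lt (i j : 'I_n) : next i j -> (i.+1 < n)%N.
Proof. by move/eqP <-. Qed.

Let reflP_sq (i j : 'I_n) : next i j -> refl n tB half i * refl n tB half i = 1.
Proof.
move/next_lt; exact: (refl_sq tB_sq tB_far tB_braid tB_last halfC half_sq).
Qed.

Let reflP_far (i j k l : 'I_n) : next i j -> next k l -> (j < k)%N ->
  refl n tB half i * refl n tB half k = refl n tB half k * refl n tB half i.
Proof.
move=> /eqP ij /next_lt lt_kn lt_jk.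
by apply: (refl_far tB_sq tB_far tB_braid tB_last halfC); rewrite // -ij.
Qed.

Let reflP_braid (i j k : 'I_n) : next i j -> next j k ->
  refl n tB half i * refl n tB half j * refl n tB half i =
  refl n tB half j * refl n tB half i * refl n tB half j.
Proof.
move=> /eqP ij /next_lt; rewrite ij => lt_jn.
exact: (refl_braid tB_sq tB_far tB_braid tB_last halfC).
Qed.

Lemma sB1 : sB 1 = 1. Proof. exact: coxeter_lift1. Qed.

Lemma sBM g h : sB g * sB h = sB (h * g)%g.
Proof. by rewrite [RHS](coxeter_liftM reflP_sq reflP_far reflP_braid). Qed.

Lemma sB_next (i j : 'I_n) : next i j -> sB (tperm i j) = refl n tB half i.
Proof. exact: (coxeter_lift_gen reflP_sq reflP_far reflP_braid). Qed.

Lemma sB_tperm g (i j : 'I_n) : next i j -> sB (tperm i j * g)%g = sB g * sB (tperm i j).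
Proof. by rewrite sBM. Qed.

Lemma sB_cB g i : sB g * cB i = cB i * sB g.
Proof.
elim/adj_tperm_ind: g => [|k l g nkl IH]; first by rewrite sB1 mul1r mulr1.
rewrite sB_tperm // -mulrA (sB_next nkl).
rewrite (refl_cliff_comm tB_sq tB_far tB_braid tB_last halfC (next_lt nkl)) //.
by rewrite [LHS]mulrA -/(cB i) IH -!mulrA.
Qed.

Lemma tB_homog i : homog true (tB i).
Proof. by rewrite /tB; case: insub => [j|]; [apply: (gen_homog (P := bn_pres C n))|apply: homog0]. Qed.

Lemma cB_homog i : homog true (cB i).
Proof.
rewrite /cB /cliff; move: (n.-1 - i)%N => d; elim: d (nat_of_ord i) => [|d IH] k /=.
  exact: tB_homog.
apply: homogN; apply: (homogM (p := false) (q := true)); last exact: tB_homog.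
by apply: (homogM (p := true) (q := true)); first exact: tB_homog.
Qed.

Lemma sB_homog g : homog false (sB g).
Proof.
elim/adj_tperm_ind: g => [|k l g nkl IH]; first by rewrite sB1 -scal1; apply: homog_scal.
rewrite sB_tperm // (sB_next nkl); apply: (homogM (p := false) (q := false)) => //.
apply: (homogM (p := false) (q := false)); first exact: homog_scal.
apply: (homogM (p := true) (q := true)); last exact: tB_homog.
by apply: homogD; [apply: cB_homog | rewrite -(eqP nkl); apply/homogN/cB_homog].
Qed.

(** The generators are words in [cB] and [sB]; with the relations above this
    turns every supermodule into one with commuting Clifford and permutation
    operators, and loses nothing. *)
Lemma tgenE i : tgen i =
  if insub i.+1 is Some j then half * ((cB i - cB j) * sB (tperm i j)) else cB i.
Proof.
case: insubP => [j lt_in ji|ge_n].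
  have nij : next i j by apply/eqP.
  rewrite (sB_next nij) /cB ji -tBE.
  exact: (t_refl tB_sq tB_far tB_braid tB_last halfC half_sq).
by rewrite /cB cliff_last ?tBE //; have := ltn_ord i; lia.
Qed.

Lemma superhomN (X Y : superAlgType C) (f : superhom X Y) a : f (- a) = - f a.
Proof. by rewrite -mulN1r -scalN1 superhomM superhom_scal scalN1 mulN1r. Qed.

Lemma phiB_tB (i : 'I_n) : phiB C n (tB i) = phi_gen (i : generator (bn_pres C n)).
Proof. by rewrite tBE phiB_gen. Qed.

Lemma phiB_cB i : phiB C n (cB i) = cD C i.
Proof.
rewrite /cB; case: i => i lt_in; rewrite -[nat_of_ord _]/i; move: (lt_in).
pattern i; move: i lt_in; apply: cliff_ind => [i ni|i lt_Sin IH] lt_in.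
  rewrite cliff_last // -[tB i]/(tB (Ordinal lt_in)) phiB_tB (phi_last C (i := Ordinal lt_in) ni).
  by rewrite /normal scal1 mul1r sD1 mulr1.
rewrite cliff_step // superhomN !superhomM (IH lt_Sin) -[tB i]/(tB (Ordinal lt_in)) phiB_tB.
set ci := Ordinal lt_in; set cj := Ordinal lt_Sin.
rewrite (@phi_next C n ci cj erefl); set x := cD C ci - cD C cj.
have xx : x * x = 1 + 1 by apply: cDB_sq; apply: next_neq.
have xc : x * cD C cj = - (cD C ci * x).
  rewrite /x mulrBl mulrBr !cD_sq opprB; congr (_ - _).
have -> : cD C cj = normal 1 (cD C cj) 1%g by rewrite /normal scal1 mul1r sD1 mulr1.
rewrite normalM; last exact: comm_cD.
rewrite normalM; last exact: comm_sDB.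
rewrite mulr1 mul1g tperm2 sqrt2V xc mulNr -mulrA xx normalN opprK.
by rewrite mulrA scalC -mulrA scal_half mulr1.
Qed.

Lemma phiB_sB g : phiB C n (sB g) = sD C g.
Proof.
elim/adj_tperm_ind: g => [|k l g nkl IH]; first by rewrite sB1 superhom1 sD1.
rewrite sB_tperm // superhomM IH -sDM; congr (_ * _).
rewrite (sB_next nkl) superhomM superhom_scal superhomM superhomD superhomN.
rewrite -(eqP nkl) !phiB_cB phiB_tB (phi_next C (eqP nkl)) /normal.
have xx : (cD C k - cD C l) * (cD C k - cD C l) = 1 + 1.
  by apply: cDB_sq; apply: next_neq; apply/eqP.
rewrite [X in scal _ * X]mulrA -scalC -mulrA [scal _ * (scal _ * _)]mulrA -scalM sqrt2V.
by rewrite [X in scal _ * X]mulrA xx mulrA scal_half mul1r.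
Qed.

End CliffordInBn.

(** * Dimensions of spaces of intertwiners *)

Section Intertwiners.

Variables (C : numClosedFieldType) (V W : vectType C).
Implicit Types (a k : 'End(V)) (b : 'End(W)) (h : 'Hom(V, W)) (S : {vspace 'Hom(V, W)}).

Definition sandwich b a h : 'Hom(V, W) := (b \o h \o a)%VF.

Fact sandwich_linear b a : linear (sandwich b a).
Proof.
by move=> c h g; apply/lfunP=> v; rewrite !(comp_lfunE, add_lfunE, scale_lfunE) linearP.
Qed.
HB.instance Definition _ b a := GRing.isLinear.Build C 'Hom(V, W) 'Hom(V, W) _
  (sandwich b a) (sandwich_linear b a).

Definition intertwiners a b : {vspace 'Hom(V, W)} :=
  lker (linfun (sandwich b \1%VF) - linfun (sandwich \1%VF a))%R.

Lemma intertwinersP a b h : reflect (forall v, b (h v) = h (a v)) (h \in intertwiners a b).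
Proof.
rewrite memv_ker add_lfunE opp_lfunE !lfunE subr_eq0.
apply: (iffP eqP) => [/lfunP e v|e]; last apply/lfunP=> v; last first.
  by rewrite !(comp_lfunE, id_lfunE).
by have := e v; rewrite !(comp_lfunE, id_lfunE).
Qed.

(** Since [a] and [b] square to -1, the map [h |-> - b h a] is an involution of
    [S] whose fixed points are the intertwiners. Composition with [k] exchanges its
    eigenspaces 1 and -1, which therefore have the same dimension. *)
Lemma dim_intertwiners_half S a b k :
    (forall v, a (a v) = - v) -> (forall w, b (b w) = - w) ->
    (forall v, k (k v) = v) -> (forall v, a (k v) = - k (a v)) ->
    (forall h, h \in S -> sandwich b a h \in S) ->
    (forall h, h \in S -> sandwich \1%VF k h \in S) ->
  \dim S = (2 * \dim (S :&: intertwiners a b))%N.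
Proof.
move=> aa bb kk ak Sba Sk.
(* twice the projection onto the fixed points *)
pose f := (\1%VF - linfun (sandwich b a))%R : 'End('Hom(V, W)).
have fE h v : f h v = h v - b (h (a v)).
  by rewrite /f add_lfunE id_lfunE opp_lfunE [linfun _ h]lfunE add_lfunE opp_lfunE !comp_lfunE.
pose T := (S :&: intertwiners a b)%VS.
pose K := linfun (sandwich \1%VF k).
have KE h v : K h v = h (k v) by rewrite lfunE /= !comp_lfunE id_lfunE.
have KK : lker K = 0%VS.
  apply/eqP/lker0P => h g /lfunP e; apply/lfunP=> v.
  by have := e (k v); rewrite !KE kk.
have dimK (X : {vspace 'Hom(V, W)}) : \dim (K @: X) = \dim X.
  by apply: limg_dim_eq; rewrite KK capv0.
have kerP h : reflect (forall v, b (h (a v)) = h v) (h \in lker f).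
  rewrite memv_ker; apply: (iffP eqP) => [/lfunP e v|e]; last first.
    by apply/lfunP=> v; rewrite fE e subrr zero_lfunE.
  by have /eqP := e v; rewrite fE zero_lfunE subr_eq0 => /eqP.
have fS : (f @: S)%VS = T.
  apply/eqP; rewrite eqEsubv; apply/andP; split; apply/subvP=> h.
    case/memv_imgP=> g gS ->; rewrite memv_cap; apply/andP; split.
      by rewrite /f add_lfunE id_lfunE opp_lfunE [linfun _ g]lfunE memvB // Sba.
    by apply/intertwinersP=> v; rewrite !fE aa !linearB /= !linearN /= bb opprK opprK addrC.
  rewrite memv_cap => /andP[hS /intertwinersP hI].
  have -> : h = f (2^-1 *: h).
    apply/lfunP=> v; rewrite fE !scale_lfunE linearZ /= hI aa linearN /= scalerN opprK -scalerDl.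
    have -> : 2^-1 + 2^-1 = 1 :> C by rewrite -mulr2n -[LHS]mulr_natr mulVf ?pnatr_eq0.
    by rewrite scale1r.
  by apply/memv_img/memvZ.
have KT : (K @: T <= S :&: lker f)%VS.
  apply/subvP=> _ /memv_imgP[h /[!memv_cap]/andP[hS /intertwinersP hI] ->].
  rewrite lfunE Sk //=; apply/kerP=> v.
  by rewrite -[sandwich _ _ h]lfunE !KE hI ak aa !linearN opprK.
have KT' : (K @: (S :&: lker f) <= T)%VS.
  apply/subvP=> _ /memv_imgP[h /[!memv_cap]/andP[hS /kerP hI] ->].
  rewrite lfunE Sk //=; apply/intertwinersP=> v.
  have hN x : b (h x) = - h (a x) by rewrite -(hI (a x)) aa !linearN opprK.
  by rewrite -[sandwich _ _ h]lfunE !KE hN ak linearN opprK.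
rewrite -(limg_ker_dim f S) fS mul2n -addnn; congr (_ + _)%N.
by apply/anti_leq; have := dimvS KT; have := dimvS KT'; rewrite !dimK => -> ->.
Qed.

(** The involutions of the different [i] commute, and [k i] changes the sign of
    the i-th one only, so that each of them halves the dimension. *)
Lemma dim_intertwiners_family (I : eqType) (a k : I -> 'End(V)) (b : I -> 'End(W))
    (r : seq I) S :
    (forall i v, a i (a i v) = - v) -> (forall i w, b i (b i w) = - w) ->
    (forall i v, k i (k i v) = v) -> (forall i v, a i (k i v) = - k i (a i v)) ->
    (forall i j v, i != j -> a i (a j v) = - a j (a i v)) ->
    (forall i j w, i != j -> b i (b j w) = - b j (b i w)) ->
    (forall i j v, i != j -> a i (k j v) = k j (a i v)) ->
    (forall i h, i \in r -> h \in S -> sandwich (b i) (a i) h \in S) ->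
    (forall i h, i \in r -> h \in S -> sandwich \1%VF (k i) h \in S) -> uniq r ->
  \dim S = (2 ^ size r * \dim (S :&: \bigcap_(i <- r) intertwiners (a i) (b i)))%N.
Proof.
move=> aa bb kk ak aA bA akC.
elim: r S => [|i r IH] S Sba Sk /=; first by rewrite big_nil capvf mul1n.
case/andP=> ir ur; rewrite big_cons capvA.
have neq j : j \in r -> i != j by apply: contraTneq => <-.
have ri := mem_head i r; have rr j : j \in r -> j \in i :: r by rewrite inE orbC => ->.
rewrite (dim_intertwiners_half (aa i) (bb i) (kk i) (ak i)); last 2 first.
- by move=> h; apply: Sba.
- by move=> h; apply: Sk.
rewrite expnS -mulnA; congr (_ * _)%N; apply: IH => // j h jr; rewrite !memv_cap.
  case/andP=> hS /intertwinersP hI; rewrite (Sba _ _ (rr _ jr)) //=.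
  apply/intertwinersP=> v; rewrite !comp_lfunE bA ?neq // hI aA ?neq //.
  by rewrite !linearN opprK.
case/andP=> hS /intertwinersP hI; rewrite (Sk _ _ (rr _ jr)) //=.
by apply/intertwinersP=> v; rewrite !comp_lfunE !id_lfunE hI akC ?neq.
Qed.

End Intertwiners.

(** * Characters of finite groups *)

Section Characters.

Import VectorInternalTheory.

Lemma f2mxE (F : fieldType) (V W : vectType F) (f : 'Hom(V, W)) v : v2r (f v) = v2r v *m f2mx f.
Proof. by rewrite unlock /= r2vK. Qed.

Lemma f2mx_comp (F : fieldType) (V W X : vectType F) (f : 'Hom(V, W)) (g : 'Hom(W, X)) :
  f2mx (g \o f)%VF = f2mx f *m f2mx g.
Proof.
apply/row_matrixP=> i; rewrite !rowE mulmxA.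
by rewrite -[delta_mx 0 i]r2vK -!f2mxE comp_lfunE.
Qed.

Lemma f2mx1 (F : fieldType) (V : vectType F) : f2mx (\1%VF : 'End(V)) = 1%:M.
Proof.
by apply/row_matrixP=> i; rewrite !rowE -[delta_mx 0 i]r2vK -f2mxE id_lfunE mulmx1.
Qed.

Lemma f2mx0 (F : fieldType) (V W : vectType F) : f2mx (0 : 'Hom(V, W)) = 0.
Proof.
apply/row_matrixP=> i; rewrite !rowE -[delta_mx 0 i]r2vK -f2mxE zero_lfunE.
by rewrite linear0 mulmx0.
Qed.

Lemma trace_lin_mx (R : comNzRingType) m n (f : {linear 'M[R]_(m, n) -> 'M[R]_(m, n)}) :
  \tr (lin_mx f) = \sum_i \sum_j f (delta_mx i j) i j.
Proof.
rewrite pair_bigA /mxtrace (reindex _ (curry_mxvec_bij _ _)) /=.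
by apply: eq_bigr => -[i j] _ /=; rewrite !mxE /= vec_mx_delta mxvecE.
Qed.

(** In a rank factorisation [E = A B] of an idempotent, [B A] is an identity
    matrix, and it has the same trace. *)
Lemma trace_idem (F : fieldType) n (E : 'M[F]_n) : E *m E = E -> \tr E = (\rank E)%:R.
Proof.
move=> EE; rewrite -{1}(mulmx_base E) mxtrace_mulC -mxtrace1; congr (\tr _).
have [/row_freeP[r rr] /row_fullP[c cc]] := (row_base_free E, col_base_full E).
have : col_base E *m (row_base E *m col_base E) *m row_base E = col_base E *m row_base E.
  by rewrite mulmxA mulmx_base -mulmxA mulmx_base.
move: (col_base E) (row_base E) cc rr => A B cc rr.
move/(congr1 (mulmx c)); rewrite !mulmxA cc !mul1mx => /(congr1 (mulmxr r)) /=.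
by rewrite -mulmxA rr mulmx1.
Qed.

Section Representations.

Variables (C : numClosedFieldType) (gT : finGroupType).

(** Anti-multiplicative, since a product of permutations applies its first factor
    first; on matrices, which act on rows, [f2mx \o r] is multiplicative. *)
Definition is_rep (V : vectType C) (r : gT -> 'End(V)) : Prop :=
  r 1%g = \1%VF /\ forall g h, r (h * g)%g = (r g \o r h)%VF.

Definition equivariant (V W : vectType C) (r1 : gT -> 'End(V)) (r2 : gT -> 'End(W))
  (f : 'Hom(V, W)) : Prop := forall g v, r2 g (f v) = f (r1 g v).

Definition char (V : vectType C) (r : gT -> 'End(V)) (g : gT) : C := \tr (f2mx (r g)).

Section Average.

Variables (V W : vectType C) (r1 : gT -> 'End(V)) (r2 : gT -> 'End(W)).
Hypotheses (rep1 : is_rep r1) (rep2 : is_rep r2).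

Lemma repK (U : vectType C) (r : gT -> 'End(U)) g v : is_rep r -> r g (r g^-1%g v) = v.
Proof. by case=> r0 rM; rewrite -comp_lfunE -rM mulVg r0 id_lfunE. Qed.

Lemma repKV (U : vectType C) (r : gT -> 'End(U)) g v : is_rep r -> r g^-1%g (r g v) = v.
Proof. by case=> r0 rM; rewrite -comp_lfunE -rM mulgV r0 id_lfunE. Qed.

Definition avg (f : 'Hom(V, W)) : 'Hom(V, W) :=
  #|gT|%:R^-1 *: \sum_g (r2 g \o f \o r1 g^-1%g)%VF.

Lemma avgE f v : avg f v = #|gT|%:R^-1 *: \sum_g r2 g (f (r1 g^-1%g v)).
Proof.
rewrite scale_lfunE sum_lfunE; congr (_ *: _); apply: eq_bigr => g _.
by rewrite !comp_lfunE.
Qed.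

Lemma avg_equivariant f : equivariant r1 r2 (avg f).
Proof.
move=> h v; rewrite !avgE linearZ linear_sum /=; congr (_ *: _).
rewrite [RHS](reindex_inj (mulIg h)) /=; apply: eq_bigr => g _.
rewrite (proj2 rep2) comp_lfunE; do 2!congr (r2 _ _); congr (f _).
by rewrite invMg (proj2 rep1) comp_lfunE repKV.
Qed.

Lemma card_neq0 : #|gT|%:R != 0 :> C.
Proof. by rewrite pnatr_eq0 -lt0n; apply/card_gt0P; exists 1%g. Qed.

Lemma avg_id (f : 'Hom(V, W)) v : (forall g, r2 g (f (r1 g^-1%g v)) = f v) -> avg f v = f v.
Proof.
move=> fv; rewrite avgE (eq_bigr _ (fun g _ => fv g)) sumr_const -scaler_nat scalerA.
by rewrite mulVf ?scale1r // card_neq0.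
Qed.

Lemma avg_equivariant_id f : equivariant r1 r2 f -> avg f = f.
Proof.
by move=> fE; apply/lfunP=> v; apply: avg_id => g; rewrite fE repK.
Qed.

Definition avg_mx (F : 'M[C]_(dim V, dim W)) : 'M[C]_(dim V, dim W) :=
  #|gT|%:R^-1 *: \sum_g f2mx (r1 g^-1%g) *m F *m f2mx (r2 g).

Fact avg_mx_linear : linear avg_mx.
Proof.
move=> k F G; rewrite /avg_mx scalerA mulrC -scalerA -scalerDr; congr (_ *: _).
rewrite scaler_sumr -big_split; apply: eq_bigr => g _ /=.
by rewrite mulmxDr mulmxDl -scalemxAr -scalemxAl.
Qed.
HB.instance Definition _ := GRing.isLinear.Build C _ _ _ avg_mx avg_mx_linear.

Lemma avg_mxE F : avg_mx F = f2mx (avg (Hom F)).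
Proof.
apply/row_matrixP=> i; rewrite !rowE -[delta_mx 0 i]r2vK -f2mxE avgE /avg_mx.
rewrite -scalemxAr mulmx_sumr [v2r (_ *: _)]linearZ /= [v2r (\sum_g _)]linear_sum /=; congr (_ *: _); apply: eq_bigr => g _.
by rewrite !f2mxE !mulmxA.
Qed.

(** Both sides are [#|gT|] times the trace of the averaging projection, which is
    computed on elementary matrices on the left, and is its rank on the right. *)
Lemma char_avg :
  \sum_g char r1 g^-1%g * char r2 g = #|gT|%:R * (\rank (lin_mx avg_mx))%:R.
Proof.
rewrite -trace_idem; last first.
  apply/row_matrixP=> i; rewrite !rowE mulmxA -[delta_mx 0 i]vec_mxK !mul_vec_lin.
  congr mxvec; rewrite /= !avg_mxE avg_equivariant_id //.
  by rewrite (_ : Hom (f2mx _) = avg (Hom (vec_mx (delta_mx 0 i)))); [exact: avg_equivariant|case: avg].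
rewrite trace_lin_mx /avg_mx.
have E i j : (#|gT|%:R^-1 *: \sum_g f2mx (r1 g^-1%g) *m delta_mx i j *m f2mx (r2 g)) i j =
    #|gT|%:R^-1 * \sum_g f2mx (r1 g^-1%g) i i * f2mx (r2 g) j j.
  rewrite mxE summxE; congr (_ * _); apply: eq_bigr => g _.
  rewrite mxE (bigD1 j) //= big1 ?addr0 => [|k kj]; rewrite mxE (bigD1 i) //= big1 ?addr0 ?mxE ?eqxx ?mulr1 //.
  - by move=> k ki; rewrite mxE (negbTE ki) mulr0.
  - by rewrite (negbTE kj) mulr0 mul0r.
  - by move=> l li; rewrite mxE (negbTE li) mulr0.
rewrite (eq_bigr _ (fun i _ => eq_bigr _ (fun j _ => E i j))).
transitivity (\sum_g (\sum_i f2mx (r1 g^-1%g) i i) * (\sum_j f2mx (r2 g) j j)) => //.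
under [in RHS]eq_bigr do rewrite -mulr_sumr.
rewrite -mulr_sumr mulrA divff ?card_neq0 // mul1r.
under [RHS]eq_bigr do rewrite exchange_big.
rewrite [RHS]exchange_big; apply: eq_bigr => g _ /=.
by rewrite mulr_suml; apply: eq_bigr => i _; rewrite mulr_sumr.
Qed.

Lemma char_orth : (forall f, equivariant r1 r2 f -> f = 0) ->
  \sum_g char r1 g^-1%g * char r2 g = 0.
Proof.
move=> no; rewrite char_avg (_ : lin_mx avg_mx = 0) ?mxrank0 ?mulr0 //.
apply/row_matrixP=> i; rewrite rowE -[delta_mx 0 i]vec_mxK mul_vec_lin row0 /=.
have /no e := avg_equivariant (Hom (vec_mx (delta_mx 0 i))).
by rewrite avg_mxE e f2mx0 linear0.
Qed.

End Average.

Lemma char_norm (V : vectType C) (r : gT -> 'End(V)) : is_rep r -> (fullv != 0 :> {vspace V})%VS ->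
  \sum_g char r g^-1%g * char r g != 0.
Proof.
move=> rep V0; rewrite (char_avg rep rep) mulf_neq0 ?card_neq0 // pnatr_eq0 mxrank_eq0.
apply: contraNneq V0 => E0; apply/eqP/vspaceP=> v; rewrite memvf memv0; apply/esym/eqP.
have : mxvec (f2mx (\1%VF : 'End(V))) *m lin_mx (avg_mx r r) = 0 by rewrite E0 mulmx0.
have f1 : equivariant r r (\1%VF : 'End(V)) by move=> g w; rewrite !id_lfunE.
have -> : f2mx (\1%VF : 'End(V)) = f2mx (Hom (f2mx (\1%VF : 'End(V)))) by [].
rewrite mul_vec_lin /= avg_mxE (_ : Hom _ = \1%VF); last by case: (\1%VF).
rewrite avg_equivariant_id //.
rewrite f2mx1 => /(congr1 vec_mx); rewrite mxvecK linear0 => V10.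
by apply: (can_inj (@v2rK _ V)); rewrite -[v2r v]mulmx1 V10 mulmx0 linear0.
Qed.

Lemma char_conj (V : vectType C) (r : gT -> 'End(V)) g h : is_rep r ->
  char r (g ^ h)%g = char r g.
Proof.
move=> rep; rewrite /char conjgE !(proj2 rep) !f2mx_comp mxtrace_mulC -mulmxA.
by rewrite -f2mx_comp -(proj2 rep) mulgV (proj1 rep) f2mx1 mulmx1.
Qed.

Lemma char_orthC (V W : vectType C) (r1 : gT -> 'End(V)) (r2 : gT -> 'End(W)) :
  is_rep r1 -> is_rep r2 ->
  (forall f, equivariant r1 r2 f -> f = 0) \/ (forall f, equivariant r2 r1 f -> f = 0) ->
  \sum_g char r1 g^-1%g * char r2 g = 0.
Proof.
move=> rep1 rep2 [no|no]; first exact: char_orth.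
rewrite -[RHS](char_orth rep2 rep1 no) (reindex_inj invg_inj) /=.
by apply: eq_bigr => g _; rewrite invgK mulrC.
Qed.

(** Elements with the same [ct] being conjugate, characters are functions of [ct].
    Those of the given representations are orthogonal, hence independent, and as
    many as the values of [ct]; so they span the functions of [ct], and the
    character of [W] is a combination of them. If [W] had no map to any of the
    representations, its character would be orthogonal to itself. *)
Lemma exists_equivariant (T : eqType) (ct : gT -> T) (V : T -> vectType C)
    (r : forall l, gT -> 'End(V l)) (W : vectType C) (rW : gT -> 'End(W)) :
    (forall g h, ct g = ct h -> exists x, h = (g ^ x)%g) ->
    (forall g, is_rep (r (ct g))) ->
    (forall g, (fullv != 0 :> {vspace V (ct g)})%VS) ->
    (forall g h, ct g != ct h ->
      (forall f, equivariant (r (ct g)) (r (ct h)) f -> f = 0) \/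
      (forall f, equivariant (r (ct h)) (r (ct g)) f -> f = 0)) ->
    is_rep rW -> (fullv != 0 :> {vspace W})%VS ->
  exists g, exists2 f, equivariant rW (r (ct g)) f & f != 0.
Proof.
move=> ct_conj rep V0 orth repW W0.
have [//|none] := pselect (exists g, exists2 f, equivariant rW (r (ct g)) f & f != 0).
exfalso; move/negP: (char_norm repW W0); apply; apply/eqP.
have noW g f : equivariant rW (r (ct g)) f -> f = 0.
  by move=> fE; apply/eqP; apply: contrapT => /negP f0; apply: none; exists g, f.
(* rho l is an element with the l-th value of ct, and lab g the index of ct g *)
pose L := undup (map ct (enum gT)); pose k := size L.
have ctL g : ct g \in L by rewrite mem_undup map_f ?mem_enum.
have rho_ex (l : 'I_k) : exists g, ct g = tnth (in_tuple L) l.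
  have : tnth (in_tuple L) l \in L by apply: mem_tnth.
  by rewrite mem_undup => /mapP[g _ ->]; exists g.
have [rho rhoE] := choice rho_ex.
have rho_inj i j : i != j -> ct (rho i) != ct (rho j).
  have /tuple_uniqP tnth_inj : uniq (in_tuple L) := undup_uniq _.
  by rewrite !rhoE (inj_eq tnth_inj).
pose lab g : 'I_k := Ordinal (etrans (index_mem (ct g) L) (ctL g)).
have labE g : ct (rho (lab g)) = ct g.
  by rewrite rhoE (tnth_nth (ct 1%g)) /= nth_index.
pose X (i : 'I_k) := char (r (ct (rho i))).
have char_lab (U : vectType C) (s : gT -> 'End(U)) g : is_rep s -> char s g = char s (rho (lab g)).
  by move=> reps; have [x e] := ct_conj _ _ (labE g); rewrite {1}e char_conj.
pose G := \matrix_(i, l) X i (rho l).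
have combo (u : 'rV_k) g : \sum_i u 0 i * X i g = (u *m G) 0 (lab g).
  by rewrite mxE; apply: eq_bigr => i _; rewrite mxE /X char_lab.
have Gfree : row_free G.
  apply/inj_row_free => u uG; apply/rowP=> j; rewrite [RHS]mxE; apply/eqP.
  have : \sum_g X j g^-1%g * (\sum_i u 0 i * X i g) = 0.
    by apply: big1 => g _; rewrite combo uG mxE mulr0.
  under eq_bigr do rewrite mulr_sumr.
  rewrite exchange_big (bigD1 j) //= [X in _ + X]big1 ?addr0 => [|i ij].
    under eq_bigr do rewrite mulrCA.
    rewrite -mulr_sumr => /eqP; rewrite mulf_eq0 => /orP[//|/eqP e].
    by case/negP: (char_norm (rep (rho j)) (V0 (rho j))); apply/eqP.
  under eq_bigr do rewrite mulrCA.
  by rewrite -mulr_sumr char_orthC ?mulr0 //; apply: orth; rewrite rho_inj // eq_sym.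
have [w wE] : exists w, w *m G = \row_l char rW (rho l).
  by exists (\row_l char rW (rho l) *m invmx G); rewrite mulmxKV // -row_free_unit.
have charW g : char rW g = \sum_i w 0 i * X i g by rewrite combo wE mxE char_lab.
under eq_bigr => g _ do rewrite (charW g) mulr_sumr.
rewrite exchange_big big1 // => i _; under eq_bigr do rewrite mulrCA.
by rewrite -mulr_sumr char_orth ?mulr0 //; apply: noW.
Qed.

End Representations.
End Characters.

(** * Cycle types *)

Section CycleType.

Variable n : nat.
Implicit Types s t : 'S_n.

Definition cycle_blocks s : seq {set 'I_n} :=
  sort (fun X Y : {set 'I_n} => #|X| >= #|Y|)%N (enum (porbits s)).

Definition cycle_type s : seq nat := [seq #|pred_of_set X| | X <- cycle_blocks s].

Lemma mem_cycle_blocks s X : (X \in cycle_blocks s) = (X \in porbits s).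
Proof. by rewrite mem_sort mem_enum. Qed.

Lemma porbits_partition s : partition (porbits s) [set: 'I_n].
Proof.
have -> : porbits s = equivalence_partition (fun x y => y \in porbit s x) [set: 'I_n].
  by apply/setP=> X; apply/imsetP/imsetP => -[x _ ->]; exists x; rewrite ?inE //;
    apply/setP=> y; rewrite !inE.
apply/equivalence_partitionP => x y z _ _ _; split; first exact: porbit_id.
by rewrite porbit_sym -eq_porbit_mem => /eqP ->.
Qed.

Lemma cycle_type_partition s : is_partition n (cycle_type s).
Proof.
apply/and3P; split.
- by rewrite sorted_map; apply: sort_sorted => X Y; apply: leq_total.
- apply/mapP=> -[X]; rewrite mem_cycle_blocks => /imsetP[x _ ->] /esym/eqP.
  by rewrite cards_eq0 => /eqP e; have := porbit_id s x; rewrite e inE.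
rewrite sumnE big_map (perm_big (enum (porbits s))) ?perm_sort //= big_enum /=.
by rewrite -(card_partition (porbits_partition s)) cardsT card_ord.
Qed.

Definition cycle_list s (X : {set 'I_n}) : seq 'I_n :=
  if [pick x in X] is Some x then traject s x #|X| else [::].

(** The effect of a permutation on positions, once its cycles are written out one
    after the other with lengths [lam]: the next position in the same cycle. *)
Definition next_in_shape (lam : seq nat) (k : nat) : nat :=
  let r := reshape_index lam k in
  flatten_index lam r ((reshape_offset lam k).+1 %% nth 0 lam r)%N.

Lemma cycle_listP s X : X \in cycle_blocks s ->
  [/\ size (cycle_list s X) = #|X|, cycle_list s X =i X &
     forall x0 c, (c < #|X|)%N ->
     s (nth x0 (cycle_list s X) c) = nth x0 (cycle_list s X) (c.+1 %% #|X|)].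
Proof.
rewrite mem_cycle_blocks /cycle_list => /imsetP[x _ XE].
case: pickP => [y yX|/(_ x)]; last by rewrite XE porbit_id.
have {}XE : X = porbit s y by rewrite XE; apply/eqP; rewrite eq_porbit_mem porbit_sym -XE.
split=> [|z|x0 c lt_c]; first by rewrite size_traject.
  by rewrite XE porbit_traject.
have lt_c' : (c.+1 %% #|X| < #|X|)%N by rewrite ltn_mod; apply: leq_trans lt_c.
rewrite !(set_nth_default y x0) ?size_traject // !nth_traject //.
have [e|lt_Sc] : c.+1 = #|X| \/ (c.+1 < #|X|)%N by lia.
  by rewrite -iterS e modnn XE iter_porbit.
by rewrite modn_small.
Qed.

Lemma cycle_layout s (x0 : 'I_n) : exists L : seq 'I_n, [/\ uniq L, size L = n &
  forall k, (k < n)%N -> s (nth x0 L k) = nth x0 L (next_in_shape (cycle_type s) k)].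
Proof.
pose css := map (cycle_list s) (cycle_blocks s).
have shapeE : shape css = cycle_type s.
  rewrite /shape /css -map_comp; apply/eq_in_map => X Xs /=.
  by have [] := cycle_listP Xs.
have sumn_ct : sumn (cycle_type s) = n by have /and3P[_ _ /eqP] := cycle_type_partition s.
have sizeL : size (flatten css) = n by rewrite size_flatten shapeE.
exists (flatten css); split=> // [|k lt_k].
  apply: (leq_size_uniq (enum_uniq 'I_n)); last by rewrite sizeL size_enum_ord.
  move=> i _; apply/flatten_mapP; exists (porbit s i).
    by rewrite mem_cycle_blocks imset_f.
  have [|_ -> _] := @cycle_listP s (porbit s i); last exact: porbit_id.
  by rewrite mem_cycle_blocks imset_f.
rewrite !nth_flatten shapeE /next_in_shape.
set r := reshape_index _ k; set c := reshape_offset _ k.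
have lt_r : (r < size (cycle_type s))%N by apply: reshape_indexP; rewrite sumn_ct.
have lt_c : (c < nth 0 (cycle_type s) r)%N by apply: reshape_offsetP; rewrite sumn_ct.
have lt_c' : (c.+1 %% nth 0 (cycle_type s) r < nth 0 (cycle_type s) r)%N.
  by rewrite ltn_mod; apply: leq_trans lt_c.
rewrite flatten_indexKl // flatten_indexKr //.
move: lt_r lt_c; rewrite size_map => lt_r; rewrite !(nth_map set0) // => lt_c.
by have [|_ _ ->] := @cycle_listP s (nth set0 (cycle_blocks s) r); first exact: mem_nth.
Qed.

(** In suitable orderings of the points both permutations act on positions as
    [next_in_shape]; matching the orderings conjugates one into the other. *)
Lemma cycle_type_conj s t : cycle_type s = cycle_type t -> exists x, s = (t ^ x)%g.
Proof.
move=> st; case: (posnP n) => [n0|n_gt0].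
  by exists 1%g; apply/permP=> i; have := ltn_ord i; rewrite {2}n0.
pose x0 := Ordinal n_gt0.
have [L [uL sL nL]] := cycle_layout s x0; have [K [uK sK nK]] := cycle_layout t x0.
have sizeK : (size (enum 'I_n) <= size K)%N by rewrite size_enum_ord sK.
have [_ memK] := uniq_min_size uK (fun j _ => mem_enum 'I_n j) sizeK.
have inK i : i \in K by rewrite memK mem_enum.
have lt_nxt k : (k < n)%N -> (next_in_shape (cycle_type t) k < n)%N.
  have /and3P[_ _ /eqP sum_ct] := cycle_type_partition t.
  move=> lt_k; rewrite -[X in (_ < X)%N]sum_ct; apply: flatten_indexP.
  have lt_c : (reshape_offset (cycle_type t) k < nth 0 (cycle_type t) (reshape_index (cycle_type t) k))%N.
    by apply: reshape_offsetP; rewrite sum_ct.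
  by rewrite ltn_mod; apply: leq_trans lt_c.
have lt_ix i : (index i K < n)%N by rewrite -{2}sK index_mem.
have f_inj : injective (fun i => nth x0 L (index i K)).
  move=> i j /eqP; rewrite nth_uniq ?sL // => /eqP e.
  by rewrite -(nth_index x0 (inK i)) e nth_index.
exists (perm f_inj); apply/permP=> j; rewrite conjgE !permM.
have [i ->] : exists i, j = perm f_inj i by exists ((perm f_inj)^-1%g j); rewrite permKV.
rewrite permK !permE; set k := index i K.
have lt_k : (k < n)%N by apply: lt_ix.
by rewrite nL // -{1}(nth_index x0 (inK i)) nK // index_uniq ?sK ?lt_nxt // st.
Qed.

End CycleType.

(** * Tableaux and dominance *)

Section Dominance.

Local Open Scope nat_scope.

Variables (n : nat) (lam : seq nat).
Hypothesis lamP : is_partition n lam.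
Implicit Types (i j : 'I_n) (c k : nat).

(** The tableau of shape [lam] filled in reading order: the entry [i] lies in row
    [cell_row i] and column [cell_col i]. *)
Definition cell_row i : nat := reshape_index lam i.
Definition cell_col i : nat := reshape_offset lam i.

Let sum_lam : sumn lam = n. Proof. by case/and3P: lamP => _ _ /eqP. Qed.

Lemma cell_inj i j : cell_row i = cell_row j -> cell_col i = cell_col j -> i = j.
Proof.
rewrite /cell_row /cell_col => rij cij; apply: val_inj => /=.
by rewrite -(reshape_indexK lam i) -(reshape_indexK lam j) rij cij.
Qed.

Lemma cell_row_lt i : (cell_row i < size lam)%N.
Proof. by apply: reshape_indexP; rewrite sum_lam. Qed.

Lemma cell_col_lt i : (cell_col i < nth 0 lam (cell_row i))%N.
Proof. by apply: reshape_offsetP; rewrite sum_lam. Qed.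

Lemma nth_part_geq r r' : (r' <= r)%N -> (nth 0 lam r <= nth 0 lam r')%N.
Proof.
move=> le_r; have [lt_r|ge_r] := ltnP r (size lam); last by rewrite nth_default.
have /and3P[sorted_lam _ _] := lamP.
apply: (sorted_leq_nth (leT := geq)) => //; rewrite ?inE //.
- by move=> a b d /= ab bd; apply: leq_trans ab.
- exact: leqnn.
- exact: leq_ltn_trans lt_r.
Qed.

Lemma cell_above i r : (r <= cell_row i)%N -> exists2 j, cell_row j = r & cell_col j = cell_col i.
Proof.
move=> le_r; have lt_c : (cell_col i < nth 0 lam r)%N.
  exact: leq_trans (cell_col_lt i) (nth_part_geq le_r).
have := flatten_indexP lt_c; rewrite sum_lam => lt_j.
exists (Ordinal lt_j); [exact: flatten_indexKl|exact: flatten_indexKr].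
Qed.

Lemma sumn_take_mono k l : (k <= l)%N -> (sumn (take k lam) <= sumn (take l lam))%N.
Proof. by move=> /subnKC <-; rewrite takeD sumn_cat leq_addr. Qed.

Lemma cell_row_ltE i k : (cell_row i < k)%N = (i < sumn (take k lam))%N.
Proof.
have iE : nat_of_ord i = (sumn (take (cell_row i) lam) + cell_col i)%N.
  by rewrite -[LHS](reshape_indexK lam).
have lt_i : (i < sumn (take (cell_row i).+1 lam))%N.
  by rewrite (take_nth 0) ?cell_row_lt // -cats1 sumn_cat /= addn0 {1}iE ltn_add2l cell_col_lt.
have [lt_k|ge_k] := ltnP (cell_row i) k.
  by rewrite (leq_trans lt_i) // sumn_take_mono.
by apply/esym/negbTE; rewrite -leqNgt {1}iE (leq_trans (sumn_take_mono ge_k)) // leq_addr.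
Qed.

Lemma card_cell_row_lt k : #|[pred i | (cell_row i < k)%N]| = sumn (take k lam).
Proof.
have le_n : (sumn (take k lam) <= n)%N.
  by rewrite -[leqRHS]sum_lam -[in leqRHS](cat_take_drop k lam) sumn_cat leq_addr.
rewrite -[RHS]card_ord -(card_image (f := widen_ord le_n)); last first.
  by move=> a b /(congr1 val) /= /val_inj.
apply: eq_card => i; rewrite !inE cell_row_ltE; apply/idP/imageP => [lt_i|[j _ ->]] //=.
by exists (Ordinal lt_i) => //; apply: val_inj.
Qed.

(** [f] is the row function of a tabloid, no two entries of which share both a
    row in it and a column of the tableau. *)
Variable f : 'I_n -> nat.
Hypothesis f_col : forall i j, cell_col i = cell_col j -> f i = f j -> i = j.

(** The first [k] rows of the tabloid take at most [k] entries of a column of the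
    tableau, because [f] is injective on it; the first [k] rows of the tableau hold
    either [k] entries of that column or all of them. *)
Lemma column_dominates c k :
  (#|[pred i | (cell_col i == c) && (f i < k)]| <=
   #|[pred i | (cell_col i == c) && (cell_row i < k)]|)%N.
Proof.
have [/existsP[i0 /andP[/eqP i0c ge_k]]|/existsPn all_lt] :=
    boolP [exists i, (cell_col i == c) && (k <= cell_row i)%N].
  apply: (@leq_trans k).
    have uniq_f : uniq (map f (enum [pred i | (cell_col i == c) && (f i < k)])).
      rewrite map_inj_in_uniq ?enum_uniq // => i j; rewrite !mem_enum !inE.
      by case/andP=> /eqP ic _ /andP[/eqP jc _]; apply: f_col; rewrite ic jc.
    rewrite cardE -(size_map f) -[X in (_ <= X)%N](size_iota 0 k).
    apply: uniq_leq_size => // _ /mapP[i + ->]; rewrite mem_enum mem_iota inE.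
    by case/andP.
  rewrite cardE -(size_map cell_row) -[X in (X <= _)%N](size_iota 0 k).
  apply: uniq_leq_size (iota_uniq _ _) _ => r; rewrite mem_iota /= add0n => lt_r.
  have [j jr jc] := cell_above (leq_trans (ltnW lt_r) ge_k).
  by rewrite -jr; apply: map_f; rewrite mem_enum inE jc i0c eqxx jr.
apply/subset_leq_card/subsetP=> i; rewrite !inE => /andP[ic _]; rewrite ic /= ltnNge.
by have := all_lt i; rewrite ic.
Qed.

Lemma card_by_column (P : pred 'I_n) :
  #|P| = (\sum_(c < n) #|[pred i | (cell_col i == c) && P i]|)%N.
Proof.
have col_lt i : (cell_col i < n)%N.
  by apply: leq_ltn_trans (ltn_ord i); rewrite /cell_col /reshape_offset leq_subr.
rewrite -sum1_card (partition_big (fun i => Ordinal (col_lt i)) predT) //=.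
apply: eq_bigr => c _; rewrite -sum1_card; apply: eq_bigl => i.
by rewrite !inE andbC -val_eqE.
Qed.

Lemma tabloid_dominates k : (#|[pred i | f i < k]| <= sumn (take k lam))%N.
Proof.
rewrite -card_cell_row_lt !card_by_column.
by apply: leq_sum => c _; apply: column_dominates.
Qed.

(** If [f] has shape [lam] the inequalities of [column_dominates] are equalities:
    on each column, [f] takes the same values as [cell_row], and the columns can
    be permuted to make them agree. *)
Lemma column_sorting : (forall k, #|[pred i | (f i < k)%N]| = sumn (take k lam)) ->
  exists q : 'S_n, forall i, cell_row (q i) = f i /\ cell_col (q i) = cell_col i.
Proof.
move=> card_f.
have card_col (c : 'I_n) k : #|[pred i | (cell_col i == c) && (f i < k)%N]| =
    #|[pred i | (cell_col i == c) && (cell_row i < k)%N]|.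
  have := card_f k; rewrite -card_cell_row_lt => e.
  rewrite [LHS]card_by_column [RHS]card_by_column in e; move/eqP: e.
  rewrite (leqif_sum (fun (c : 'I_n) _ => leqif_eq (column_dominates c k))).
  by move/forall_inP => /(_ c isT) /eqP.
have q_ex i : exists j, cell_row j = f i /\ cell_col j = cell_col i.
  have [/existsP[j /andP[/eqP jc /eqP jr]]|/existsPn no] :=
    boolP [exists j, (cell_col j == cell_col i) && (cell_row j == f i)]; first by exists j.
  have col_lt : (cell_col i < n)%N.
    by apply: leq_ltn_trans (ltn_ord i); rewrite /cell_col /reshape_offset leq_subr.
  have := card_col (Ordinal col_lt) (f i).+1; have := card_col (Ordinal col_lt) (f i).
  rewrite /= => e1 e2; exfalso.
  have e3 : #|[pred j | (cell_col j == cell_col i) && (cell_row j < (f i).+1)%N]| =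
            #|[pred j | (cell_col j == cell_col i) && (cell_row j < f i)%N]|.
    apply: eq_card => j; rewrite !inE; have := no j; case: eqP => //= _ nr.
    by rewrite ltnS leq_eqVlt (negbTE nr).
  have : (#|[pred j | (cell_col j == cell_col i) && (f j < f i)%N]| <
          #|[pred j | (cell_col j == cell_col i) && (f j < (f i).+1)%N]|)%N.
    apply: proper_card; apply/properP; split.
      by apply/subsetP=> j; rewrite !inE => /andP[-> /= /ltnW]; rewrite ltnS.
    by exists i; rewrite !inE ?eqxx ?ltnSn ?ltnn.
  by rewrite e1 e2 e3 ltnn.
have [q qE] := choice q_ex.
have q_inj : injective q.
  move=> i j qij; have [ri ci] := qE i; have [rj cj] := qE j.
  by apply: f_col; [rewrite -ci -cj qij|rewrite -ri -rj qij].
by exists (perm q_inj) => i; rewrite permE.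
Qed.

End Dominance.

Lemma partition_eq n lam mu : is_partition n lam -> is_partition n mu ->
  (forall k, sumn (take k lam) = sumn (take k mu)) -> lam = mu.
Proof.
move=> lamP muP e.
have nthE k : nth 0%N lam k = nth 0%N mu k.
  have step nu : (sumn (take k nu) + nth 0%N nu k = sumn (take k.+1 nu))%N.
    have [lt_k|ge_k] := ltnP k (size nu).
      by rewrite (take_nth 0%N) // -cats1 sumn_cat /= addn0.
    by rewrite nth_default // !take_oversize ?addn0 // ltnW.
  by have := step mu; rewrite -!e -step => /addnI.
have size_le (nu rho : seq nat) : is_partition n nu -> (forall k, nth 0%N nu k = nth 0%N rho k) ->
    (size nu <= size rho)%N.
  move=> /and3P[_ nu0 _] er; rewrite leqNgt; apply/negP => lt_s.
  by case/negP: nu0; rewrite -(nth_default 0%N (leqnn (size rho))) -er mem_nth.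
apply: (@eq_from_nth _ 0%N) => [|k _ //]; apply/anti_leq.
by rewrite !size_le.
Qed.

(** * Specht modules *)

Section SpechtModules.

Variables (C : numClosedFieldType) (n : nat).
Notation T := (tabloid_space C n).
Notation act := (@perm_act C n).
Notation vec := (@tabloid_vec C n).
Implicit Types (lam mu : seq nat) (g h s : 'S_n).

Lemma cell_row_le lam i : is_partition n lam -> (cell_row lam (i : 'I_n) < n.+1)%N.
Proof.
move=> lamP; apply: leq_trans (cell_row_lt lamP i) _.
have /and3P[_ lam0 /eqP <-] := lamP; apply: leqW.
elim: lam lam0 {lamP} => //= a l IH; rewrite inE negb_or eq_sym -lt0n => /andP[a0 l0].
by have := IH l0; lia.
Qed.

Lemma tabloid_ofE lam g i : is_partition n lam ->
  tabloid_of lam g i = cell_row lam (g^-1%g i) :> nat.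
Proof. by move=> lamP; rewrite ffunE inordK // /tab_row; apply: cell_row_le. Qed.

Lemma tabloid_of_act lam g : act g (vec (tabloid_of lam 1)) = vec (tabloid_of lam g).
Proof.
rewrite perm_act_vec; congr vec; apply/ffunP=> i.
by rewrite !ffunE /tab_row invg1 perm1.
Qed.

Section Fixed.

Variables (lam : seq nat) (lamP : is_partition n lam).
Notation stab := (col_stab lam (1%g : 'S_n)).

Lemma col_stabP s : reflect (forall i, cell_col lam (s i) = cell_col lam i) (s \in stab).
Proof.
rewrite inE; apply: (iffP forallP) => cs i; have := cs i; rewrite /tab_col invg1 !perm1.
  by move/eqP.
by rewrite -/(cell_col lam _) => ->.
Qed.

Lemma col_stabM s g : s \in stab -> (s * g \in stab)%g = (g \in stab).
Proof.
move=> /col_stabP cs; apply/col_stabP/col_stabP => cg i; last by rewrite permM cg cs.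
by have := cg (s^-1%g i); rewrite permM permKV => ->; rewrite -[in RHS](permKV s i) cs.
Qed.

(** The column antisymmetriser of the tableau in reading order. *)
Definition kappa : 'End(T) := \sum_(s in stab) (-1) ^+ s *: act s.

Lemma kappaE v : kappa v = \sum_(s in stab) (-1) ^+ s *: act s v.
Proof.
by rewrite sum_lfunE; apply: eq_bigr => s _; rewrite scale_lfunE.
Qed.

Lemma kappa_act g v : g \in stab -> kappa (act g v) = (-1) ^+ g *: kappa v.
Proof.
move=> gs; rewrite !kappaE scaler_sumr [RHS](reindex_inj (mulgI g)) /=.
apply: eq_big => [s|s _]; first by rewrite col_stabM.
by rewrite perm_actM comp_lfunE odd_permM signr_addb scalerA mulrA -signr_addb addbb mul1r.
Qed.

Notation e := (polytabloid C lam (1%g : 'S_n)).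

Lemma polytabloid1E : e = kappa (vec (tabloid_of lam 1)).
Proof.
rewrite kappaE; apply: eq_bigr => s _; rewrite tabloid_of_act mul1g //.
Qed.

Lemma kappa_kappa v : kappa (kappa v) = #|stab|%:R *: kappa v.
Proof.
rewrite [in LHS](kappaE v) linear_sum /= scaler_nat -sumr_const; apply: eq_bigr => s ss.
by rewrite linearZ /= kappa_act // scalerA -signr_addb addbb scale1r.
Qed.

Lemma card_stab_neq0 : #|stab|%:R != 0 :> C.
Proof.
rewrite pnatr_eq0 -lt0n; apply/card_gt0P; exists 1%g.
by apply/col_stabP=> i; rewrite perm1.
Qed.

Lemma polytabloid1_neq0 : e != 0.
Proof.
apply/eqP => /ffunP/(_ (tabloid_of lam 1)) /eqP; rewrite polytabloid1E kappaE.
rewrite sum_ffunE (bigD1 1%g) /=; last by apply/col_stabP=> i; rewrite perm1.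
rewrite big1 => [|s /andP[ss s1]].
  by rewrite addr0 tabloid_of_act !ffunE eqxx odd_perm1 scale1r oner_eq0.
rewrite tabloid_of_act !ffunE; case: eqP => [es|_]; last by rewrite scaler0.
case/eqP: s1; apply/permP=> i; rewrite perm1.
have /(congr1 val) := congr1 (fun f : tabloid n => f (s i)) es.
rewrite /= !tabloid_ofE // invg1 perm1 permK => rE.
by apply: (cell_inj rE); move: i {rE}; apply/col_stabP.
Qed.

(** The transposition of [i] and [j] fixes the tabloid and lies in the column
    stabiliser, so [kappa] of the tabloid is its own opposite. *)
Lemma kappa_vec_eq0 (f : tabloid n) i j : i != j -> cell_col lam i = cell_col lam j ->
  f i = f j -> kappa (vec f) = 0.
Proof.
move=> ij cij fij; have ts : tperm i j \in stab.
  by apply/col_stabP=> k; case: tpermP => // ->.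
have : kappa (act (tperm i j) (vec f)) = kappa (vec f).
  rewrite perm_act_vec; congr (kappa (vec _)); apply/ffunP=> k; rewrite ffunE tpermV.
  by case: tpermP => // ->.
rewrite kappa_act // odd_tperm ij scaleN1r => /eqP; rewrite eq_sym -addr_eq0 -mulr2n.
by rewrite -scaler_nat scaler_eq0 pnatr_eq0 /= => /eqP.
Qed.

Lemma kappa_vec_neq0 (f : tabloid n) : kappa (vec f) != 0 ->
  forall i j, cell_col lam i = cell_col lam j -> f i = f j :> nat -> i = j.
Proof.
move=> nz i j cij fij; apply/eqP; apply: contraNT nz => ij.
by apply/eqP; apply: (kappa_vec_eq0 ij cij); apply: val_inj.
Qed.

End Fixed.

Lemma specht_sub mu (X : {vspace T}) :
  (forall g, vec (tabloid_of mu g) \in X) -> (specht C n mu <= X)%VS.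
Proof.
move=> vX; apply/span_subvP=> _ /imageP[g _ ->].
by apply: memv_suml => s _; apply: memvZ.
Qed.

Lemma card_tabloid_lt mu g k : is_partition n mu ->
  #|[pred i | (tabloid_of mu g i < k)%N]| = sumn (take k mu).
Proof.
move=> muP; rewrite -(card_cell_row_lt muP) -[RHS](card_image (@perm_inj _ g)).
apply: eq_card => i; rewrite !inE tabloid_ofE //; apply/idP/imageP => [ri|[j rj ->]].
  by exists (g^-1%g i); rewrite ?permKV.
by rewrite permK.
Qed.

(** Some tabloid of shape [mu] is not killed by [kappa], hence has no two entries
    of a column in the same row. *)
Lemma kappa_specht_dominates lam mu v : is_partition n lam -> is_partition n mu ->
  v \in specht C n mu -> kappa lam v != 0 ->
  forall k, (sumn (take k mu) <= sumn (take k lam))%N.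
Proof.
move=> lamP muP vS kv k; rewrite leqNgt; apply: contra kv => lt_k.
rewrite -memv_ker; apply: (subvP _ _ vS); apply: specht_sub => g.
rewrite memv_ker; apply: contraTT lt_k => /kappa_vec_neq0 nz.
by rewrite -leqNgt -(card_tabloid_lt g k muP); apply: tabloid_dominates.
Qed.

(** A tabloid of shape [lam] that is not killed by [kappa] is obtained from the
    standard one by an element of the column stabiliser. *)
Lemma kappa_specht_line lam v : is_partition n lam -> v \in specht C n lam ->
  kappa lam v \in <[polytabloid C lam 1%g]>%VS.
Proof.
move=> lamP vS; rewrite memv_preim; apply: (subvP _ _ vS); apply: specht_sub => g.
rewrite -memv_preim; have [->|/kappa_vec_neq0 nz] := eqVneq (kappa lam (vec (tabloid_of lam g))) 0.
  exact: mem0v.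
have [q qE] := column_sorting lamP nz (fun k => card_tabloid_lt g k lamP).
have -> : vec (tabloid_of lam g) = act q^-1%g (vec (tabloid_of lam 1)).
  rewrite perm_act_vec; congr vec; apply/ffunP=> i; apply: val_inj.
  rewrite [in RHS]ffunE invgK; transitivity (cell_row lam (q i)).
    by rewrite (proj1 (qE i)).
  by rewrite [RHS]tabloid_ofE // invg1 perm1.
rewrite kappa_act; first by rewrite -polytabloid1E memvZ ?memv_line.
by apply/col_stabP=> i; have [_ <-] := qE (q^-1%g i); rewrite permKV.
Qed.

Notation rho lam := (@specht_act C n lam : 'S_n -> 'End(spechtv C n lam)).

Lemma specht_rep lam : is_rep (rho lam).
Proof.
split=> [|g h]; apply/lfunP=> v; apply: val_inj.
  by rewrite /= specht_actE perm_act1 !id_lfunE.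
by rewrite comp_lfunE /= !specht_actE perm_actM comp_lfunE.
Qed.

Definition specht_gen lam : subvs_of (specht C n lam) :=
  vsproj _ (polytabloid C lam (1%g : 'S_n)).

Lemma specht_genE lam : vsval (specht_gen lam) = polytabloid C lam 1%g.
Proof. by rewrite vsprojK //; apply/memv_span/image_f. Qed.

Lemma specht_act_kappa lam (v : spechtv C n lam) mu :
  vsval (\sum_(s in col_stab mu 1%g) (-1) ^+ s *: rho lam s v : subvs_of _) =
  kappa mu (vsval (v : subvs_of _)).
Proof.
rewrite kappaE linear_sum; apply: eq_bigr => s _ /=.
by rewrite -specht_actE.
Qed.

(** The generating polytabloid is an eigenvector of [kappa], and so is its image
    under an equivariant map. *)
Lemma equivariant_specht_gen lam mu (f : 'Hom(spechtv C n lam, spechtv C n mu)) :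
  is_partition n lam -> equivariant (rho lam) (rho mu) f ->
  kappa lam (vsval (f (specht_gen lam) : subvs_of _)) =
  #|col_stab lam (1%g : 'S_n)|%:R *: vsval (f (specht_gen lam) : subvs_of _).
Proof.
move=> lamP fE; rewrite -specht_act_kappa.
under eq_bigr do rewrite fE -linearZ.
rewrite -linear_sum /=.
have -> : \sum_(s in col_stab lam 1%g) (-1) ^+ s *: rho lam s (specht_gen lam) =
    #|col_stab lam (1%g : 'S_n)|%:R *: specht_gen lam :> spechtv C n lam.
  apply: val_inj; rewrite /= specht_act_kappa specht_genE.
  by rewrite [in LHS]polytabloid1E kappa_kappa -polytabloid1E // -specht_genE.
by rewrite linearZ.
Qed.

Lemma equivariant_specht_eq0 lam (W : vectType C) (r : 'S_n -> 'End(W))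
    (f : 'Hom(spechtv C n lam, W)) :
  equivariant (rho lam) r f -> f (specht_gen lam) = 0 -> f = 0.
Proof.
move=> fE f0; apply/lfunP=> v; rewrite zero_lfunE; apply/eqP; rewrite -memv_ker.
have : (specht C n lam <= linfun (vsval : spechtv C n lam -> T) @: lker f)%VS.
  apply/span_subvP=> _ /imageP[g _ ->].
  have -> : polytabloid C lam g = linfun (vsval : spechtv C n lam -> T) (rho lam g (specht_gen lam)).
    by rewrite lfunE /= specht_actE specht_genE perm_act_polytabloid mul1g.
  by apply: memv_img; rewrite memv_ker -fE f0 linear0.
move/subvP/(_ _ (subvsP v))/memv_imgP => [w wk]; rewrite lfunE /= => /val_inj e.
by rewrite e.
Qed.

(** The image of the generator lies in the image of [kappa], which is the line that
    the generator spans. *)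
Lemma specht_schur lam (f : 'End(spechtv C n lam)) : is_partition n lam ->
  equivariant (rho lam) (rho lam) f -> exists k, f = k *: \1%VF.
Proof.
move=> lamP fE; have := kappa_specht_line lamP (subvsP (f (specht_gen lam))).
rewrite equivariant_specht_gen // => /vlineP[k].
move/(canRL (scalerK (card_stab_neq0 lam))); rewrite scalerA => fk.
exists (#|col_stab lam (1%g : 'S_n)|%:R^-1 * k); apply/eqP; rewrite -subr_eq0; apply/eqP.
apply: (@equivariant_specht_eq0 lam _ (rho lam)) => [g v|].
  by rewrite !add_lfunE !opp_lfunE !scale_lfunE !id_lfunE linearB linearZ /= fE.
apply/eqP; rewrite add_lfunE opp_lfunE scale_lfunE id_lfunE subr_eq0; apply/eqP/val_inj.
by rewrite /= [LHS]fk -specht_genE.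
Qed.

Lemma specht_neq0 lam : is_partition n lam -> (fullv != 0 :> {vspace spechtv C n lam})%VS.
Proof.
move=> lamP; apply: contra_neq (polytabloid1_neq0 lamP) => full0.
have : specht_gen lam \in (fullv : {vspace spechtv C n lam}) by rewrite memvf.
by rewrite full0 memv0 => /eqP e; rewrite -specht_genE e linear0.
Qed.

Lemma equivariant_specht_dominates lam mu (f : 'Hom(spechtv C n lam, spechtv C n mu)) :
  is_partition n lam -> is_partition n mu ->
  equivariant (rho lam) (rho mu) f -> f != 0 ->
  forall k, (sumn (take k mu) <= sumn (take k lam))%N.
Proof.
move=> lamP muP fE f0; apply: (kappa_specht_dominates lamP muP (subvsP (f (specht_gen lam)))).
rewrite equivariant_specht_gen // scaler_eq0 negb_or card_stab_neq0 /=.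
apply: contra_neq f0 => e; apply: (equivariant_specht_eq0 fE).
by apply: val_inj; rewrite /= e.
Qed.

Lemma equivariant_specht_orth lam mu : is_partition n lam -> is_partition n mu -> lam != mu ->
  (forall f, equivariant (rho lam) (rho mu) f -> f = 0) \/
  (forall f, equivariant (rho mu) (rho lam) f -> f = 0).
Proof.
move=> lamP muP ne; have [[f fE f0]|none] := pselect (exists2 f, equivariant (rho lam) (rho mu) f & f != 0).
  right=> g gE; apply/eqP; apply: contraNT ne => g0; apply/eqP.
  apply: (partition_eq lamP muP) => k; apply/anti_leq.
  by rewrite (equivariant_specht_dominates muP lamP gE) ?(equivariant_specht_dominates lamP muP fE).
by left=> f fE; apply/eqP; apply: contrapT => /negP f0; apply: none; exists f.
Qed.

Lemma exists_equivariant_specht (W : vectType C) (r : 'S_n -> 'End(W)) :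
  is_rep r -> (fullv != 0 :> {vspace W})%VS ->
  exists2 lam, is_partition n lam & exists2 f, equivariant r (rho lam) f & f != 0.
Proof.
move=> rep W0; have ctP := @cycle_type_partition n.
have [|g|g|g h gh|g [f fE f0]] := exists_equivariant (ct := @cycle_type n)
    (r := fun lam => rho lam) _ _ _ _ rep W0.
- by move=> g h /esym; apply: cycle_type_conj.
- exact: specht_rep.
- exact: specht_neq0.
- exact: equivariant_specht_orth.
by exists (cycle_type g) => //; exists f.
Qed.

End SpechtModules.

(** * Parity and Clifford actions *)

Section SuperSpaces.

Variable C : numClosedFieldType.
Implicit Types M N : superVectType C.

Lemma invol_part M p v : v \in (part p : {vspace M}) -> invol M true v = (-1) ^+ p *: v.
Proof. exact: involE. Qed.

Lemma invol_proj M v : invol M true v = part_proj M false v - part_proj M true v.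
Proof. by rewrite add_lfunE opp_lfunE. Qed.

Lemma invol_homogE M N p (f : 'Hom(M, N)) v : map_homog p f ->
  f (invol M true v) = (-1) ^+ p *: invol N true (f v).
Proof.
move=> /map_homogP fp; rewrite -[v]part_projD !linearD /=.
have E q w : w \in (part q : {vspace M}) ->
    f (invol M true w) = (-1) ^+ p *: invol N true (f w).
  move=> wq; rewrite (invol_part wq) (invol_part (fp _ _ wq)) linearZ scalerA.
  by rewrite -signr_addb addbCA addbb addbF.
by rewrite !(E _ _ (part_projP _ _)).
Qed.

Lemma involK M v : invol M true (invol M true v) = v.
Proof.
rewrite -[in RHS](part_projD v) [invol M true v]invol_proj linearB /=.
rewrite (invol_part (part_projP false v)) (invol_part (part_projP true v)).
by rewrite expr0 expr1 scale1r scaleN1r opprK.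
Qed.

Lemma part_proj_invol M p v : part_proj M p v = 2^-1 *: (v + (-1) ^+ p *: invol M true v).
Proof.
apply: (canRL (scalerK _)); first by rewrite pnatr_eq0.
rewrite invol_proj -{2}[v]part_projD scaler_nat mulr2n.
case: p; rewrite /= ?expr0 ?expr1 ?scale1r ?scaleN1r.
  by rewrite opprB [RHS]addrC addrA subrK.
by rewrite addrACA subrr addr0.
Qed.

Lemma mem_part_invol M (p : bool) v : invol M true v = (-1) ^+ p *: v -> v \in (part p : {vspace M}).
Proof.
move=> vE; suff <- : part_proj M p v = v by apply: part_projP.
rewrite part_proj_invol vE scalerA -signr_addb addbb scale1r -mulr2n -scaler_nat scalerA.
by rewrite mulVf ?scale1r // pnatr_eq0.
Qed.

Lemma map_homog_invol M N (p : bool) (f : 'Hom(M, N)) :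
  (forall v, f (invol M true v) = (-1) ^+ p *: invol N true (f v)) -> map_homog p f.
Proof.
move=> fE; apply/map_homogP=> q v vq; apply: mem_part_invol.
have := fE v; rewrite (invol_part vq) linearZ /= => e.
by rewrite signr_addb mulrC -scalerA e scalerA -signr_addb addbb scale1r.
Qed.

Section HomogeneousParts.

Variables (M N : superVectType C) (f : 'Hom(M, N)).

Definition hom_part (p : bool) : 'Hom(M, N) :=
  2^-1 *: (f + (-1) ^+ p *: (invol N true \o f \o invol M true)%VF).

Lemma hom_partE p v : hom_part p v = 2^-1 *: (f v + (-1) ^+ p *: invol N true (f (invol M true v))).
Proof. by rewrite scale_lfunE add_lfunE scale_lfunE !comp_lfunE. Qed.

Lemma hom_part_homog p : map_homog p (hom_part p).
Proof.
apply: map_homog_invol => v; rewrite !hom_partE involK.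
have lin k (x y : N) : invol N true (k *: (x + (-1) ^+ p *: y)) =
    k *: (invol N true x + (-1) ^+ p *: invol N true y) by rewrite linearZ /= linearD linearZ.
rewrite lin involK scalerA mulrC -scalerA; congr (_ *: _).
by rewrite scalerDr scalerA -signr_addb addbb scale1r addrC.
Qed.

Lemma hom_partD : hom_part false + hom_part true = f.
Proof.
apply/lfunP=> v; rewrite add_lfunE !hom_partE -scalerDr expr0 expr1 scale1r scaleN1r.
rewrite addrACA subrr addr0 -mulr2n -scaler_nat scalerA.
by rewrite mulVf ?scale1r // pnatr_eq0.
Qed.

End HomogeneousParts.

Section CliffordActions.

Variable n : nat.

Record clifford_action M (c : 'I_n -> 'End(M)) : Prop := CliffordAction {
  clifford_odd : forall i, map_homog true (c i);
  clifford_sq : forall i v, c i (c i v) = v;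
  clifford_anti : forall i j v, i != j -> c i (c j v) = - c j (c i v)
}.

(** Composition with the parity involution removes the signs from the definition of
    a homomorphism: a homogeneous map supercommutes with [c i], whatever its parity,
    exactly when it commutes with [twist c i] (see [super_intertwiners_homog]). *)
Definition twist M (c : 'I_n -> 'End(M)) i : 'End(M) := (c i \o invol M true)%VF.

Lemma clifford_invol M (c : 'I_n -> 'End(M)) i v : clifford_action c ->
  c i (invol M true v) = - invol M true (c i v).
Proof. by move=> cc; rewrite (invol_homogE _ (clifford_odd cc i)) expr1 scaleN1r. Qed.

Lemma twist_sq M (c : 'I_n -> 'End(M)) i v : clifford_action c -> twist c i (twist c i v) = - v.
Proof.
move=> cc; rewrite !comp_lfunE (clifford_invol i v cc) !linearN /= involK.
by rewrite clifford_sq.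
Qed.

Lemma twist_anti M (c : 'I_n -> 'End(M)) i j v : clifford_action c -> i != j ->
  twist c i (twist c j v) = - twist c j (twist c i v).
Proof.
move=> cc ij; rewrite !comp_lfunE !(clifford_invol _ v cc) !linearN /= !involK.
by rewrite (clifford_anti cc) // opprK.
Qed.

Variables (M N : superVectType C) (c : 'I_n -> 'End(M)) (d : 'I_n -> 'End(N)).
Hypotheses (cc : clifford_action c) (dd : clifford_action d).

Definition super_intertwiners (S : {vspace 'Hom(M, N)}) : {vspace 'Hom(M, N)} :=
  (S :&: \bigcap_i intertwiners (twist c i) (twist d i))%VS.

Lemma super_intertwinersP (S : {vspace 'Hom(M, N)}) (f : 'Hom(M, N)) :
  reflect (f \in S /\ forall i v, d i (invol N true (f v)) = f (c i (invol M true v)))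
    (f \in super_intertwiners S).
Proof.
rewrite memv_cap; apply: (iffP andP) => -[fS fI]; split=> //.
  move=> i v; have /subv_bigcapP/(_ i isT) := fI.
  by rewrite -memvE => /intertwinersP/(_ v); rewrite !comp_lfunE.
rewrite memvE; apply/subv_bigcapP=> i _; rewrite -memvE.
by apply/intertwinersP=> v; rewrite !comp_lfunE.
Qed.

Lemma super_intertwiners_homog p (f : 'Hom(M, N)) : map_homog p f ->
  (forall i v, d i (invol N true (f v)) = f (c i (invol M true v))) <->
  (forall i v, f (c i v) = (-1) ^+ p *: d i (f v)).
Proof.
move=> fp; have fP v : invol N true (f v) = (-1) ^+ p *: f (invol M true v).
  by rewrite (invol_homogE _ fp) scalerA -signr_addb addbb scale1r.
split=> fI i v; last by rewrite fI fP linearZ.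
by rewrite -[v in LHS]involK -fI fP involK linearZ.
Qed.

Lemma hom_part_super_intertwiners (S : {vspace 'Hom(M, N)}) p (f : 'Hom(M, N)) :
  (forall h, h \in S -> sandwich (invol N true) (invol M true) h \in S) ->
  f \in super_intertwiners S -> hom_part f p \in super_intertwiners S.
Proof.
move=> SP /super_intertwinersP[fS fI]; apply/super_intertwinersP; split.
  by apply/memvZ/memvD => //; apply/memvZ/SP.
move=> i v; rewrite !hom_partE -fI.
have -> : invol N true (f (invol M true (c i (invol M true v)))) =
    d i (invol N true (invol N true (f (invol M true v)))).
  rewrite (clifford_invol i v cc) linearN /= involK linearN linearN /=.
  by rewrite -{1}[v]involK -fI -(clifford_invol _ _ dd).
by rewrite !linearZ /= !linearD !linearZ.
Qed.

(** [c j] commutes with [twist c i] for [j != i] and anticommutes with [twist c j],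
    so it provides the changes of sign of [dim_intertwiners_family]. *)
Lemma dim_super_intertwiners (S : {vspace 'Hom(M, N)}) :
  (forall i h, h \in S -> sandwich (twist d i) (twist c i) h \in S) ->
  (forall i h, h \in S -> sandwich \1%VF (c i) h \in S) ->
  \dim S = (2 ^ n * \dim (super_intertwiners S))%N.
Proof.
move=> Stw Sc; rewrite -[in RHS](card_ord n) cardE /super_intertwiners -big_enum /=.
apply: (dim_intertwiners_family (k := c)) => //; last exact: enum_uniq.
- by move=> i v; apply: twist_sq.
- by move=> i v; apply: twist_sq.
- by move=> i v; apply: clifford_sq.
- by move=> i v; rewrite !comp_lfunE (clifford_invol i (c i v) cc) !(clifford_sq cc).
- by move=> i j v; apply: twist_anti.
- by move=> i j v; apply: twist_anti.
- move=> i j v ij; rewrite !comp_lfunE (clifford_invol i _ cc) (clifford_invol i v cc) linearN /=.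
  by rewrite (clifford_invol j _ cc) opprK (clifford_anti cc _ ij) linearN opprK.
- by move=> i h _; apply: Stw.
- by move=> i h _; apply: Sc.
Qed.

End CliffordActions.

End SuperSpaces.

(** * Supermodules and Schur's lemma *)

Section Modules.

Variable C : numClosedFieldType.

Lemma gradedP (A : superAlgType C) (M : supermodule A) (S : {vspace M}) :
  graded S <-> (forall v, v \in S -> invol M true v \in S).
Proof.
rewrite /graded; split=> [-> v /memv_addP[v0 v0S [v1 v1S ->]]|SP].
  move: v0S v1S; rewrite !memv_cap => /andP[S0 p0] /andP[S1 p1].
  rewrite linearD /= (invol_part p0) (invol_part p1) expr0 expr1.
  by apply: memv_add; apply: memvZ; rewrite memv_cap ?S0 ?S1.
apply/eqP; rewrite eqEsubv subv_add !capvSl !andbT; apply/subvP=> v vS.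
have pS p : part_proj M p v \in (S :&: part p)%VS.
  by rewrite memv_cap part_projP andbT part_proj_invol memvZ // memvD ?memvZ // SP.
by rewrite -[v]part_projD memv_add.
Qed.

Lemma smod_actM (A : superAlgType C) (M : supermodule A) a b (v : M) :
  smod_act (a * b) v = smod_act a (smod_act b v).
Proof. by rewrite /smod_act superhomM comp_lfunE. Qed.

Lemma smod_actD (A : superAlgType C) (M : supermodule A) a b (v : M) :
  smod_act (a + b) v = smod_act a v + smod_act b v.
Proof. by rewrite /smod_act superhomD add_lfunE. Qed.

Lemma smod_act_scal (A : superAlgType C) (M : supermodule A) k (v : M) :
  smod_act (scal k : A) v = k *: v.
Proof. by rewrite /smod_act superhom_scal scale_lfunE id_lfunE. Qed.

Lemma smod_act1 (A : superAlgType C) (M : supermodule A) (v : M) : smod_act (1 : A) v = v.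
Proof. by rewrite /smod_act superhom1 id_lfunE. Qed.

Lemma smod_actN (A : superAlgType C) (M : supermodule A) (a : A) (v : M) :
  smod_act (- a) v = - smod_act a v.
Proof. by rewrite /smod_act superhomN opp_lfunE. Qed.

Section PresentedModules.

Variable P : presentation C.
Implicit Types M N : supermodule (presented P).

Lemma presented_submodule M (S : {vspace M}) :
  (forall i v, v \in S -> smod_act (gen i) v \in S) -> forall a v, v \in S -> smod_act a v \in S.
Proof.
move=> Sgen; elim/cls_ind; elim=> [i|k|s IHs t IHt|s IHs t IHt] v vS.
- exact: Sgen.
- by rewrite -scalE smod_act_scal memvZ.
- by rewrite cls_add smod_actD memvD ?IHs ?IHt.
- by rewrite cls_mul smod_actM IHs ?IHt.
Qed.

Lemma presented_module_hom M N p (f : 'Hom(M, N)) : map_homog p f ->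
  (forall i v, f (smod_act (gen i) v) = (-1) ^+ (p && gen_parity i) *: smod_act (gen i) (f v)) ->
  module_hom p f.
Proof.
move=> fp fgen; split=> // q a v [t qt ->].
elim: qt v => {q a t} [i|k|q|q s t _ IHs _ IHt|q r s t _ IHs _ IHt] v.
- exact: fgen.
- by rewrite -scalE !smod_act_scal linearZ andbF expr0 scale1r.
- by rewrite -scalE !smod_act_scal !scale0r linear0 scaler0.
- by rewrite cls_add !smod_actD linearD /= IHs IHt scalerDr.
rewrite cls_mul !smod_actM IHs IHt {1}/smod_act linearZ /= scalerA -signr_addb.
by rewrite andb_addr addbC.
Qed.

End PresentedModules.

Section Schur.

Import VectorInternalTheory.

Variable A : superAlgType C.
Implicit Types M N : supermodule A.

Lemma module_hom_comp (M N L : supermodule A) p q (f : 'Hom(M, N)) (g : 'Hom(N, L)) :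
  module_hom p f -> module_hom q g -> module_hom (p (+) q) (g \o f)%VF.
Proof.
move=> [/map_homogP fp fa] [/map_homogP gq ga]; split.
  by apply/map_homogP=> r v vr; rewrite comp_lfunE addbA gq // fp.
move=> r a v ar; rewrite !comp_lfunE (fa _ _ _ ar) linearZ /= (ga _ _ _ ar) scalerA.
by rewrite -signr_addb andb_addl.
Qed.

Lemma module_homB M N p (f g : 'Hom(M, N)) k : module_hom p f -> module_hom p g ->
  module_hom p (f - k *: g)%R.
Proof.
move=> [/map_homogP fp fa] [/map_homogP gp ga]; split.
  apply/map_homogP=> q v vq; rewrite add_lfunE opp_lfunE scale_lfunE.
  by rewrite memvB ?fp // memvZ ?gp.
move=> q a v aq; rewrite !add_lfunE !opp_lfunE !scale_lfunE (fa _ _ _ aq) (ga _ _ _ aq).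
rewrite /smod_act linearB /= scalerBr; congr (_ - _).
by rewrite [in RHS]linearZ /= !scalerA mulrC.
Qed.

Lemma module_hom_id M : module_hom false (\1%VF : 'End(M)).
Proof.
split; first exact: (invol_homog M false).
by move=> q a v _; rewrite !id_lfunE expr0 scale1r.
Qed.

Lemma homog_act_ind (S : A -> Prop) : (forall p a, homog p a -> S a) ->
  (forall a b, S a -> S b -> S (a + b)) -> forall a, S a.
Proof. by move=> Sh SD a; have [a0 [a1 [h0 h1 ->]]] := homog_split a; apply: SD; apply: Sh; eauto. Qed.

Lemma lker_submodule M N p (f : 'Hom(M, N)) : module_hom p f -> graded_submodule (lker f).
Proof.
move=> [fp fa]; split.
  apply/gradedP=> v; rewrite !memv_ker => /eqP fv; rewrite (invol_homogE _ fp) fv.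
  by rewrite linear0 scaler0.
move=> a v; rewrite !memv_ker => /eqP fv; apply/eqP; move: a.
apply: homog_act_ind => [q a aq|a b fav fbv].
  by rewrite (fa _ _ _ aq) fv /smod_act linear0 scaler0.
by rewrite smod_actD linearD /= fav fbv addr0.
Qed.

Lemma limg_submodule M N p (f : 'Hom(M, N)) : module_hom p f -> graded_submodule (limg f).
Proof.
move=> [fp fa]; split.
  apply/gradedP=> _ /memv_imgP[v _ ->].
  have -> : invol N true (f v) = (-1) ^+ p *: f (invol M true v).
    by rewrite (invol_homogE _ fp) scalerA -signr_addb addbb scale1r.
  by rewrite -linearZ memv_img ?memvf.
move=> a _ /memv_imgP[v _ ->]; move: a; apply: homog_act_ind => [q a aq|a b aS bS].
  have -> : smod_act a (f v) = (-1) ^+ (p && q) *: f (smod_act a v).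
    by rewrite (fa _ _ _ aq) scalerA -signr_addb addbb scale1r.
  by rewrite -linearZ memv_img ?memvf.
by rewrite smod_actD memvD.
Qed.

Lemma simple_lker0 M N p (f : 'Hom(M, N)) : smod_simple M -> module_hom p f -> f != 0 ->
  lker f = 0%VS.
Proof.
move=> [_ simM] fh f0; case: (simM _ (lker_submodule fh)) => // kf.
by case/eqP: f0; apply/lfunP=> v; apply/eqP; rewrite zero_lfunE -memv_ker kf memvf.
Qed.

Lemma simple_limg_full M N p (f : 'Hom(M, N)) : smod_simple N -> module_hom p f -> f != 0 ->
  limg f = fullv.
Proof.
move=> [_ simN] fh f0; case: (simN _ (limg_submodule fh)) => // imf.
by case/eqP: f0; apply/lfunP=> v; apply/eqP; rewrite zero_lfunE -memv0 -imf memv_img ?memvf.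
Qed.

Lemma exists_eigenvalue (V : vectType C) (f : 'End(V)) : (fullv != 0 :> {vspace V})%VS ->
  exists k, lker (f - k *: \1%VF)%R != 0%VS.
Proof.
move=> V0; have dimV : (0 < dim V)%N.
  by rewrite -dimvf lt0n dimv_eq0.
have [k] : exists k, root (char_poly (f2mx f)) k.
  apply: (elimT (closed_rootP _)); rewrite size_char_poly.
  by move: dimV; case: (dim V).
rewrite -eigenvalue_root_char => /eigenvalueP[v vf v0]; exists k.
apply: contraNneq v0 => ker0; rewrite -[v]r2vK.
have : r2v v \in lker (f - k *: \1%VF)%R.
  rewrite memv_ker add_lfunE opp_lfunE scale_lfunE id_lfunE subr_eq0.
  by rewrite -(inj_eq (can_inj (@v2rK _ V))) f2mxE linearZ /= r2vK vf.
by rewrite ker0 memv0 => /eqP ->; rewrite linear0.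
Qed.

(** The kernel of [f - k], for an eigenvalue [k], is a nonzero graded submodule. *)
Lemma simple_even_scalar M (f : 'End(M)) : smod_simple M -> module_hom false f ->
  exists k, f = k *: \1%VF.
Proof.
move=> simM fh; have [k kerk] := exists_eigenvalue f (proj1 simM).
exists k; apply/eqP; rewrite -subr_eq0; apply: contraNT kerk => ne.
by apply/eqP; apply: (simple_lker0 simM (module_homB k fh (module_hom_id M)) ne).
Qed.

(** Even endomorphisms are scalar. If [f] is a nonzero odd one, it is injective, and
    for any odd [g] both [f \o f] and [f \o g] are even, hence scalar; so [g] is a
    multiple of [f]. *)
Lemma simple_End_dim M (H : {vspace 'End(M)}) : smod_simple M -> is_Hom_space H ->
  (0 < \dim H <= 2)%N.
Proof.
move=> simM [Hhom Hmin]; apply/andP; split.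
  rewrite lt0n dimv_eq0; apply: contraNneq (proj1 simM) => H0.
  have := Hhom _ _ (module_hom_id M); rewrite H0 memv0 => /eqP/lfunP e.
  by apply/eqP/vspaceP=> v; rewrite memvf memv0; have := e v; rewrite id_lfunE zero_lfunE => ->; rewrite eqxx.
have [f [fh Hf]] : exists f : 'End(M), module_hom true f /\
    forall g : 'End(M), module_hom true g -> g \in <[f]>%VS.
  have [[f fh f0]|none] := pselect (exists2 f : 'End(M), module_hom true f & f != 0); last first.
    exists 0; split=> [|g gh].
      split=> [|q a v _]; last by rewrite !zero_lfunE /smod_act linear0 scaler0.
      by apply/map_homogP=> q v _; rewrite zero_lfunE mem0v.
    suff -> : g = 0 by apply: mem0v.
    by apply/eqP; apply: contrapT => /negP g0; apply: none; exists g.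
  exists f; split=> // g gh.
  have inj := simple_lker0 simM fh f0; move/eqP/lker0P: inj => inj.
  have [k fk] := simple_even_scalar simM (module_hom_comp fh fh).
  have [l gl] := simple_even_scalar simM (module_hom_comp gh fh).
  have ffE v : f (f v) = k *: v by rewrite -comp_lfunE fk scale_lfunE id_lfunE.
  have fgE v : f (g v) = l *: v by rewrite -comp_lfunE gl scale_lfunE id_lfunE.
  have k0 : k != 0.
    apply: contra_neq f0 => k0; apply/lfunP=> v; apply: inj.
    by rewrite ffE k0 scale0r zero_lfunE linear0.
  apply/vlineP; exists (l / k); apply/lfunP=> v; apply: inj.
  by rewrite fgE scale_lfunE linearZ /= ffE scalerA divfK.
apply: leq_trans (dimvS (Hmin (<[\1%VF]> + <[f]>)%VS _)) _; last first.
  by rewrite (leq_trans (dimv_add_leqif _ _)) // !dim_vline; case: (_ != 0) (_ != 0) => [] [].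
move=> [] g gh; first by apply: (subvP (addvSr _ _)); apply: Hf.
have [k ->] := simple_even_scalar simM gh.
by apply: (subvP (addvSl _ _)); apply/memvZ/memv_line.
Qed.

End Schur.

(** * Spaces of homomorphisms *)

Section HomSpaces.

Variables (A : superAlgType C) (n : nat) (M N : supermodule A).
Variables (c : 'I_n -> 'End(M)) (d : 'I_n -> 'End(N)).
Hypotheses (cc : clifford_action c) (dd : clifford_action d).

(** The super intertwiners are stable under conjugation by the parity involutions,
    hence spanned by homogeneous ones, and these are the homomorphisms. *)
Lemma super_intertwiners_Hom_space (S : {vspace 'Hom(M, N)}) :
    (forall h, h \in S -> sandwich (invol N true) (invol M true) h \in S) ->
    (forall p (f : 'Hom(M, N)), map_homog p f -> module_hom p f <->
      f \in S /\ forall i v, f (c i v) = (-1) ^+ p *: d i (f v)) ->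
  is_Hom_space (super_intertwiners c d S).
Proof.
move=> SP homP; split=> [p f fh|K Khom].
  have fp := proj1 fh; have [fS fcd] := proj1 (homP p f fp) fh.
  by apply/super_intertwinersP; split=> //; apply/(super_intertwiners_homog c d fp).
apply/subvP=> f fI; rewrite -(hom_partD f).
have partK p : hom_part f p \in K.
  have fp := hom_part_homog f p; apply: (Khom p); apply/(homP p _ fp).
  have /super_intertwinersP[fS fcd] := hom_part_super_intertwiners cc dd p SP fI.
  by split=> //; apply/(super_intertwiners_homog c d fp).
by rewrite memvD.
Qed.

End HomSpaces.

Section CliffordModules.

Variables (n : nat) (U : supermodule (Cl C n)).

Definition clifford_op (i : 'I_n) : 'End(U) := smod_hom U (cgen i).

Lemma clifford_op_action : clifford_action clifford_op.
Proof.
split=> [i|i v|i j v ij].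
- exact: (superhom_homog (smod_hom U) (gen_homog (i : generator (clif_pres C n)))).
- have := relationE (P := clif_pres C n) (clif_sq C i).
  rewrite !cls_mul mulr1 -scalE -![cls (Gen _)]/(cgen _) => e.
  by rewrite -/(smod_act _ _) -/(smod_act _ _) -smod_actM e smod_act_scal scale1r.
have := relationE (P := clif_pres C n) (clif_anti C ij).
rewrite !cls_mul -scalE -![cls (Gen _)]/(cgen _) => e.
rewrite -[LHS]/(smod_act (cgen i) (smod_act (cgen j) v)) -smod_actM e !smod_actM.
by rewrite smod_act_scal scaleN1r.
Qed.

Lemma clifford_submodule (S : {vspace U}) : (forall v, v \in S -> invol U true v \in S) ->
  (forall i v, v \in S -> clifford_op i v \in S) -> graded_submodule S.
Proof.
move=> SP Sc; split; first by apply/gradedP.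
by apply: presented_submodule => i v; apply: Sc.
Qed.

Lemma clifford_module_homP p (f : 'End(U)) : map_homog p f -> module_hom p f <->
  f \in (fullv : {vspace 'End(U)}) /\
  forall i v, f (clifford_op i v) = (-1) ^+ p *: clifford_op i (f v).
Proof.
move=> fp; split=> [[_ fa]|[_ fc]].
  split=> [|i v]; first exact: memvf.
  by have := fa true (cgen i) v (gen_homog (i : generator (clif_pres C n))); rewrite andbT.
by apply: presented_module_hom => // i v; rewrite andbT; apply: fc.
Qed.

Definition clifford_End := super_intertwiners clifford_op clifford_op (fullv : {vspace 'End(U)}).

Lemma clifford_End_Hom_space : is_Hom_space clifford_End.
Proof.
apply: (super_intertwiners_Hom_space clifford_op_action clifford_op_action) => [h _|].
  exact: memvf.
exact: clifford_module_homP.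
Qed.

Lemma dim_Hom (V W : vectType C) : \dim (fullv : {vspace 'Hom(V, W)}) =
  (\dim (fullv : {vspace V}) * \dim (fullv : {vspace W}))%N.
Proof. by rewrite !dimvf. Qed.

(** Counting gives the equation, and the dimension of the endomorphisms is 1 or 2 by
    Schur's lemma; the exponent of 2 in a square being even, the parity of [n]
    decides. *)
Lemma dim_clifford_module : smod_simple U ->
  (\dim (fullv : {vspace U}) ^ 2 = 2 ^ n * \dim clifford_End)%N /\
  \dim clifford_End = (if odd n then 2 else 1)%N.
Proof.
move=> simU; have cc := clifford_op_action.
have dimE : (\dim (fullv : {vspace U}) ^ 2 = 2 ^ n * \dim clifford_End)%N.
  rewrite expnS expn1 -dim_Hom; apply: dim_super_intertwiners => // i h _; exact: memvf.
split=> //; have /andP[e_gt0 e_le2] := simple_End_dim simU clifford_End_Hom_space.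
have d_gt0 : (0 < \dim (fullv : {vspace U}))%N by rewrite lt0n dimv_eq0 (proj1 simU).
have /(congr1 odd) := congr1 (logn 2) dimE.
rewrite lognX lognM ?expn_gt0 // pfactorK // oddM /= oddD.
have [->|->] : \dim clifford_End = 1%N \/ \dim clifford_End = 2%N by lia.
  by rewrite logn1 /=; case: odd.
by rewrite (logn_prime 2) //=; case: odd.
Qed.

End CliffordModules.

Section BnModules.

Variable n : nat.
Implicit Types M N : supermodule (CB C n).

Definition clif_op M (i : 'I_n) : 'End(M) := smod_hom M (cB C i).
Definition perm_op M (g : 'S_n) : 'End(M) := smod_hom M (sB C g).

Lemma clif_op_action M : clifford_action (clif_op M).
Proof.
have actE i v : clif_op M i v = smod_act (cB C i) v by [].
split=> [i|i v|i j v ij]; rewrite ?actE.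
- exact: (superhom_homog (smod_hom M) (cB_homog C i)).
- by rewrite -smod_actM cB_sq smod_act1.
by rewrite -!smod_actM cB_anti // smod_actN.
Qed.

Lemma perm_op_rep M : is_rep (perm_op M).
Proof.
split=> [|g h]; rewrite /perm_op; first by rewrite sB1 superhom1.
by rewrite -sBM superhomM.
Qed.

Lemma perm_op_invol M g v : perm_op M g (invol M true v) = invol M true (perm_op M g v).
Proof.
have sg : map_homog false (perm_op M g) := superhom_homog (smod_hom M) (sB_homog C g).
by rewrite (invol_homogE _ sg) scale1r.
Qed.

Lemma perm_clif_op M g i v : perm_op M g (clif_op M i v) = clif_op M i (perm_op M g v).
Proof. by rewrite -[LHS]smod_actM sB_cB smod_actM. Qed.

Definition equivariants M N : {vspace 'Hom(M, N)} :=
  (\bigcap_g intertwiners (perm_op M g) (perm_op N g))%VS.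

Lemma equivariantsP M N (f : 'Hom(M, N)) :
  reflect (equivariant (perm_op M) (perm_op N) f) (f \in equivariants M N).
Proof.
rewrite memvE; apply: (iffP subv_bigcapP) => fE g; last first.
  by move=> _; rewrite -memvE; apply/intertwinersP/fE.
by have := fE g isT; rewrite -memvE => /intertwinersP.
Qed.

Lemma tgen_act M (i : 'I_n) v : smod_act (tgen i) v =
  if insub i.+1 is Some j then
    (sqrtC 2)^-1 *: (clif_op M i (perm_op M (tperm i j) v) - clif_op M j (perm_op M (tperm i j) v))
  else clif_op M i v.
Proof.
rewrite tgenE; case: insub => [j|] //.
by rewrite smod_actM smod_act_scal smod_actM /smod_act superhomD superhomN add_lfunE opp_lfunE.
Qed.

Lemma Bn_module_homP M N p (f : 'Hom(M, N)) : map_homog p f -> module_hom p f <->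
  f \in equivariants M N /\ forall i v, f (clif_op M i v) = (-1) ^+ p *: clif_op N i (f v).
Proof.
move=> fp; split=> [[_ fa]|[/equivariantsP fE fc]].
  split=> [|i v]; last by have := fa _ _ v (cB_homog C i); rewrite andbT.
  by apply/equivariantsP=> g v; have := fa _ _ v (sB_homog C g); rewrite andbF scale1r.
apply: presented_module_hom => // i v; rewrite andbT !tgen_act.
case: insub => [j|]; last exact: fc.
by rewrite linearZ linearB /= !fc -!fE -scalerBr !scalerA mulrC.
Qed.

Definition Bn_Hom M N := super_intertwiners (clif_op M) (clif_op N) (equivariants M N).

Lemma equivariants_sandwich M N (a : 'End(M)) (b : 'End(N)) (h : 'Hom(M, N)) :
  (forall g v, perm_op M g (a v) = a (perm_op M g v)) ->
  (forall g v, perm_op N g (b v) = b (perm_op N g v)) ->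
  h \in equivariants M N -> sandwich b a h \in equivariants M N.
Proof.
move=> aP bP /equivariantsP hE; apply/equivariantsP=> g v.
by rewrite !comp_lfunE bP hE aP.
Qed.

Lemma Bn_Hom_space M N : is_Hom_space (Bn_Hom M N).
Proof.
apply: (super_intertwiners_Hom_space (@clif_op_action M) (@clif_op_action N)) => [h|].
  by apply: equivariants_sandwich => g v; apply: perm_op_invol.
exact: Bn_module_homP.
Qed.

(** Forgetting the Clifford operators multiplies the dimension of the space of
    homomorphisms by a constant, whatever the two modules. *)
Lemma dim_equivariants M N : \dim (equivariants M N) = (2 ^ n * \dim (Bn_Hom M N))%N.
Proof.
have tw L g i v : perm_op L g (twist (clif_op L) i v) = twist (clif_op L) i (perm_op L g v).
  by rewrite !comp_lfunE perm_clif_op perm_op_invol.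
apply: dim_super_intertwiners => [||i h|i h]; try exact: clif_op_action.
  by apply: equivariants_sandwich => g v; apply: tw.
apply: equivariants_sandwich => g v; last by rewrite !id_lfunE.
exact: perm_clif_op.
Qed.

End BnModules.

End Modules.

(** * Endomorphisms of a tensor product *)

Section TensorCommutant.

Import VectorInternalTheory.

Variables (C : numClosedFieldType) (U W : vectType C).
Implicit Types (u : U) (w : W) (x : tensv U W) (j : 'I_(dim U)).

(** The pairing of the first factor with the j-th coordinate form on [U]. *)
Definition contract_fun j x : W := r2v (row j (x : 'M_(dim U, dim W))).
Fact contract_fun_linear j : linear (contract_fun j).
Proof. by move=> k x y; rewrite /contract_fun !linearP. Qed.
HB.instance Definition _ j := GRing.isLinear.Build C (tensv U W) W _
  (contract_fun j) (contract_fun_linear j).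

Definition insert_fun u w : tensv U W := ptens u w.
Fact insert_fun_linear u : linear (insert_fun u).
Proof. by move=> k w w'; rewrite /insert_fun ptensDr ptensZr. Qed.
HB.instance Definition _ u := GRing.isLinear.Build C W (tensv U W) _
  (insert_fun u) (insert_fun_linear u).

Definition contract j : 'Hom(tensv U W, W) := linfun (contract_fun j).
Definition insert u : 'Hom(W, tensv U W) := linfun (insert_fun u).

Lemma insertE u w : insert u w = ptens u w. Proof. by rewrite lfunE. Qed.

Lemma contract_ptens j u w : contract j (ptens u w) = v2r u 0 j *: w.
Proof.
rewrite lfunE /= /contract_fun /ptens row_mul -[w in RHS]v2rK -linearZ; congr r2v.
apply/rowP=> k; rewrite !mxE big_ord1 !mxE.
by congr (_ * _).
Qed.

Lemma contract_sum x : x = \sum_j ptens (r2v (delta_mx 0 j)) (contract j x).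
Proof.
have entry j a b : ptens (r2v (delta_mx 0 j)) (contract j x) a b = (a == j)%:R * (x : 'M_(_, _)) j b.
  by rewrite /ptens r2vK lfunE /= /contract_fun r2vK !mxE big_ord1 !mxE eqxx.
apply/matrixP=> a b; rewrite summxE (bigD1 a) //= big1 ?addr0 => [|j ja].
  by rewrite entry eqxx mul1r.
by rewrite entry eq_sym (negbTE ja) mul0r.
Qed.

Lemma contract_tensf j (g : 'End(W)) x : contract j (tensf \1%VF g x) = g (contract j x).
Proof.
have /lfunP/(_ x) : (contract j \o tensf \1%VF g = g \o contract j)%VF.
  by apply: ptens_ext => u w; rewrite !comp_lfunE tensfE id_lfunE !contract_ptens linearZ.
by rewrite !comp_lfunE.
Qed.

Lemma exists_neq0 (V : vectType C) : (fullv != 0 :> {vspace V})%VS -> exists v : V, v != 0.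
Proof. by move=> V0; exists (vpick (fullv : {vspace V})); rewrite vpick0. Qed.

Lemma contract_neq0 x : x != 0 -> exists j, contract j x != 0.
Proof.
move=> x0; apply/existsP; apply: contraNT x0 => /existsPn no.
rewrite [x]contract_sum big1 // => j _; have := no j; rewrite negbK => /eqP ->.
by rewrite -insertE linear0.
Qed.

Lemma v2r_neq0 u : u != 0 -> exists j, v2r u 0 j != 0.
Proof.
move=> u0; apply/existsP; apply: contraNT u0 => /existsPn no.
rewrite -[u]v2rK (_ : v2r u = 0) ?linear0 //; apply/rowP=> j; rewrite mxE; apply/eqP.
by have := no j; rewrite negbK.
Qed.

Lemma ptens_neq0 u w : u != 0 -> w != 0 -> ptens u w != 0.
Proof.
move=> /v2r_neq0[j uj] w0; apply: contra_neq w0 => e.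
have := contract_ptens j u w; rewrite e linear0 => /esym/eqP.
by rewrite scaler_eq0 (negbTE uj) => /eqP.
Qed.

Lemma tensf1_inj (P Q : 'End(U)) : (fullv != 0 :> {vspace W})%VS ->
  tensf P (\1%VF : 'End(W)) = tensf Q \1%VF -> P = Q.
Proof.
move=> W0 /lfunP e; apply/lfunP=> u; apply/eqP; rewrite -subr_eq0.
apply: contraNT W0 => ne; apply/eqP/vspaceP=> w; rewrite memvf memv0.
apply/esym; apply: contraT => w0; have := ptens_neq0 ne w0.
have := e (ptens u w); rewrite !tensfE id_lfunE => e'.
by rewrite ptensDl -scaleN1r ptensZl scaleN1r e' subrr eqxx.
Qed.

Variables (I : Type) (r : I -> 'End(W)).
Hypothesis schur : forall f : 'End(W), (forall g w, r g (f w) = f (r g w)) -> exists k, f = k *: \1%VF.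

(** The blocks of [h] in a basis of [U] are endomorphisms of [W] that commute with
    [r], hence scalars; these are the entries of [P]. *)
Lemma tensor_commutant (h : 'End(tensv U W)) :
  (forall g x, tensf \1%VF (r g) (h x) = h (tensf \1%VF (r g) x)) ->
  exists P : 'End(U), h = tensf P \1%VF.
Proof.
move=> hE.
pose b i : U := r2v (delta_mx 0 i).
have k_ex i : exists k : 'rV[C]_(dim U), forall j w, contract j (h (ptens (b i) w)) = k 0 j *: w.
  have kij j : exists k : C, forall w, contract j (h (ptens (b i) w)) = k *: w.
    have [g w|k e] := schur (f := (contract j \o h \o insert (b i))%VF).
      rewrite !comp_lfunE -contract_tensf hE !insertE tensfE id_lfunE //.
    exists k => w; have /lfunP/(_ w) := e.
    by rewrite !comp_lfunE insertE scale_lfunE id_lfunE.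
  have [k kE] := choice kij; exists (\row_j k j) => j w; rewrite mxE; exact: kE.
have [K KE] := choice k_ex.
pose P : 'End(U) := Hom (\matrix_i K i).
have PE i : P (b i) = r2v (K i).
  by apply: (can_inj (@v2rK _ U)); rewrite f2mxE !r2vK -rowE rowK.
exists P; apply: ptens_ext => u w; rewrite tensfE id_lfunE.
have uE : u = \sum_i v2r u 0 i *: b i.
  rewrite -[LHS]v2rK [v2r u in LHS]row_sum_delta linear_sum; apply: eq_bigr => i _.
  by rewrite linearZ.
rewrite uE !linear_sum !ptens_suml linear_sum; apply: eq_bigr => i _ /=.
rewrite ptensZl !linearZ ptensZl; congr (_ *: _).
rewrite /= PE [LHS]contract_sum [RHS]contract_sum; apply: eq_bigr => j _; congr ptens.
by rewrite KE contract_ptens r2vK.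
Qed.

End TensorCommutant.

(** * The modules over the hyperoctahedral superalgebra *)

Section BnSimple.

Variables (C : numClosedFieldType) (n : nat) (U : supermodule (Cl C n)).
Hypothesis U_simple : smod_simple U.
Notation B lam := (Bmodule U lam).
Notation S lam := (spechtv C n lam).
Notation rho lam := (@specht_act C n lam : 'S_n -> 'End(spechtv C n lam)).

Lemma perm_op_B lam g : perm_op (B lam) g = tensf \1%VF (rho lam g) :> 'End(tensv U (S lam)).
Proof.
rewrite /perm_op -[LHS]/(smod_hom (boxtimes U (specht_module C n lam)) (phiB C n (sB C g) : tensA _ _)).
rewrite phiB_sB [LHS](plift_gen (boxtimes_homog U _) (@boxtimes_rel _ _ _ U _)) /=.
by congr tensf; apply: (@plift_gen _ _ _ _ (@specht_homog C n lam) (@specht_rel C n lam) g).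
Qed.

Lemma clif_op_B lam i : clif_op (B lam) i = tensf (clifford_op U i) \1%VF :> 'End(tensv U (S lam)).
Proof.
rewrite /clif_op -[LHS]/(smod_hom (boxtimes U (specht_module C n lam)) (phiB C n (cB C i) : tensA _ _)).
by rewrite phiB_cB [LHS](plift_gen (boxtimes_homog U _) (@boxtimes_rel _ _ _ U _)).
Qed.

Lemma invol_ptens (X Y : superVectType C) (u : X) (w : Y) :
  invol (tensv X Y) true (ptens u w) = ptens (invol X true u) (invol Y true w).
Proof.
rewrite -[u]part_projD -[w]part_projD !(ptensDl, ptensDr, linearD) /=.
have E p q u' w' : u' \in (part p : {vspace X}) -> w' \in (part q : {vspace Y}) ->
    invol (tensv X Y) true (ptens u' w') = ptens (invol X true u') (invol Y true w').
  move=> up wq; rewrite (invol_part (ptens_part up wq)) (invol_part up) (invol_part wq).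
  by rewrite ptensZl ptensZr scalerA -signr_addb.
by rewrite !(E _ _ _ _ (part_projP _ _) (part_projP _ _)).
Qed.

Lemma invol_specht lam (w : S lam) : invol (S lam) true w = w.
Proof. by rewrite (@invol_part _ _ false) ?scale1r // memvf. Qed.

Lemma equivariant_insert lam u :
  equivariant (rho lam) (perm_op (B lam)) (insert (S lam) u : 'Hom(S lam, B lam)).
Proof. by move=> g w; rewrite perm_op_B !insertE tensfE id_lfunE. Qed.

Lemma equivariant_contract lam j :
  equivariant (perm_op (B lam)) (rho lam) (contract (S lam) j : 'Hom(B lam, S lam)).
Proof. by move=> g x; rewrite perm_op_B contract_tensf. Qed.

(** As an Sn-module, the tensor product is a sum of copies of the Specht module. *)
Lemma equivariant_block lam mu (f : 'Hom(B lam, B mu)) :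
    equivariant (perm_op (B lam)) (perm_op (B mu)) f -> f != 0 ->
  exists2 h, equivariant (rho lam) (rho mu) h & h != 0.
Proof.
move=> fE f0; have [[u [j h0]]|none] :=
    pselect (exists u j, (contract (S mu) j \o f \o insert (S lam) u)%VF != 0).
  exists (contract (S mu) j \o f \o insert (S lam) u)%VF => // g w.
  rewrite !comp_lfunE; apply: etrans (equivariant_contract j g _) (congr1 _ _).
  exact: etrans (fE g _) (congr1 f (equivariant_insert u g w)).
case/eqP: f0; apply: ptens_ext => u w; rewrite zero_lfunE.
apply/eqP; apply: contrapT => /negP/contract_neq0[j cj]; apply: none; exists u, j.
apply: contra_neq cj => /lfunP/(_ w).
by rewrite !comp_lfunE insertE zero_lfunE.
Qed.

(** Averaging a projection onto a graded submodule [X] over the symmetric group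
    gives a projection onto [X] of the form [P (x) 1]. So [X] is the tensor product of
    the image of [P], a graded submodule of [U], with the Specht module. *)
Lemma B_simple lam : is_partition n lam -> smod_simple (B lam).
Proof.
move=> lamP; have W0 := specht_neq0 C lamP.
have [w0 w0_neq0] := exists_neq0 W0.
have [u0 u0_neq0] := exists_neq0 (proj1 U_simple).
split=> [|X [/gradedP Xinv Xact]].
  apply: contra_neq (ptens_neq0 u0_neq0 w0_neq0) => full0; apply/eqP.
  by rewrite -memv0 -full0 memvf.
have rep := perm_op_rep (B lam).
have permX g x : x \in X -> perm_op (B lam) g x \in X by apply: Xact.
pose p : 'End(B lam) := avg (perm_op (B lam)) (perm_op (B lam)) (projv X).
have pX x : p x \in X.
  rewrite avgE; apply/memvZ/memv_suml => g _; apply: permX; exact: memv_proj.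
have p_id x : x \in X -> p x = x.
  move=> xX; rewrite -[RHS](projv_id xX); apply: avg_id => g.
  by rewrite !projv_id ?permX // repK.
have pE : equivariant (perm_op (B lam)) (perm_op (B lam)) p by apply: avg_equivariant.
have [P pP] : exists P : 'End(U), p = tensf P (\1%VF : 'End(S lam)).
  apply: (tensor_commutant (r := rho lam)) => [f fE|g x]; first exact: specht_schur.
  by rewrite -!perm_op_B pE.
have limgP u : reflect (forall w, ptens u w \in X) (u \in limg P).
  apply: (iffP idP) => [/memv_imgP[v _ ->] w|uX].
    by rewrite -[w]id_lfunE -tensfE -pP.
  suff <- : P u = u by rewrite memv_img ?memvf.
  apply/eqP; rewrite -subr_eq0; apply: contraT => ne; have := ptens_neq0 ne w0_neq0.
  rewrite ptensDl -scaleN1r ptensZl scaleN1r.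
  by rewrite -[X in ptens (P u) X]id_lfunE -tensfE -pP p_id ?uX // subrr eqxx.
have subP : graded_submodule (limg P).
  apply: clifford_submodule => [u /limgP uX|i u /limgP uX]; apply/limgP=> w.
    by rewrite -(invol_specht w) -invol_ptens Xinv.
  by rewrite -[w]id_lfunE -tensfE -clif_op_B Xact.
case: (proj2 U_simple _ subP) => [P0|Pfull].
  left; apply/vspaceP=> x; rewrite memv0; apply/idP/eqP => [/p_id <-|->]; last exact: mem0v.
  have -> : p = 0; last by rewrite zero_lfunE.
  rewrite pP; apply: ptens_ext => u w; rewrite tensfE zero_lfunE.
  have /eqP -> : P u == 0 by rewrite -memv0 -P0 memv_img ?memvf.
  by rewrite -[0 in LHS](scale0r (0 : U)) ptensZl scale0r.
right; apply/vspaceP=> x; rewrite memvf; apply: ptens_span => u w.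
by apply: (elimT (limgP u)); rewrite Pfull memvf.
Qed.

(** Blocks of the isomorphism and of its inverse are nonzero maps between the
    Specht modules in both directions, so that each partition dominates the
    other. *)
Lemma B_isomorphic_inj lam mu : is_partition n lam -> is_partition n mu ->
  isomorphic (B lam) (B mu) -> lam = mu.
Proof.
move=> lamP muP [p [f [fh kf imf]]].
have fE : equivariant (perm_op (B lam)) (perm_op (B mu)) f.
  by apply/equivariantsP; have [] := proj1 (Bn_module_homP (proj1 fh)) fh.
have fK : cancel f (f^-1)%VF by apply: lker0_lfunK; rewrite kf.
have fKV y : f ((f^-1)%VF y) = y by apply: limg_lfunVK; rewrite imf memvf.
have fVE : equivariant (perm_op (B mu)) (perm_op (B lam)) (f^-1)%VF.
  by move=> g y; apply: (canRL fK (etrans (esym (fE g _)) (congr1 _ (fKV y)))).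
have f0 : f != 0.
  apply: contra_neq (proj1 (B_simple lamP)) => f0.
  by rewrite -kf f0; apply/esym/vspaceP=> x; rewrite memvf memv_ker zero_lfunE eqxx.
have fV0 : (f^-1)%VF != 0.
  apply: contra_neq (proj1 (B_simple muP)) => fV0; apply/vspaceP=> y.
  by rewrite memvf memv0 -[y]fKV fV0 zero_lfunE linear0 eqxx.
have [h hE h0] := equivariant_block fE f0; have [k kE k0] := equivariant_block fVE fV0.
apply: (partition_eq lamP muP) => l; apply/anti_leq.
by rewrite (equivariant_specht_dominates muP lamP kE k0) (equivariant_specht_dominates lamP muP hE h0).
Qed.

(** Some Specht module receives a nonzero Sn-map from [M]; the induced Sn-map to the
    tensor product need not commute with the Clifford operators, but by
    [dim_equivariants] its existence forces that of a nonzero homomorphism. *)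
Lemma B_complete (M : supermodule (CB C n)) : smod_simple M ->
  exists2 lam, is_partition n lam & isomorphic M (B lam).
Proof.
move=> simM.
have [lam lamP [f fE f0]] := exists_equivariant_specht (perm_op_rep M) (proj1 simM).
exists lam => //.
have [u0 u0_neq0] := exists_neq0 (proj1 U_simple).
have E0 : (0 < \dim (equivariants M (B lam)))%N.
  rewrite lt0n dimv_eq0; apply: contra_neq f0 => E0.
  have : (insert (S lam) u0 \o f)%VF \in equivariants M (B lam).
    by apply/equivariantsP=> g v; rewrite !comp_lfunE equivariant_insert fE.
  rewrite E0 memv0 => /eqP/lfunP e; apply/lfunP=> v; rewrite zero_lfunE.
  apply/eqP; apply: contraT => fv; have := ptens_neq0 u0_neq0 fv.
  by have := e v; rewrite comp_lfunE insertE zero_lfunE => ->; rewrite eqxx.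
have [[p [h [hh h0]]]|none] := pselect (exists p (h : 'Hom(M, B lam)), module_hom p h /\ h != 0).
  exists p, h; split=> //; first exact: simple_lker0 simM hh h0.
  exact: simple_limg_full (B_simple lamP) hh h0.
move: E0; rewrite dim_equivariants muln_gt0 => /andP[_].
have sub0 : (Bn_Hom M (B lam) <= 0)%VS.
  apply: (proj2 (Bn_Hom_space M (B lam))) => p h hh; rewrite memv0; apply: contrapT => /negP h0; apply: none.
  by exists p, h.
by have := dimvS sub0; rewrite dimv0 leqn0 => /eqP ->.
Qed.

Definition tensf1 lam (P : 'End(U)) : 'End(tensv U (S lam)) := tensf P \1%VF.
Fact tensf1_linear lam : linear (@tensf1 lam).
Proof.
move=> k P Q; apply: ptens_ext => u w.
by rewrite !(add_lfunE, scale_lfunE, tensfE, ptensDl, ptensZl).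
Qed.
HB.instance Definition _ lam := GRing.isLinear.Build C 'End(U) 'End(tensv U (S lam)) _
  (@tensf1 lam) (@tensf1_linear lam).

Lemma dim_equivariants_B lam : is_partition n lam ->
  \dim (equivariants (B lam) (B lam)) = (\dim (fullv : {vspace U}) ^ 2)%N.
Proof.
move=> lamP; have W0 := specht_neq0 C lamP.
pose T : 'Hom('End(U), 'End(B lam)) := linfun (@tensf1 lam).
have TE P : T P = tensf P \1%VF by rewrite lfunE.
have <- : (T @: fullv)%VS = equivariants (B lam) (B lam).
  apply/vspaceP=> f; apply/memv_imgP/equivariantsP => [[P _ ->] g v|fE].
    by rewrite TE perm_op_B -!comp_lfunE !tensf_comp !comp_lfun1l !comp_lfun1r.
  have [P ->] : exists P : 'End(U), f = tensf P (\1%VF : 'End(S lam)).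
    apply: (tensor_commutant (r := rho lam)) => [h hE|g x]; first exact: specht_schur.
    by rewrite -!perm_op_B fE.
  by exists P; rewrite ?memvf.
rewrite limg_dim_eq; first by rewrite dim_Hom expnS expn1.
suff -> : lker T = 0%VS by rewrite capv0.
by apply/eqP/lker0P => P Q; rewrite !TE; apply: tensf1_inj.
Qed.

Lemma dim_B_End lam : is_partition n lam ->
  \dim (Bn_Hom (B lam) (B lam)) = (if odd n then 2 else 1)%N.
Proof.
move=> lamP; have [d2 <-] := dim_clifford_module U_simple.
have /eqP := dim_equivariants (B lam) (B lam); rewrite dim_equivariants_B // d2.
by rewrite eqn_pmul2l ?expn_gt0 // => /eqP.
Qed.

End BnSimple.

Theorem proposition4p3 (R : realType) (n : nat) (n_ge1 : (1 <= n)%N)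
    (U : supermodule (Cl R[i] n)) (U_simple : smod_simple U) :
  [/\ forall lam : seq nat, is_partition n lam ->
        smod_simple (Bmodule U lam),
      forall lam mu : seq nat, is_partition n lam -> is_partition n mu ->
        isomorphic (Bmodule U lam) (Bmodule U mu) -> lam = mu,
      forall M : supermodule (CB R[i] n), smod_simple M ->
        exists2 lam : seq nat, is_partition n lam &
          isomorphic M (Bmodule U lam) &
      forall lam : seq nat, is_partition n lam ->
        (~~ odd n -> typeM (Bmodule U lam)) /\
        (odd n -> typeQ (Bmodule U lam))].
Proof.
split=> [lam lamP|lam mu lamP muP iso|M simM|lam lamP].
- exact: B_simple.
- exact: B_isomorphic_inj iso.
- exact: B_complete.
have dimB := dim_B_End U_simple lamP; have homB := Bn_Hom_space (Bmodule U lam) (Bmodule U lam).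
split=> [/negbTE even_n|odd_n]; split; try exact: B_simple.
  by exists (Bn_Hom (Bmodule U lam) (Bmodule U lam)); rewrite // dimB even_n.
by exists (Bn_Hom (Bmodule U lam) (Bmodule U lam)); rewrite // dimB odd_n.
Qed.
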